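(* Assume $Q\ge0$, $(A-\frac\rho2I,\sqrt Q)$ is observable, and $(A+G-\frac\rho2I,\sqrt Q(I-\Gamma))$ is observable. Let $(\mathrm{R}_P)$ and $(\mathrm R_\Pi)$ denote the algebraic Riccati equations $$(\mathrm R_P)\ \ \rho P=A^TP+PA-PBR^{-1}B^TP+Q,\qquad (\mathrm R_\Pi)\ \ \rho\Pi=(A+G)^T\Pi+\Pi(A+G)-\Pi BR^{-1}B^T\Pi+\hat Q,$$ with $\hat Q=(I-\Gamma)^TQ(I-\Gamma)$. Then the following statements are equivalent: (i) The decentralized control laws $\hat u_i$ described in the context are well defined (i.e. there are symmetric $P,\Pi$ solving $(\mathrm R_P)$, $(\mathrm R_\Pi)$ and associated $s,\bar x\in C_{\rho/2}([0,\infty),\mathbb R^n)$), and with them, for any initial condition $(\hat x_1(0),\dots,\hat x_N(0))$ such that the $\hat x_i(0)$ are mutually independent with common mean $\bar x_0$, $\max_i\mathbb E\|\hat x_i(0)\|^2<C_0$ ($C_0$ independent of $N$), and $\{\hat x_i(0)\}$ independent of $\{W_i\}$, $$\sum_{i=1}^N\mathbb E\int_0^\infty e^{-\rho t}\big(\|\hat x_i(t)\|^2+\|\hat u_i(t)\|^2\big)dt<\infty.$$ (ii) $(\mathrm R_P)$ and $(\mathrm R_\Pi)$ admit unique solutions $P>0$, $\Pi>0$, respectively, and $\bar A+G-\frac\rho2I$ is Hurwitz, where $\bar A=A-BR^{-1}B^TP$. (iii) $(A-\frac\rho2I,B)$ is stabilizable, $(A+G-\frac\rho2I,B)$ is stabilizable,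 and $\bar A+G-\frac\rho2I$ is Hurwitz, where $\bar A=A-BR^{-1}B^TP$ with $P$ the positive definite solution of $(\mathrm R_P)$.
   Context: $N$ is the number of agents, $\rho>0$ a discount constant. $A,G,\Gamma,Q\in\mathbb R^{n\times n}$, $B\in\mathbb R^{n\times r}$, $R\in\mathbb R^{r\times r}$, $\eta\in\mathbb R^n$ are constant, $Q,R$ symmetric, $R>0$. $C_{\rho/2}([0,\infty),\mathbb R^n)$ is the set of continuous $g:[0,\infty)\to\mathbb R^n$ with $\int_0^\infty e^{-\rho t}\|g(t)\|^2dt<\infty$; $f,\sigma\in C_{\rho/2}([0,\infty),\mathbb R^n)$. $W_1,\dots,W_N$ are independent one-dimensional Brownian motions. A matrix is Hurwitz if all its eigenvalues have negative real part. Control laws: given symmetric solutions $P,\Pi$ of the two Riccati equations in the claim, $s,\bar x\in C_{\rho/2}([0,\infty),\mathbb R^n)$ are determined by $$\rho s=\dot s+[A+G-BR^{-1}B^T\Pi]^Ts+\Pi f-\bar\eta,\qquad \frac{d\bar x}{dt}=(A+G)\bar x-BR^{-1}B^T(\Pi\bar x+s)+f,\quad \bar x(0)=\bar x_0,$$ with $\bar\eta=Q\eta-\Gamma^TQ\eta$, and for $t\ge0$, $i=1,\dots,N$, $$\hat u_i(t)=-R^{-1}B^T[P\hat x_i(t)+(\Pi-P)\bar x(t)+s(t)],$$ where $\hat x_i$ are the closed-loop states: $d\hat x_i=[A\hat x_i+B\hat u_i+G\hat x^{(N)}+f]dt+\sigma dW_i$, $\hat x^{(N)}=\frac1N\sum_{j=1}^N\hat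 x_j$.
   Formalization: The number of agents is taken to be N ≥ 2: for N = 1 the equivalence fails (n = 1, B = 0, Γ = 0, Q > 0, A > ρ/2 > A+G gives (i) but P < 0); initial conditions may live on an extension of the probability space carrying the W_i. *)

(* Defs.v *)
From HB Require Import structures.
From mathcomp Require Import all_boot all_order all_algebra.
From mathcomp Require Import all_classical all_reals all_analysis.
From mathcomp Require Import complex.

Set Implicit Arguments.
Unset Strict Implicit.
Unset Printing Implicit Defensive.

Import Order.TTheory GRing.Theory Num.Theory.
Import numFieldNormedType.Exports.

Local Open Scope classical_set_scope.
Local Open Scope ring_scope.

Section LinearSystems.
Context {R : realType}.

(* The library norm on matrices is the sup norm; this is the squared
   Euclidean norm. *)
Definition sqnorm n (v : 'cV[R]_n) : R := \sum_(k < n) v k 0 ^+ 2.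

Definition psdmx n (M : 'M[R]_n) : Prop :=
  M^T = M /\ forall v : 'cV[R]_n, 0 <= (v^T *m M *m v) 0 0.

Definition pdmx n (M : 'M[R]_n) : Prop :=
  M^T = M /\ forall v : 'cV[R]_n, v != 0 -> 0 < (v^T *m M *m v) 0 0.

(* [S] is the (unique) positive semidefinite square root of [M]. *)
Definition is_sqrtmx n (M S : 'M[R]_n) : Prop := psdmx S /\ S *m S = M.

Definition hurwitz n (M : 'M[R]_n) : Prop :=
  forall lam : R[i],
    eigenvalue (map_mx (real_complex R) M) lam -> complex.Re lam < 0.

Definition stabilizable n r (A : 'M[R]_n) (B : 'M[R]_(n, r)) : Prop :=
  exists K : 'M[R]_(r, n), hurwitz (A + B *m K).

(* [x] is a classical solution of x'(t) = F t (x t) on [0, +oo[.  The equation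
   is required at t > 0 only; for continuous [F] and [x] it then holds at 0
   for the right derivative. *)
Definition ode_sol n (F : R -> 'cV[R]_n -> 'cV[R]_n) (x : R -> 'cV[R]_n) :
    Prop :=
  {within `[0, +oo[, continuous x} /\
  forall t : R, 0 < t -> is_derive t (1 : R) x (F t (x t)).

(* The output C x(t), t >= 0, of x' = A x determines the initial state. *)
Definition observable n p (A : 'M[R]_n) (C : 'M[R]_(p, n)) : Prop :=
  forall x y : R -> 'cV[R]_n,
    ode_sol (fun _ v => A *m v) x -> ode_sol (fun _ v => A *m v) y ->
    (forall t, 0 <= t -> C *m x t = C *m y t) -> x 0 = y 0.

(* The discounted algebraic Riccati equation
   rho P = A^T P + P A - P B Rm^-1 B^T P + Q. *)
Definition riccati n r (rho : R) (A : 'M[R]_n) (B : 'M[R]_(n, r))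
    (Rm : 'M[R]_r) (Q P : 'M[R]_n) : Prop :=
  rho *: P
  = A^T *m P + P *m A - P *m B *m invmx Rm *m B^T *m P + Q.

(* The space C_{rho/2}([0, +oo[, R^n). *)
Definition Crho n (rho : R) (g : R -> 'cV[R]_n) : Prop :=
  {within `[0, +oo[, continuous g} /\
  (\int[lebesgue_measure]_(t in `[0%R, +oo[)
      (expR (- rho * t) * sqnorm (g t))%:E < +oo)%E.

End LinearSystems.

Section Probability.
Context {R : realType} {d : measure_display} {Omega : measurableType d}.
Variable Pr : probability Omega R.

Definition sigma_of (J : Type) (D : set J) (X : J -> Omega -> R) :
    set (set Omega) :=
  <<s [set E | exists2 j, D j & exists2 B, measurable B & E = X j @^-1` B] >>.

Definition indep2 (F F' : set (set Omega)) : Prop :=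
  forall E E', F E -> F' E' -> Pr (E `&` E') = (Pr E * Pr E')%E.

Definition mutually_indep (I : finType) (F : I -> set (set Omega)) : Prop :=
  forall (J : {set I}) (E : I -> set Omega),
    (forall i, i \in J -> F i (E i)) ->
    Pr (\bigcap_(i in [set` J]) E i) = (\prod_(i in J) Pr (E i))%E.

(* Processes are indexed by all of [R]; only the times t >= 0 matter. *)
Definition brownian_motion (w : R -> Omega -> R) : Prop :=
  [/\ forall t, 0 <= t -> measurable_fun setT (w t),
      {ae Pr, forall om, w 0 om = 0},
      forall s t, 0 <= s -> s < t -> forall E : set R, measurable E ->
        Pr [set om | E (w t om - w s om)] = normal_prob 0 (Num.sqrt (t - s)) E,
      forall s t, 0 <= s -> s <= t ->
        indep2 (sigma_of [set u | 0 <= u <= s] w)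
               (sigma_of [set: unit] (fun _ om => w t om - w s om)) &
      forall om, {within `[0, +oo[, continuous (fun t => w t om)}].

Definition indep_brownian_motions (N : nat) (W : 'I_N -> R -> Omega -> R) :
    Prop :=
  (forall i, brownian_motion (W i)) /\
  mutually_indep (fun i => sigma_of [set t : R | 0 <= t] (W i)).

Definition riemann_ito_sum (g : R -> R) (w : R -> Omega -> R) (t : R) (m : nat)
    (om : Omega) : R :=
  \sum_(j < m.+1) g (j%:R * t / m.+1%:R)
    * (w (j.+1%:R * t / m.+1%:R) om - w (j%:R * t / m.+1%:R) om).

(* [X] is the process t |-> \int_0^t g dw for a deterministic continuous
   integrand [g]: for such [g] the Ito integral is the L^2 limit of the
   left-endpoint Riemann sums.  This determines each [X t] almost surely. *)
Definition wiener_integral (g : R -> R) (w X : R -> Omega -> R) : Prop :=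
  forall t, 0 <= t ->
    measurable_fun setT (X t) /\
    ('E_Pr[fun om => ((riemann_ito_sum g w t m om - X t om) ^+ 2)%R]%E
       @[m --> \oo] --> 0%E).

(* [x] solves, for i < N,
     dx_i = b i t (x_1, ..., x_N) dt + sg(t) dW_i,   t >= 0.
   The noise is additive and deterministic, so the integral form below needs
   no filtration: its solution is automatically adapted. *)
Definition sde_sol (N n : nat) (W : 'I_N -> R -> Omega -> R)
    (sg : R -> 'cV[R]_n)
    (b : 'I_N -> R -> ('I_N -> 'cV[R]_n) -> 'cV[R]_n)
    (x : 'I_N -> R -> Omega -> 'cV[R]_n) : Prop :=
  [/\ forall i t k, 0 <= t -> measurable_fun setT (fun om => x i t om k 0),
      forall i om, {within `[0, +oo[, continuous (fun t => x i t om)} &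
      exists Z : 'I_N -> R -> Omega -> 'cV[R]_n,
        (forall i k, wiener_integral (fun t => sg t k 0) (W i)
                       (fun t om => Z i t om k 0)) /\
        {ae Pr, forall om, forall i k t, 0 <= t ->
           x i t om k 0
           = x i 0 om k 0
             + \int[lebesgue_measure]_(tau in `[0, t])
                 (b i tau (fun j => x j tau om)) k 0
             + Z i t om k 0}].

(* [y i] is the initial state of agent [i]. *)
Definition admissible_initial (N n : nat) (W : 'I_N -> R -> Omega -> R)
    (xbar0 : 'cV[R]_n) (C0 : R) (y : 'I_N -> Omega -> 'cV[R]_n) : Prop :=
  [/\ forall i k, measurable_fun setT (fun om => y i om k 0),
      mutually_indep
        (fun i => sigma_of [set: 'I_n] (fun k om => y i om k 0)),
      forall i k, ('E_Pr[fun om => (y i om k 0)%R] = ((xbar0 k 0)%R)%:E)%E,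
      forall i, ('E_Pr[fun om => sqnorm (y i om)] < C0%:E)%E &
      indep2
        (sigma_of [set: 'I_N * 'I_n] (fun p om => y p.1 om p.2 0))
        (sigma_of [set p : 'I_N * R | 0 <= p.2] (fun p => W p.1 p.2))].

End Probability.

Section MeanFieldControl.
Context {R : realType}.

Definition feedback n r (B : 'M[R]_(n, r)) (Rm : 'M[R]_r) (P Pi : 'M[R]_n)
    (xbar s : R -> 'cV[R]_n) (t : R) (v : 'cV[R]_n) : 'cV[R]_r :=
  - (invmx Rm *m B^T *m (P *m v + (Pi - P) *m xbar t + s t)).

Definition state_mean N n (v : 'I_N -> 'cV[R]_n) : 'cV[R]_n :=
  N%:R^-1 *: \sum_(j < N) v j.

Definition closed_loop_drift N n r (A G : 'M[R]_n) (B : 'M[R]_(n, r))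
    (f : R -> 'cV[R]_n) (u : R -> 'cV[R]_n -> 'cV[R]_r)
    (i : 'I_N) (t : R) (v : 'I_N -> 'cV[R]_n) : 'cV[R]_n :=
  A *m v i + B *m u t (v i) + G *m state_mean v + f t.

(* rho s = s' + (A + G - B Rm^-1 B^T Pi)^T s + Pi f - etabar, solved for s',
   with etabar = Q eta - Gam^T Q eta; no boundary value is prescribed, the
   growth condition [Crho] takes its place. *)
Definition offset_eq n r (rho : R) (A G Gam Q : 'M[R]_n) (B : 'M[R]_(n, r))
    (Rm : 'M[R]_r) (eta : 'cV[R]_n) (f : R -> 'cV[R]_n) (Pi : 'M[R]_n)
    (s : R -> 'cV[R]_n) : Prop :=
  ode_sol (fun t v => rho *: v - (A + G - B *m invmx Rm *m B^T *m Pi)^T *m v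
                      - Pi *m f t + (Q *m eta - Gam^T *m Q *m eta)) s.

Definition mean_field_eq n r (A G : 'M[R]_n) (B : 'M[R]_(n, r))
    (Rm : 'M[R]_r) (f : R -> 'cV[R]_n) (xbar0 : 'cV[R]_n) (Pi : 'M[R]_n)
    (s xbar : R -> 'cV[R]_n) : Prop :=
  xbar 0 = xbar0 /\
  ode_sol (fun t v => (A + G) *m v - B *m invmx Rm *m B^T *m (Pi *m v + s t)
                      + f t) xbar.

Definition Qhat n (Q Gam : 'M[R]_n) : 'M[R]_n :=
  (1%:M - Gam)^T *m Q *m (1%:M - Gam).

Definition Abar n r (A : 'M[R]_n) (B : 'M[R]_(n, r)) (Rm : 'M[R]_r)
    (P : 'M[R]_n) : 'M[R]_n :=
  A - B *m invmx Rm *m B^T *m P.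

Definition total_cost N n r (rho : R) (d : measure_display)
    (Omega : measurableType d) (Pr : probability Omega R)
    (u : R -> 'cV[R]_n -> 'cV[R]_r)
    (x : 'I_N -> R -> Omega -> 'cV[R]_n) : \bar R :=
  (\sum_(i < N) \int[Pr]_om \int[lebesgue_measure]_(t in `[0%R, +oo[)
     (expR (- rho * t)
      * (sqnorm (x i t om) + sqnorm (u t (x i t om))))%:E)%E.

(* The initial states may use randomness that is not available on [Omega]
   (they are to be independent of all of [W]), so they range over all
   extensions [phi : Omega' -> Omega] of the given probability space, on which
   the Brownian motions are the pullbacks of [W]. *)
Definition uniformly_stabilizing N n r (rho : R) (A G : 'M[R]_n)
    (B : 'M[R]_(n, r)) (f sg : R -> 'cV[R]_n) (xbar0 : 'cV[R]_n)
    (d : measure_display) (Omega : measurableType d)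
    (Pr : probability Omega R) (W : 'I_N -> R -> Omega -> R)
    (u : R -> 'cV[R]_n -> 'cV[R]_r) : Prop :=
  forall (d' : measure_display) (Omega' : measurableType d')
    (Pr' : probability Omega' R) (phi : Omega' -> Omega),
    measurable_fun setT phi ->
    (forall E, measurable E -> Pr' (phi @^-1` E) = Pr E) ->
    let W' := fun i t om => W i t (phi om) in
    forall (C0 : R) (x : 'I_N -> R -> Omega' -> 'cV[R]_n),
      admissible_initial Pr' W' xbar0 C0 (fun i => x i 0) ->
      sde_sol Pr' W' sg (closed_loop_drift A G B f u) x ->
      (total_cost rho Pr' u x < +oo)%E.

End MeanFieldControl.

(* Main.v *)
(** After the discount factor exp(- rho t / 2) is absorbed into the state, the
closed loop splits into the population mean, driven by Abar + G, and the
deviations from the mean, driven by Abar.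

(ii) -> (i): subtracting the noise, a Wiener integral, from a closed-loop path
leaves an ordinary linear equation path by path. A quadratic Lyapunov form of a
Hurwitz matrix bounds the L2 norm of its solution by that of the forcing, whose
expectation is finite by the Ito isometry. The offset equation is antistable;
its bounded solution is obtained by integrating backward from infinity.

(i) -> (ii): the hypothesis is vacuous unless the closed loop has a solution, so
a continuous version of the Wiener integral is needed: integrals of step
functions are Cauchy uniformly on compacts by Kolmogorov's maximal inequality
and the Borel-Cantelli lemma. Compare the solution starting at the mean with the
one whose agent i0 starts at the mean plus or minus v, the sign being a fair
coin on an enlarged probability space. Noise and offsets cancel in the
difference, which is a combination of the solutions of q' = Abar q and
p' = (Abar + G) p starting at v. Finite cost makes both square integrable for
every v, hence Abar - rho/2 and Abar + G - rho/2 are Hurwitz.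

Riccati equations: a positive definite solution is stabilizing by LaSalle's
principle and observability. Existence under stabilizability is Kleinman's
policy iteration: the Lyapunov equations of the successive gains have decreasing
solutions. Two stabilizing solutions dominate each other. *)

Require Import Defs.
From HB Require Import structures.
From mathcomp Require Import all_boot all_order all_algebra.
From mathcomp Require Import all_classical all_reals all_analysis.
From mathcomp Require Import measurable_realfun complex ring lra spectral.

Set Implicit Arguments.
Unset Strict Implicit.
Unset Printing Implicit Defensive.

Import Order.TTheory GRing.Theory Num.Theory.
Import numFieldNormedType.Exports.

Local Open Scope classical_set_scope.
Local Open Scope ring_scope.

(** * Quadratic forms and Lyapunov functions *)

(** Statement (i) only makes [P] and [Pi] symmetric, so neither is known to be positive or
    stabilizing. What can be extracted from it is that the gain of [P] stabilizes both [A - rho/2]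
    and [A + G - rho/2]. This produces positive definite solutions of both equations, and [P] is
    identified with the new one because two stabilizing solutions agree. Admissible initial states
    must share the mean [xbar0], so one agent cannot simply be shifted by v: the random sign keeps
    the mean, and since all other agents stay deterministic, mutual independence is trivial. The
    sign has to be independent of the Brownian motions, hence the enlarged space. With a single
    agent only [Abar + G] would be visible; a second one separates the deviations from the mean. The
    estimates are energy inequalities integrated in time, path by path. No exponential decay of the
    flow is ever proved: a function with bounded integral is small at some time, and this replaces
    limits at infinity. *)

Section MatrixEntries.
Context {R : pzRingType} {m n : nat}.
Implicit Types U V : 'M[R]_(m, n).

(** Rewriting with [mxE] would also expand matrix products into sums. These rules stop at the linear
    operations, so that products stay folded and [ring] treats their entries as atoms. *)
Lemma mxDE U V i j : (U + V) i j = U i j + V i j. Proof. by rewrite mxE. Qed.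
Lemma mxNE U i j : (- U) i j = - U i j. Proof. by rewrite mxE. Qed.
Lemma mxBE U V i j : (U - V) i j = U i j - V i j.
Proof. by rewrite mxDE mxNE. Qed.
Lemma mxZE a U i j : (a *: U) i j = a * U i j. Proof. by rewrite mxE. Qed.

End MatrixEntries.

Section ComplexMatrices.
Context {R : realType}.

Definition mxRe m n (U : 'M[R[i]]_(m, n)) : 'M[R]_(m, n) :=
  map_mx (@complex.Re R) U.
Definition mxIm m n (U : 'M[R[i]]_(m, n)) : 'M[R]_(m, n) :=
  map_mx (@complex.Im R) U.

Lemma complex_Re_sum (I : Type) (s : seq I) (F : I -> R[i]) :
  complex.Re (\sum_(i <- s) F i) = \sum_(i <- s) complex.Re (F i).
Proof. by apply: (big_morph (@complex.Re R)) => // -[a b] [c d]. Qed.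

Lemma complex_Im_sum (I : Type) (s : seq I) (F : I -> R[i]) :
  complex.Im (\sum_(i <- s) F i) = \sum_(i <- s) complex.Im (F i).
Proof. by apply: (big_morph (@complex.Im R)) => // -[a b] [c d]. Qed.

Lemma mxRe_mul m n p (U : 'M[R[i]]_(m, n)) (V : 'M[R[i]]_(n, p)) :
  mxRe (U *m V) = mxRe U *m mxRe V - mxIm U *m mxIm V.
Proof.
apply/matrixP => i j; rewrite !mxE complex_Re_sum -sumrB.
by apply: eq_bigr => k _; rewrite !mxE; case: (U i k) => a b; case: (V k j).
Qed.

Lemma mxIm_mul m n p (U : 'M[R[i]]_(m, n)) (V : 'M[R[i]]_(n, p)) :
  mxIm (U *m V) = mxRe U *m mxIm V + mxIm U *m mxRe V.
Proof.
apply/matrixP => i j; rewrite !mxE complex_Im_sum -big_split.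
by apply: eq_bigr => k _; rewrite !mxE; case: (U i k) => a b; case: (V k j).
Qed.

Lemma mxRe_real m n (U : 'M[R]_(m, n)) : mxRe (map_mx (real_complex R) U) = U.
Proof. by apply/matrixP => i j; rewrite !mxE. Qed.

Lemma mxIm_real m n (U : 'M[R]_(m, n)) : mxIm (map_mx (real_complex R) U) = 0.
Proof. by apply/matrixP => i j; rewrite !mxE. Qed.

Lemma complex_mx0 m n (U : 'M[R[i]]_(m, n)) :
  mxRe U = 0 -> mxIm U = 0 -> U = 0.
Proof.
move=> /matrixP Ur /matrixP Ui; apply/matrixP => i j; rewrite !mxE.
move: (Ur i j) (Ui i j); rewrite !mxE; case: (U i j) => a b /= -> ->.
by [].
Qed.

(* Real and imaginary parts of a right eigenvector; [eigenvalue] speaks of left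
   eigenvectors. *)
Lemma eigenvalue_realP n (M : 'M[R]_n) (lam : R[i]) :
  eigenvalue (map_mx (real_complex R) M) lam ->
  exists a b : 'cV[R]_n, [/\ a != 0 \/ b != 0,
    M *m a = complex.Re lam *: a - complex.Im lam *: b &
    M *m b = complex.Im lam *: a + complex.Re lam *: b].
Proof.
move=> /eigenvalueP[v0 v0E v00].
(* A left eigenvector makes a determinant vanish; the transpose has the same determinant, and its
   left kernel gives the right eigenvector. *)
have : exists2 v : 'rV[R[i]]_n, v != 0 & v *m (map_mx (real_complex R) M - lam%:M)^T = 0.
  apply/det0P; rewrite det_tr; apply/det0P; exists v0 => //.
  by rewrite mulmxBr v0E mul_mx_scalar subrr.
move=> [v v0' /(congr1 trmx)]; rewrite trmx_mul trmxK trmx0 mulmxBl mul_scalar_mx.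
move=> /eqP; rewrite subr_eq0 => /eqP Mv.
have Mre : M *m mxRe v^T = mxRe (lam *: v^T).
  by rewrite -Mv mxRe_mul mxRe_real mxIm_real mul0mx subr0.
have Mim : M *m mxIm v^T = mxIm (lam *: v^T).
  by rewrite -Mv mxIm_mul mxRe_real mxIm_real mul0mx addr0.
exists (mxRe v^T), (mxIm v^T); split.
- have [a0|] := eqVneq (mxRe v^T) 0; last by left.
  have [b0|] := eqVneq (mxIm v^T) 0; last by right.
  by move: v0'; rewrite -[v]trmxK (complex_mx0 a0 b0) trmx0 eqxx.
- rewrite Mre; apply/matrixP => i j; rewrite !mxE.
  by case: (lam) => x y; case: (v j i).
- rewrite Mim; apply/matrixP => i j; rewrite !mxE.
  by case: (lam) => x y; case: (v j i) => c d; rewrite /= addrC.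
Qed.

End ComplexMatrices.

Section QuadraticForms.
Context {R : realType}.

Definition qf n (X : 'M[R]_n) (u v : 'cV[R]_n) : R := (u^T *m X *m v) 0 0.

Lemma qfDl n (X : 'M[R]_n) u1 u2 v : qf X (u1 + u2) v = qf X u1 v + qf X u2 v.
Proof. by rewrite /qf linearD /= !mulmxDl mxE. Qed.
Lemma qfDr n (X : 'M[R]_n) u v1 v2 : qf X u (v1 + v2) = qf X u v1 + qf X u v2.
Proof. by rewrite /qf mulmxDr mxE. Qed.
Lemma qfZl n (X : 'M[R]_n) a u v : qf X (a *: u) v = a * qf X u v.
Proof. by rewrite /qf linearZ /= -!scalemxAl mxE. Qed.
Lemma qfZr n (X : 'M[R]_n) a u v : qf X u (a *: v) = a * qf X u v.
Proof. by rewrite /qf -scalemxAr mxE. Qed.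
Lemma qfNl n (X : 'M[R]_n) u v : qf X (- u) v = - qf X u v.
Proof. by rewrite -scaleN1r qfZl mulN1r. Qed.
Lemma qfNr n (X : 'M[R]_n) u v : qf X u (- v) = - qf X u v.
Proof. by rewrite -scaleN1r qfZr mulN1r. Qed.
Lemma qf0l n (X : 'M[R]_n) v : qf X 0 v = 0.
Proof. by rewrite -(scale0r 0) qfZl mul0r. Qed.
Lemma qfDx n (X Y : 'M[R]_n) u v : qf (X + Y) u v = qf X u v + qf Y u v.
Proof. by rewrite /qf mulmxDr mulmxDl mxE. Qed.
Lemma qfNx n (X : 'M[R]_n) u v : qf (- X) u v = - qf X u v.
Proof. by rewrite /qf mulmxN mulNmx mxE. Qed.
Lemma qfC n (X : 'M[R]_n) u v : qf X u v = qf X^T v u.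
Proof.
rewrite /qf; transitivity ((u^T *m X *m v)^T 0 0); first by rewrite [RHS]mxE.
by rewrite !trmx_mul trmxK mulmxA.
Qed.
Lemma qf_mull n m (X : 'M[R]_n) (F : 'M[R]_(n, m)) u v :
  qf X (F *m u) v = (u^T *m (F^T *m X) *m v) 0 0.
Proof. by rewrite /qf trmx_mul !mulmxA. Qed.
Lemma qf_mulr n m (X : 'M[R]_n) (F : 'M[R]_(n, m)) u v :
  qf X u (F *m v) = (u^T *m (X *m F) *m v) 0 0.
Proof. by rewrite /qf !mulmxA. Qed.

Lemma sqnormE n (v : 'cV[R]_n) : sqnorm v = qf 1%:M v v.
Proof.
by rewrite /qf mulmx1 mxE; apply: eq_bigr => k _; rewrite !mxE expr2.
Qed.

Lemma sqnorm_ge0 n (v : 'cV[R]_n) : 0 <= sqnorm v.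
Proof. by apply: sumr_ge0 => k _; rewrite sqr_ge0. Qed.

Lemma sqnorm_eq0 n (v : 'cV[R]_n) : sqnorm v = 0 -> v = 0.
Proof.
move=> /eqP; rewrite psumr_eq0; last by move=> k _; rewrite sqr_ge0.
move=> /allP v0; apply/matrixP => i j; rewrite ord1 !mxE.
by have := v0 i; rewrite mem_index_enum => /(_ isT); rewrite sqrf_eq0 => /eqP.
Qed.

Lemma sqnormD_le n (u v : 'cV[R]_n) :
  sqnorm (u + v) <= 2 * sqnorm u + 2 * sqnorm v.
Proof.
rewrite /sqnorm !mulr_sumr -big_split; apply: ler_sum => k _; rewrite mxE /=.
have := sqr_ge0 (u k 0 - v k 0); nra.
Qed.

Lemma sqnormZ n a (v : 'cV[R]_n) : sqnorm (a *: v) = a ^+ 2 * sqnorm v.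
Proof. by rewrite mulr_sumr; apply: eq_bigr => k _; rewrite mxE exprMn. Qed.

Lemma sqnormN n (v : 'cV[R]_n) : sqnorm (- v) = sqnorm v.
Proof. by apply: eq_bigr => k _; rewrite mxE sqrrN. Qed.

Lemma sqnorm0 n : sqnorm (0 : 'cV[R]_n) = 0.
Proof. by apply: big1 => k _; rewrite mxE expr0n. Qed.

Lemma pdmx_psd n (X : 'M[R]_n) : pdmx X -> psdmx X.
Proof.
move=> [Xs X0]; split => // v; have [->|/X0/ltW//] := eqVneq v 0.
by rewrite mulmx0 mxE.
Qed.

(** The polynomial t -> X(u + t v) is nonnegative; evaluate it at its minimizer - X(u, v) / X(v, v).
    In the degenerate case X(v, v) = 0 it is affine, and a nonnegative affine function is
    constant. *)
Lemma psd_cauchy n (X : 'M[R]_n) u v : psdmx X ->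
  qf X u v ^+ 2 <= qf X u u * qf X v v.
Proof.
move=> [Xs X0].
have X0' w : 0 <= qf X w w by exact: X0.
have Xc : qf X v u = qf X u v by rewrite qfC Xs.
have quad t : 0 <= qf X u u + 2 * t * qf X u v + t ^+ 2 * qf X v v.
  have := X0' (u + t *: v); rewrite !(qfDl, qfDr, qfZl, qfZr) Xc; nra.
have [v0|v0] := eqVneq (qf X v v) 0.
  have := quad (- (qf X u v) * (1 + qf X u u)); rewrite v0.
  have := X0' u; set a := qf X u u; set b := qf X u v.
  move=> a0; rewrite !mulr0 addr0 => H; suff : b ^+ 2 <= 0 by [].
  have [b0|b0] := eqVneq b 0; first by rewrite b0 expr0n.
  have : 0 < b ^+ 2 by rewrite exprn_even_gt0.
  have : a + 2 * (- b * (1 + a)) * b = a - 2 * b ^+ 2 - 2 * a * b ^+ 2 by ring.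
  move=> E; move: H; rewrite E => H.
  (* At t = - (1 + a) / b the affine function takes the value - a - 2, which is negative. *)
  have quad2 := quad (- b^-1 * (1 + a)).
  move: quad2; rewrite v0 mulr0 addr0.
  have -> : 2 * (- b^-1 * (1 + a)) * qf X u v = - 2 * (1 + a).
    by rewrite -/b; field.
  rewrite -/a; lra.
have vp : 0 < qf X v v by rewrite lt_neqAle eq_sym v0 X0'.
have := quad (- (qf X u v) / qf X v v).
set a := qf X u u; set b := qf X u v; set c := qf X v v in vp v0 *.
have -> : a + 2 * (- b / c) * b + (- b / c) ^+ 2 * c = (a * c - b ^+ 2) / c.
  by field.
by rewrite pmulr_lge0 ?invr_gt0 // subr_ge0.
Qed.

(** Cauchy-Schwarz for the pair X v, v bounds |X v|^4 by a multiple of X(v, v). *)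
Lemma psd_qf0 n (X : 'M[R]_n) v : psdmx X -> qf X v v = 0 -> X *m v = 0.
Proof.
move=> Xp v0; apply: sqnorm_eq0; apply/eqP.
have := @psd_cauchy n X (X *m v) v Xp.
rewrite v0 mulr0 /qf trmx_mul Xp.1 => H.
have E : sqnorm (X *m v) = (v^T *m X *m X *m v) 0 0.
  by rewrite sqnormE /qf mulmx1 trmx_mul Xp.1 !mulmxA.
by rewrite -sqrf_eq0 eq_le E sqr_ge0 H.
Qed.

(** Expansion of c times the nonnegative value X(u - v / c). *)
Lemma psd_young n (X : 'M[R]_n) c u v : psdmx X -> 0 < c ->
  2 * qf X u v <= c * qf X u u + c^-1 * qf X v v.
Proof.
move=> [Xs X0] c0.
have Xc : qf X v u = qf X u v by rewrite qfC Xs.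
have := X0 (u - c^-1 *: v); rewrite -/(qf _ _ _).
rewrite !(qfDl, qfDr, qfNl, qfNr, qfZl, qfZr) Xc.
set a := qf X u u; set b := qf X u v; set d := qf X v v => H.
rewrite -subr_ge0; have -> : c * a + c^-1 * d - 2 * b =
   c * (a + - (c^-1 * b) + (- (c^-1 * b) - - (c^-1 * (c^-1 * d)))).
  by field; rewrite gt_eqF.
by rewrite mulr_ge0 // ltW.
Qed.

Lemma qf_ub n (X : 'M[R]_n) : exists2 C : R, 0 < C & forall v, qf X v v <= C * sqnorm v.
Proof.
pose s : R := \sum_i \sum_j `|X i j|.
have s0 : 0 <= s by apply: sumr_ge0 => i _; apply: sumr_ge0.
(* The added 1 keeps the constant positive when X = 0. *)
exists (s + 1); first by rewrite ltr_pwDr.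
move=> v; apply: (@le_trans _ _ (s * sqnorm v)); last first.
  by rewrite ler_wpM2r ?sqnorm_ge0 // lerDl.
have -> : qf X v v = \sum_i \sum_j X i j * (v i 0 * v j 0).
  rewrite /qf mxE exchange_big; apply: eq_bigr => j _.
  rewrite mxE mulr_suml; apply: eq_bigr => i _; rewrite !mxE; ring.
rewrite mulr_suml; apply: ler_sum => i _; rewrite mulr_suml; apply: ler_sum => j _.
apply: le_trans (ler_norm _) _; rewrite normrM ler_wpM2l //.
have vle k : v k 0 ^+ 2 <= sqnorm v.
  by rewrite /sqnorm (bigD1 k) //= lerDl sumr_ge0 // => ? _; rewrite sqr_ge0.
have := vle i; have := vle j; have := sqr_ge0 (v i 0 - v j 0).
by have := sqr_ge0 (v i 0 + v j 0); rewrite ler_norml; nra.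
Qed.

Lemma pdmx_unit n (X : 'M[R]_n) : pdmx X -> X \in unitmx.
Proof.
move=> [Xs X0]; rewrite -row_free_unit -kermx_eq0; apply: contraT.
move=> /rowV0Pn[v /sub_kermxP vX v0].
have := X0 v^T; rewrite trmxK vX mul0mx mxE ltxx; apply.
by apply: contra v0 => /eqP /(congr1 trmx); rewrite trmxK trmx0 => ->.
Qed.

(** No compactness of the sphere is involved: the coordinate v_k equals X(X^-1 e_k, v), so
    Cauchy-Schwarz bounds v_k^2 by X(v, v) times a constant, and the sum of these constants,
    increased by 1, is 1 / c. *)
Lemma pdmx_lb n (X : 'M[R]_n) : pdmx X ->
  exists2 c : R, 0 < c & forall v, c * sqnorm v <= qf X v v.
Proof.
move=> Xp; have Xu := pdmx_unit Xp; have Xpsd := pdmx_psd Xp.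
have e (k : 'I_n) (v : 'cV[R]_n) : v k 0 = qf X (invmx X *m delta_mx k 0) v.
  rewrite qf_mull trmx_inv Xp.1 mulVmx // mulmx1 mxE.
  rewrite (bigD1 k) //= !mxE !eqxx mul1r big1 ?addr0 // => j jk.
  by rewrite !mxE (negbTE jk) mul0r.
pose s : R := \sum_k qf X (invmx X *m delta_mx k 0) (invmx X *m delta_mx k 0).
have s0 : 0 <= s by apply: sumr_ge0 => k _; apply: Xpsd.2.
exists (s + 1)^-1; first by rewrite invr_gt0 ltr_pwDr.
move=> v; rewrite mulrC ler_pdivrMr ?ltr_pwDr //.
have qv : 0 <= qf X v v by apply: Xpsd.2.
apply: (@le_trans _ _ (qf X v v * s)); last by rewrite ler_wpM2l // lerDl.
rewrite /sqnorm mulr_sumr; apply: ler_sum => k _; rewrite {1}e.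
by rewrite mulrC; apply: le_trans (psd_cauchy _ _ Xpsd) _; rewrite mulrC.
Qed.

Lemma sqnorm_mulmx n m (F : 'M[R]_(m, n)) : exists2 C : R, 0 < C &
  forall v, sqnorm (F *m v) <= C * sqnorm v.
Proof.
have [C C0 H] := @qf_ub n (F^T *m F); exists C => // v.
by apply: le_trans (H v); rewrite sqnormE /qf mulmx1 trmx_mul !mulmxA.
Qed.

End QuadraticForms.

Section LyapunovFunction.
Context {R : realType}.

(* A pointwise form of [X F + F^T X <= - 2 c X]: along solutions of x' = F x
   the form [X] decays at rate [2 c]. *)
Definition lyapunov n (F : 'M[R]_n) (X : 'M[R]_n) (c : R) : Prop :=
  [/\ pdmx X, 0 < c & forall v, qf X v (F *m v) <= - c * qf X v v].

(** [T] and [S] are meant as the real and imaginary parts of a lower triangular matrix, [p] and [q]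
    as those of a vector; the left side is what the strictly lower part contributes to the
    derivative of the weighted norm. A coupling of i to a smaller j carries the weight th^i, while
    Young's inequality can charge it to the larger weight th^j, so a small ratio th makes it
    harmless. *)
Lemma trig_weight_le n (T S : 'I_n -> 'I_n -> R) (c b : R) :
  0 < c -> (forall i j, `|T i j| <= b) -> (forall i j, `|S i j| <= b) ->
  exists2 th : R, 0 < th & forall p q : 'I_n -> R,
   \sum_(i < n) \sum_(j < n | (j < i)%N) th ^+ i *
     (p i * (T i j * p j - S i j * q j) + q i * (T i j * q j + S i j * p j))
   <= c * \sum_(i < n) th ^+ i * (p i ^+ 2 + q i ^+ 2).
Proof.
move=> c0 Tb Sb.
pose b1 : R := `|b| + 1; have b10 : 0 < b1 by rewrite ltr_pwDr.
pose N : R := n.+1%:R; have N0 : 0 < N by rewrite ltr0n.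
(* Young's inequality with weight e, and th = e^2, bounds each pair by b1 e times the weighted terms
   of i and j. Over n^2 pairs this sums to 2 n b1 e times the norm, whence the condition 2 N b1 e <=
   c; e <= 1 makes the weights nonincreasing. *)
pose e : R := Num.min 1 (c / (2 * N * b1)).
have e0 : 0 < e by rewrite lt_min ltr01 divr_gt0 // !mulr_gt0.
have e1 : e <= 1 by rewrite ge_min lexx.
have ec : 2 * N * b1 * e <= c.
  rewrite mulrC -ler_pdivlMr ?mulr_gt0 //.
  by rewrite ge_min lexx orbT.
exists (e ^+ 2); first by rewrite exprn_gt0.
set th : R := e ^+ 2; have th0 : 0 < th by rewrite exprn_gt0.
have th1 : th <= 1 by rewrite exprn_ile1 // ltW.
move=> p q; set w := fun i => p i ^+ 2 + q i ^+ 2.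
have w0 i : 0 <= w i by rewrite addr_ge0 ?sqr_ge0.
set V : R := \sum_(i < n) th ^+ i * (p i ^+ 2 + q i ^+ 2).
have V0 : 0 <= V.
  by apply: sumr_ge0 => i _; apply: mulr_ge0; [exact: exprn_ge0 (ltW th0)|exact: w0].
have term i j : p i * (T i j * p j - S i j * q j) + q i * (T i j * q j + S i j * p j)
    <= b1 * (e * w i + e^-1 * w j).
  pose x : R := `|p i| + `|q i|; pose y : R := `|p j| + `|q j|.
  have bb (z : R) : `|z| <= b -> `|z| <= b1.
    by move=> zb; apply: le_trans zb _; rewrite (le_trans (ler_norm _)) // lerDl.
  have H : p i * (T i j * p j - S i j * q j) + q i * (T i j * q j + S i j * p j)
    <= b1 * (x * y).
    have L (a z d : R) : `|z| <= b1 -> a * (z * d) <= b1 * (`|a| * `|d|).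
      move=> zb; apply: le_trans (ler_norm _) _; rewrite !normrM mulrCA.
      by rewrite ler_wpM2r // mulr_ge0.
    have L' (a z d : R) : `|z| <= b1 -> - (a * (z * d)) <= b1 * (`|a| * `|d|).
      move=> zb; apply: le_trans (ler_norm _) _; rewrite normrN !normrM mulrCA.
      by rewrite ler_wpM2r // mulr_ge0.
    have := L (p i) _ (p j) (bb _ (Tb i j)); have := L' (p i) _ (q j) (bb _ (Sb i j)).
    have := L (q i) _ (q j) (bb _ (Tb i j)); have := L (q i) _ (p j) (bb _ (Sb i j)).
    rewrite /x /y; lra.
  apply: le_trans H _; rewrite ler_wpM2l ?(ltW b10) //.
  have x2 : x ^+ 2 <= 2 * w i.
    rewrite /x /w -[p i ^+ 2]real_normK ?num_real // -[q i ^+ 2]real_normK ?num_real //.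
    have := sqr_ge0 (`|p i| - `|q i|); nra.
  have y2 : y ^+ 2 <= 2 * w j.
    rewrite /y /w -[p j ^+ 2]real_normK ?num_real // -[q j ^+ 2]real_normK ?num_real //.
    have := sqr_ge0 (`|p j| - `|q j|); nra.
  have : 0 <= e * (x - e^-1 * y) ^+ 2 by rewrite mulr_ge0 ?sqr_ge0 // ltW.
  have -> : e * (x - e^-1 * y) ^+ 2 = e * x ^+ 2 - 2 * (x * y) + e^-1 * y ^+ 2.
    by field; rewrite gt_eqF.
  have : e * x ^+ 2 <= e * (2 * w i) by rewrite ler_wpM2l // ltW.
  have : e^-1 * y ^+ 2 <= e^-1 * (2 * w j) by rewrite ler_wpM2l // invr_ge0 ltW.
  lra.
pose K (i j : 'I_n) : R := b1 * e * (th ^+ i * w i) + b1 * e * (th ^+ j * w j).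
have K0 (i j : 'I_n) : 0 <= K i j by rewrite addr_ge0 // !mulr_ge0 ?exprn_ge0 // ltW.
have step (i j : 'I_n) : (j < i)%N -> th ^+ i *
     (p i * (T i j * p j - S i j * q j) + q i * (T i j * q j + S i j * p j)) <= K i j.
  move=> ji; apply: le_trans (ler_wpM2l (exprn_ge0 _ (ltW th0)) (term i j)) _.
  have -> : K i j = th ^+ i * (b1 * (e * w i)) + b1 * e^-1 * ((th * th ^+ j) * w j).
    by rewrite /K /th; field; rewrite gt_eqF.
  rewrite mulrDr mulrDr lerD2l.
  have -> : th ^+ i * (b1 * (e^-1 * w j)) = b1 * e^-1 * (th ^+ i * w j) by ring.
  rewrite ler_wpM2l ?mulr_ge0 ?invr_ge0 ?(ltW e0) ?(ltW b10) // ler_wpM2r //.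
  by rewrite -exprS ler_wiXn2l // ltW.
apply: (@le_trans _ _ (\sum_(i < n) \sum_(j < n) K i j)).
  apply: ler_sum => i _; rewrite [leRHS](bigID (fun j : 'I_n => (j < i)%N)) /=.
  rewrite -[leLHS]addr0 lerD ?sumr_ge0 //.
  by apply: ler_sum => j; exact: step.
have -> : \sum_(i < n) \sum_(j < n) K i j = 2 * n%:R * b1 * e * V.
  transitivity (\sum_(i < n) (n%:R * (b1 * e * (th ^+ i * w i)) + b1 * e * V)).
    apply: eq_bigr => i _; rewrite big_split /= sumr_const card_ord -mulr_sumr.
    by rewrite mulr_natl.
  rewrite big_split /= sumr_const card_ord -!mulr_sumr -mulr_natl -/V.
  by ring.
rewrite ler_wpM2r // (le_trans _ ec) // ler_wpM2r ?(ltW e0) // ler_wpM2r ?(ltW b10) //.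
by rewrite ler_wpM2l // ler_nat.
Qed.

(** Schur triangularization [P *m A = T *m P] over the complex numbers gives coordinates P v in
    which X is the sum of th^i |(P v)_i|^2. The diagonal entries of [T] are eigenvalues and
    contribute at most - c2; half of this margin absorbs the strictly triangular part once th is
    small. *)
Lemma hurwitz_lyapunov n (M : 'M[R]_n) : hurwitz M ->
  exists X c, lyapunov M X c.
Proof.
case: n M => [|n] M Mh.
  have z (v : 'cV[R]_0) : v = 0 by exact: flatmx0.
  exists 0, 1; split => [|//|v]; last by rewrite (z v) !qf0l mulr0.
  by split; [rewrite trmx0|move=> v; rewrite (z v) eqxx].
pose A := map_mx (real_complex R) M.
have [P Pu Tt] := @Schur R[i] n.+1 A isT.
have Punit : P \in unitmx := unitarymx_unit Pu.
pose T := P *m A *m invmx P.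
have {}Tt : is_trig_mx T by move: Tt; rewrite /mxred.similar_to mxred.conjumx.
have PA : P *m A = T *m P by rewrite /T mulmxKV.
clearbody T.
have Tneg i : complex.Re (T i i) < 0.
  apply: Mh; apply/eigenvalueP.
  have /det0P[v v0 vT] : \det (T - (T i i)%:M) == 0.
    rewrite det_trig; last first.
      apply/is_trig_mxP => j k jk; rewrite !mxE (is_trig_mxP Tt) //.
      by rewrite -val_eqE ltn_eqF //= subr0.
    by rewrite (bigD1 i) //= !mxE eqxx subrr mul0r.
  exists (v *m P); last first.
    by apply: contra v0 => /eqP vP; rewrite -[v](mulmxK Punit) vP mul0mx.
  rewrite -mulmxA PA mulmxA.
  move/eqP: vT; rewrite mulmxBr mul_mx_scalar subr_eq0 => /eqP ->.
  by rewrite scalemxAl.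
pose Pr := mxRe P; pose Pi := mxIm P; pose Tr := mxRe T; pose Ti := mxIm T.
have PrM : Pr *m M = Tr *m Pr - Ti *m Pi.
  by rewrite -mxRe_mul -PA mxRe_mul mxRe_real mxIm_real mulmx0 subr0.
have PiM : Pi *m M = Tr *m Pi + Ti *m Pr.
  by rewrite -mxIm_mul -PA mxIm_mul mxRe_real mxIm_real mulmx0 add0r.
have Pinj v : Pr *m v = 0 -> Pi *m v = 0 -> v = 0.
  move=> rv iv; have : P *m map_mx (real_complex R) v = 0.
    apply: complex_mx0; first by rewrite mxRe_mul mxRe_real mxIm_real mulmx0 subr0.
    by rewrite mxIm_mul mxRe_real mxIm_real mulmx0 add0r.
  move/(congr1 (mulmx (invmx P))); rewrite mulKmx // mulmx0.
  by move/(congr1 (@mxRe R _ _)) => /matrixP E; apply/matrixP => i j; have := E i j; rewrite !mxE.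
(* The starting value 1 only caps the margin: any positive lower bound of the - Re T_ii serves. *)
pose c2 : R := \big[Num.min/1]_i (- complex.Re (T i i)).
have c20 : 0 < c2 by apply: lt_bigmin => // i _; rewrite oppr_gt0 Tneg.
have c2le i : complex.Re (T i i) <= - c2 by rewrite lerNr; exact: bigmin_le_cond.
pose c : R := c2 / 2; have c0 : 0 < c by rewrite divr_gt0.
pose b : R := \sum_i \sum_j (`|Tr i j| + `|Ti i j|).
have bT i j : `|Tr i j| + `|Ti i j| <= b.
  rewrite /b (bigD1 i) //= (bigD1 j) //= -addrA lerDl.
  have t0 k l : 0 <= `|Tr k l| + `|Ti k l| by exact: addr_ge0.
  by apply: addr_ge0; apply: sumr_ge0 => k _ //; apply: sumr_ge0 => l _.
pose D (th : R) : 'M[R]_n.+1 := diag_mx (\row_i th ^+ i).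
pose X (th : R) := Pr^T *m D th *m Pr + Pi^T *m D th *m Pi.
have qD th u v : qf (D th) u v = \sum_(i < n.+1) th ^+ i * (u i 0 * v i 0).
  rewrite /qf mxE; apply: eq_bigr => i _; rewrite mul_mx_diag !mxE; ring.
have qX th u v : qf (X th) u v =
    \sum_(i < n.+1) th ^+ i * ((Pr *m u) i 0 * (Pr *m v) i 0 + (Pi *m u) i 0 * (Pi *m v) i 0).
  have -> : qf (X th) u v = qf (D th) (Pr *m u) (Pr *m v) + qf (D th) (Pi *m u) (Pi *m v).
    by rewrite /X qfDx /qf !trmx_mul !mulmxA.
  by rewrite !qD -big_split; apply: eq_bigr => i _; rewrite mulrDr.
have Xpd th : 0 < th -> pdmx (X th).
  move=> th0; split.
    by rewrite /X linearD /= !trmx_mul !trmxK tr_diag_mx !mulmxA.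
  move=> v v0; rewrite -/(qf _ _ _) qX.
  have ge0 (i : 'I_n.+1) : 0 <= th ^+ i * ((Pr *m v) i 0 * (Pr *m v) i 0 + (Pi *m v) i 0 * (Pi *m v) i 0).
    by rewrite mulr_ge0 ?exprn_ge0 ?(ltW th0) // -!expr2 addr_ge0 ?sqr_ge0.
  rewrite lt_neqAle sumr_ge0 // andbT eq_sym; apply: contra v0.
  rewrite psumr_eq0 // => /allP z.
  have {}z (i : 'I_n.+1) : (Pr *m v) i 0 = 0 /\ (Pi *m v) i 0 = 0.
    have := z i; rewrite mem_index_enum => /(_ isT) /=.
    rewrite mulf_eq0 expf_eq0 (gt_eqF th0) andbF /= -!expr2 paddr_eq0 ?sqr_ge0 //.
    by rewrite !sqrf_eq0 => /andP[/eqP-> /eqP->].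
  by apply/eqP/Pinj; apply/matrixP => i j; rewrite ord1 [RHS]mxE; case: (z i).
have [||th th0 H] := @trig_weight_le _ Tr Ti c b c0.
- by move=> i j; apply: le_trans (bT i j); rewrite lerDl.
- by move=> i j; apply: le_trans (bT i j); rewrite lerDr.
exists (X th), c; split => // [|v]; first exact: Xpd.
rewrite !qX; set p := Pr *m v; set q := Pi *m v.
have -> : Pr *m (M *m v) = Tr *m p - Ti *m q by rewrite mulmxA PrM mulmxBl -!mulmxA.
have -> : Pi *m (M *m v) = Tr *m q + Ti *m p by rewrite mulmxA PiM mulmxDl -!mulmxA.
have {}H := H (p^~ 0) (q^~ 0); clearbody p q.
apply: (@le_trans _ _ (\sum_(i < n.+1) th ^+ i * (- c2 * (p i 0 ^+ 2 + q i 0 ^+ 2)) + c * \sum_(i < n.+1) th ^+ i * (p i 0 ^+ 2 + q i 0 ^+ 2))); last first.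
  rewrite !mulr_sumr -big_split le_eqVlt; apply/orP; left; apply/eqP/eq_bigr => i _.
  by rewrite /c /=; field.
apply: le_trans (lerD (lexx _) H); rewrite -big_split; apply: ler_sum => i _ /=.
rewrite -mulr_sumr -mulrDr ler_wpM2l ?exprn_ge0 ?(ltW th0) //.
have lowertri (U : 'M[R]_n.+1) (u : 'cV[R]_n.+1) : is_trig_mx U ->
    (U *m u) i 0 = U i i * u i 0 + \sum_(j < n.+1 | (j < i)%N) U i j * u j 0.
  move=> /is_trig_mxP Ut; rewrite mxE (bigD1 i) //=; congr +%R.
  rewrite [LHS](bigID (fun j : 'I_n.+1 => (j < i)%N)) /= [X in _ + X]big1 ?addr0.
    by apply: eq_bigl => j; rewrite ltn_neqAle andbA andbb.
  move=> j /andP[ji]; rewrite -leqNgt => ij; rewrite Ut ?mul0r //.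
  by rewrite ltn_neqAle eq_sym ji.
have Trt : is_trig_mx Tr by apply/is_trig_mxP => k j kj; rewrite mxE (is_trig_mxP Tt).
have Tit : is_trig_mx Ti by apply/is_trig_mxP => k j kj; rewrite mxE (is_trig_mxP Tt).
rewrite mxBE mxDE !lowertri //.
apply: (@le_trans _ _ (Tr i i * (p i 0 ^+ 2 + q i 0 ^+ 2) + \sum_(j < n.+1 | (j < i)%N)
   (p i 0 * (Tr i j * p j 0 - Ti i j * q j 0) + q i 0 * (Tr i j * q j 0 + Ti i j * p j 0)))).
  rewrite le_eqVlt; apply/orP; left; apply/eqP.
  rewrite big_split /= -!mulr_sumr sumrB big_split /=; ring.
by rewrite lerD2r ler_wpM2r ?addr_ge0 ?sqr_ge0 // mxE c2le.
Qed.

End LyapunovFunction.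

(** * Linear differential equations *)

Section MatrixLimits.
Context {R : realType}.

Lemma cvg_sumr (T : Type) (F : set_system T) (FF : Filter F) (I : Type)
    (s : seq I) (P : pred I) (f : I -> T -> R) (l : I -> R) :
  (forall i, P i -> f i x @[x --> F] --> l i) ->
  \sum_(i <- s | P i) f i x @[x --> F] --> \sum_(i <- s | P i) l i.
Proof.
move=> fl; elim: s => [|i s IH].
  by rewrite big_nil; under eq_fun do rewrite big_nil; exact: cvg_cst.
rewrite big_cons; under eq_fun do rewrite big_cons.
by case: ifPn => // Pi; apply: cvgD => //; exact: fl.
Qed.

Lemma continuous_sumr (T : topologicalType) (I : Type) (s : seq I) (P : pred I)
    (f : I -> T -> R) : (forall i, P i -> continuous (f i)) ->
  continuous (fun x => \sum_(i <- s | P i) f i x).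
Proof. by move=> fc x; apply: cvg_sumr => i Pi; exact: fc. Qed.

Lemma cvg_mx (T : Type) (F : set_system T) (FF : Filter F) m n
    (f : T -> 'M[R]_(m, n)) (L : 'M[R]_(m, n)) :
  (forall i j, f x i j @[x --> F] --> L i j) -> f x @[x --> F] --> L.
Proof.
move=> fL; apply/cvgrPdist_lt => /= e e0.
have : \forall x \near F, forall i j, `|L i j - f x i j| < e / 2.
  apply: filter_forall => i; apply: filter_forall => j.
  by move/cvgrPdist_lt : (fL i j); apply; rewrite divr_gt0.
apply: filterS => x H.
rewrite [ltLHS]/Num.Def.normr/= mx_normrE.
apply: (@le_lt_trans _ _ (e / 2)); last by rewrite ltr_pdivrMr // ltr_pMr // ltr1n.
by apply: bigmax_le => [|[i j] _]; rewrite ?divr_ge0 ?(ltW e0) // !mxE ltW //= H.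
Qed.

Lemma continuous_mx (T : topologicalType) m n (f : T -> 'M[R]_(m, n)) :
  (forall i j, continuous (fun x => f x i j)) -> continuous f.
Proof. by move=> fc x; apply: cvg_mx => i j; exact: fc. Qed.

Lemma continuous_entry (T : topologicalType) m n (f : T -> 'M[R]_(m, n)) i j :
  continuous f -> continuous (fun x => f x i j).
Proof.
move=> fc x; apply: (@continuous_comp _ _ _ f (fun M => M i j)); first exact: fc.
exact: coord_continuous.
Qed.

Lemma is_derive_mx m n (f : R -> 'M[R]_(m, n)) (t : R) (L : 'M[R]_(m, n)) :
  (forall i j, is_derive t (1 : R) (fun x => f x i j) (L i j)) ->
  is_derive t (1 : R) f L.
Proof.
move=> fL.
have H : h^-1 *: ((f \o shift t) (h *: (1 : R)) - f t) @[h --> 0^'] --> L.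
  apply: cvg_mx => i j.
  have [d e] := fL i j.
  have -> : (fun h => (h^-1 *: ((f \o shift t) (h *: (1:R)) - f t)) i j) =
    (fun h => h^-1 *: (((fun x => f x i j) \o shift t) (h *: (1:R)) - f t i j)).
    by apply/funext => h; rewrite !mxE.
  by rewrite -e; exact: d.
apply: DeriveDef; first by apply/cvg_ex; exists L.
exact: cvg_lim H.
Qed.

Lemma is_derive_entry m n (f : R -> 'M[R]_(m, n)) (t : R) (L : 'M[R]_(m, n)) i j :
  is_derive t (1 : R) f L -> is_derive t (1 : R) (fun x => f x i j) (L i j).
Proof.
move=> [d e].
have H0 : h^-1 *: ((f \o shift t) (h *: (1:R)) - f t) @[h --> 0^'] --> L.
  by rewrite -e; exact: d.
have H : h^-1 *: (((fun x => f x i j) \o shift t) (h *: (1:R)) - f t i j)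
    @[h --> 0^'] --> L i j.
  have := @cvg_comp _ _ _ _ (fun M : 'M[R]_(m, n) => M i j) _ _ _ H0
    (@coord_continuous _ _ _ i j L).
  apply: cvg_trans; apply: near_eq_cvg; apply: nearW => h.
  by rewrite /= mxZE mxBE.
apply: DeriveDef; first by apply/cvg_ex; exists (L i j).
exact: cvg_lim H.
Qed.

End MatrixLimits.

Section HalfLine.
Context {R : realType}.

(* Functions on [0, +oo[ are handled through their constant extension to the
   negative reals. *)
Definition clamp (t : R) : R := Num.max 0 t.

Lemma clamp_ge0 t : 0 <= clamp t. Proof. by rewrite le_max lexx. Qed.
Lemma clamp_id t : 0 <= t -> clamp t = t. Proof. exact: max_r. Qed.
Lemma clamp_le0 t : t <= 0 -> clamp t = 0. Proof. exact: max_l. Qed.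

Lemma continuous_clamp : continuous clamp.
Proof. by apply: max_fun_continuous => x; [exact: cvg_cst|exact: cvg_id]. Qed.

Lemma within_clamp (U : topologicalType) (f : R -> U) :
  {within `[0, +oo[, continuous f} <-> continuous (f \o clamp).
Proof.
split=> [/subspace_continuousP fc t|fc].
- have /fc c0 : `[0, +oo[%classic (clamp t) by rewrite /= in_itv /= clamp_ge0.
  apply: cvg_comp c0 => A wA.
  have : nbhs t (clamp @^-1` (fun x => `[0, +oo[%classic x -> A x)).
    exact: (@continuous_clamp t _ wA).
  by apply: filterS => u; apply; rewrite /= in_itv /= clamp_ge0.
- have := @continuous_subspaceT R U (`[0, +oo[%classic : set R) _ fc.
  apply: subspace_eq_continuous => t; rewrite inE /= in_itv /= andbT => t0.
  by rewrite /from_subspace /= clamp_id.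
Qed.

Lemma within_entry m n (f : R -> 'M[R]_(m, n)) :
  {within `[0, +oo[, continuous f} <->
  forall i j, continuous (fun t => f (clamp t) i j).
Proof.
rewrite within_clamp; split=> [fc i j|fc]; last exact: continuous_mx.
exact: continuous_entry fc.
Qed.

End HalfLine.

Section Primitive.
Context {R : realType}.
Notation mu := (@lebesgue_measure R).
Implicit Types (h : R -> R) (t a : R).

Lemma continuous_integrable (h : R -> R) (a b : R) :
  continuous h -> mu.-integrable `[a, b] (EFin \o h).
Proof.
move=> hc; apply: continuous_compact_integrable; first exact: segment_compact.
exact: continuous_subspaceT.
Qed.

(** For negative t the interval is empty and the value is 0, so the primitive lives on the whole
    line, constant before 0. *)
Definition prim (h : R -> R) (t : R) : R := \int[mu]_(u in `[0, t]) h u.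

Lemma prim_le0 h t : t <= 0 -> prim h t = 0.
Proof.
rewrite le_eqVlt => /predU1P[->|t0]; rewrite /prim.
  by rewrite set_itv1 Rintegral_set1.
by rewrite set_itv_ge ?Rintegral_set0 // bnd_simp -ltNge.
Qed.

Lemma prim0 h : prim h 0 = 0. Proof. exact: prim_le0. Qed.

Lemma eq_prim (h1 h2 : R -> R) t : (forall u, 0 <= u -> h1 u = h2 u) -> prim h1 t = prim h2 t.
Proof.
move=> h12; apply: eq_Rintegral => u; rewrite inE /= in_itv /= => /andP[u0 _].
exact: h12.
Qed.

Lemma prim_derive h (t : R) : continuous h -> 0 < t ->
  is_derive t (1 : R) (prim h) (h t).
Proof.
move=> hc t0.
have [||d e] := @continuous_FTC1_closed R h 0 t (t + 1) _ _ t0 (hc t).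
- by rewrite ltrDl.
- exact: continuous_integrable.
by apply: DeriveDef; [exact: d|rewrite -derive1E; exact: e].
Qed.

Lemma prim_continuous h : continuous h -> continuous (prim h).
Proof.
move=> hc.
suff : {within `[0, +oo[, continuous (prim h)}.
  move=> /within_clamp; have -> : prim h \o clamp = prim h; last exact.
  apply/funext => t /=; have [t0|/ltW t0] := leP 0 t; first by rewrite clamp_id.
  by rewrite clamp_le0 // !prim_le0.
apply/continuous_within_itvcyP; split.
  move=> t; rewrite in_itv /= andbT => t0.
  apply: differentiable_continuous; apply/derivable1_diffP.
  by have [] := prim_derive hc t0.
(* Positive times are covered by differentiability; right continuity at 0 is read off from
   continuity of the primitive on [0, 1]. *)
have := @parameterized_integral_continuous R 0 1 h ler01 (@continuous_integrable h 0 1 hc).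
by move=> /(continuous_within_itvP _ ltr01)[_ + _].
Qed.

Lemma primD (h1 h2 : R -> R) t : continuous h1 -> continuous h2 ->
  prim (fun u => h1 u + h2 u) t = prim h1 t + prim h2 t.
Proof. by move=> c1 c2; apply: RintegralD => //; exact: continuous_integrable. Qed.

Lemma primB (h1 h2 : R -> R) t : continuous h1 -> continuous h2 ->
  prim (fun u => h1 u - h2 u) t = prim h1 t - prim h2 t.
Proof. by move=> c1 c2; apply: RintegralB => //; exact: continuous_integrable. Qed.

Lemma primZ a h t : continuous h -> prim (fun u => a * h u) t = a * prim h t.
Proof. by move=> c1; apply: RintegralZl => //; exact: continuous_integrable. Qed.

Lemma prim_ge0 h t : (forall u, 0 <= u -> 0 <= h u) -> 0 <= prim h t.
Proof.
move=> h0; apply: Rintegral_ge0 => u /=; rewrite in_itv /= => /andP[u0 _].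
exact: h0.
Qed.

Lemma le_prim (h1 h2 : R -> R) t : continuous h1 -> continuous h2 ->
  (forall u, 0 <= u -> h1 u <= h2 u) -> prim h1 t <= prim h2 t.
Proof.
move=> c1 c2 h12; apply: le_Rintegral => //; try exact: continuous_integrable.
by move=> u /=; rewrite in_itv /= => /andP[u0 _]; exact: h12.
Qed.

Lemma prim_sum (I : Type) (s : seq I) (h : I -> R -> R) t :
  (forall i, continuous (h i)) ->
  prim (fun u => \sum_(i <- s) h i u) t = \sum_(i <- s) prim (h i) t.
Proof.
move=> hc; elim: s => [|i s IH].
  transitivity (prim (fun u => 0 * cst 0 u) t).
    by apply: eq_prim => u _; rewrite big_nil mul0r.
  by rewrite primZ ?mul0r ?big_nil // => ?; exact: cvg_cst.
rewrite big_cons -IH -primD //; first by apply: eq_prim => u _; rewrite big_cons.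
by apply: continuous_sumr => j _; exact: hc.
Qed.

Lemma prim_ereal h t : (forall u, 0 <= u -> 0 <= h u) -> continuous h ->
  (\int[mu]_(u in `[0%R, t]) (h u)%:E)%E = (prim h t)%:E.
Proof.
move=> h0 hc; rewrite /prim /Rintegral fineK //.
apply: integrable_fin_num => //; exact: continuous_integrable.
Qed.

Lemma continuous_le_of_derive (V V' : R -> R) (T : R) : continuous V ->
  (forall t : R, 0 < t -> is_derive t (1 : R) V (V' t)) ->
  (forall t : R, 0 < t -> V' t <= 0) -> 0 <= T -> V T <= V 0.
Proof.
move=> Vc Vd V0 T0.
apply: (@ler0_derive1_le_cc _ V 0 T); rewrite ?in_itv /= ?lexx ?T0 //.
- by move=> t; rewrite in_itv /= => /andP[t0 _]; have [] := Vd _ t0.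
- move=> t; rewrite in_itv /= => /andP[t0 _].
  by rewrite derive1E; have [_ ->] := Vd _ t0; exact: V0.
- exact: continuous_subspaceT.
Qed.

(** Monotonicity applied to V + prim p - prim q. The energy estimates below are instances, with p
    the dissipation and q the supply. *)
Lemma energy_integral (V V' p q : R -> R) (T : R) : continuous V ->
  continuous p -> continuous q ->
  (forall t : R, 0 < t -> is_derive t (1 : R) V (V' t)) ->
  (forall t : R, 0 < t -> V' t <= q t - p t) -> 0 <= T ->
  V T + prim p T <= V 0 + prim q T.
Proof.
move=> Vc pc qc Vd V0 T0.
have := @continuous_le_of_derive (fun t => V t + (prim p t - prim q t))
  (fun t => V' t + (p t - q t)) T.
rewrite !prim0 subrr addr0 -lerBrDr opprB addrA lerBrDr.
apply => //.
- move=> t; apply: cvgD; first exact: Vc.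
  by apply: cvgB; exact: prim_continuous.
- move=> t t0; have := Vd _ t0; have := prim_derive pc t0; have := prim_derive qc t0.
  by move=> ? ? ?; apply: is_deriveD.
- by move=> t /V0; lra.
Qed.

End Primitive.

(** * The matrix exponential as an entrywise power series *)

Section MatrixExponential.
Context {R : realType}.

Lemma is_derive_sumr (I : Type) (s : seq I) (P : pred I) (f : I -> R -> R)
    (df : I -> R) (t : R) : (forall i, P i -> is_derive t (1 : R) (f i) (df i)) ->
  is_derive t (1 : R) (fun u => \sum_(i <- s | P i) f i u) (\sum_(i <- s | P i) df i).
Proof.
move=> fd; elim: s => [|i s IH].
  rewrite big_nil; under eq_fun do rewrite big_nil.
  exact: is_derive_cst.
rewrite big_cons; under eq_fun do rewrite big_cons.
by case: ifPn => // Pi; apply: is_deriveD => //; exact: fd.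
Qed.

Lemma is_derive_mulmx m n p (U : R -> 'M[R]_(m, n)) (V : R -> 'M[R]_(n, p))
    U' V' (t : R) :
  is_derive t (1 : R) U U' -> is_derive t (1 : R) V V' ->
  is_derive t (1 : R) (fun u => U u *m V u) (U' *m V t + U t *m V').
Proof.
move=> Ud Vd; apply: is_derive_mx => i j.
have -> : (U' *m V t + U t *m V') i j = \sum_k (U t i k * V' k j + V t k j * U' i k).
  rewrite mxE !mxE -big_split; apply: eq_bigr => k _ /=; ring.
under eq_fun do rewrite mxE; apply: is_derive_sumr => k _.
have ud := is_derive_entry i k Ud; have vd := is_derive_entry k j Vd.
exact: (is_deriveM ud vd).
Qed.

Lemma is_derive_cstmx m n (M : 'M[R]_(m, n)) (t : R) :
  is_derive t (1 : R) (fun=> M) 0.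
Proof. exact: is_derive_cst. Qed.

(** Domination by the series of B exp(a x). Unlike mere convergence, this bound passes to the
    differentiated series, with B replaced by B a, which is what term-by-term differentiation asks
    for. *)
Definition exp_bounded (c : R^nat) : Prop :=
  exists B a : R, [/\ 0 <= B, 0 <= a & forall k, `|c k| <= B * (a ^+ k / k`!%:R)].

Lemma exp_bounded_cvg c x : exp_bounded c -> cvgn (pseries c x).
Proof.
move=> [B [a [B0 a0 cB]]]; apply: normed_cvg.
apply: (@series_le_cvg _ _ (fun k => B * exp_coeff (a * `|x|) k)) => [k|k|k|].
- exact: normr_ge0.
- by rewrite mulr_ge0 // exp_coeff_ge0 // mulr_ge0.
- rewrite /exp_coeff /= normrM normrX exprMn.
  have -> : B * (a ^+ k * `|x| ^+ k / k`!%:R) = B * (a ^+ k / k`!%:R) * `|x| ^+ k.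
    by ring.
  by rewrite ler_wpM2r ?exprn_ge0.
- exact/is_cvg_seriesZ/is_cvg_series_exp_coeff.
Qed.

Lemma exp_bounded_diffs c : exp_bounded c -> exp_bounded (pseries_diffs c).
Proof.
move=> [B [a [B0 a0 cB]]]; exists (B * a), a; split => // [|k].
  exact: mulr_ge0.
rewrite /pseries_diffs normrM normr_nat.
apply: (@le_trans _ _ (k.+1%:R * (B * (a ^+ k.+1 / k.+1`!%:R)))).
  by rewrite ler_wpM2l.
rewrite le_eqVlt; apply/orP; left; apply/eqP.
rewrite factS natrM exprS; field.
by rewrite nat1r !pnatr_eq0 -lt0n fact_gt0.
Qed.

Lemma exp_bounded_derive c (x : R) : exp_bounded c ->
  is_derive x (1 : R) (fun x => limn (pseries c x)) (limn (pseries (pseries_diffs c) x)).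
Proof.
move=> cb; have cb1 := exp_bounded_diffs cb; have cb2 := exp_bounded_diffs cb1.
apply: (@pseries_snd_diffs _ c (`|x| + 1)); try exact: exp_bounded_cvg.
by rewrite [ltRHS]ger0_norm ?addr_ge0 // ltrDl.
Qed.

Context {n : nat} (F : 'M[R]_n).

Definition mxpow (k : nat) : 'M[R]_n := iter k (mulmx F) 1%:M.

Lemma mxpowSr k : mxpow k.+1 = mxpow k *m F.
Proof.
elim: k => [|k IH]; first by rewrite /mxpow /= mul1mx mulmx1.
by rewrite -[LHS]/(F *m mxpow k.+1) {1}IH mulmxA.
Qed.

(** Every row sum of |F| is at most a, so by induction the entries of F^k are at most a^k. *)
Lemma mxpow_bounded i j : exp_bounded (fun k => mxpow k i j / k`!%:R).
Proof.
pose a : R := \sum_i \sum_l `|F i l| + 1.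
have s0 (k : 'I_n) : 0 <= \sum_l `|F k l| by exact: sumr_ge0.
have a0 : 0 <= a by rewrite addr_ge0 // sumr_ge0.
have row_le k : \sum_l `|F k l| <= a.
  by rewrite /a [X in X + 1](bigD1 k) //= -addrA lerDl addr_ge0 // sumr_ge0.
exists 1, a; split => // k; rewrite mul1r normrM normfV normr_nat.
rewrite ler_wpM2r ?invr_ge0 //; elim: k i => [|k IH] i /=.
  by rewrite mxE expr0; case: eqP => _; rewrite ?normr1 ?normr0.
rewrite mxE exprS; apply: le_trans (ler_norm_sum _ _ _) _.
apply: le_trans (ler_wpM2r (exprn_ge0 _ a0) (row_le i)).
rewrite mulr_suml; apply: ler_sum => l _; rewrite normrM.
by rewrite ler_wpM2l.
Qed.

Definition expmx (t : R) : 'M[R]_n :=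
  \matrix_(i, j) limn (pseries (fun k => mxpow k i j / k`!%:R) t).

Lemma expmx_cvg t i j :
  pseries (fun k => mxpow k i j / k`!%:R) t @ \oo --> expmx t i j.
Proof. by rewrite mxE; exact/exp_bounded_cvg/mxpow_bounded. Qed.

Lemma mxpow_diffs k i j : pseries_diffs (fun k => mxpow k i j / k`!%:R) k
  = mxpow k.+1 i j / k`!%:R.
Proof.
rewrite /pseries_diffs factS natrM; field.
by rewrite nat1r !pnatr_eq0 -lt0n fact_gt0.
Qed.

Lemma expmx_derivel (t : R) : is_derive t (1 : R) expmx (F *m expmx t).
Proof.
apply: is_derive_mx => i j.
have -> : (F *m expmx t) i j
    = limn (pseries (pseries_diffs (fun k => mxpow k i j / k`!%:R)) t).
  apply/esym/cvg_lim => //; rewrite mxE.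
  have -> : pseries (pseries_diffs (fun k => mxpow k i j / k`!%:R)) t =
      (fun N => \sum_l F i l * pseries (fun k => mxpow k l j / k`!%:R) t N).
    apply/funext => N; rewrite /pseries /series /=.
    under eq_bigr => k _ do rewrite mxpow_diffs /= mxE 2!mulr_suml.
    rewrite exchange_big; apply: eq_bigr => l _; rewrite mulr_sumr.
    by apply: eq_bigr => k _; rewrite !mulrA.
  apply: cvg_sumr => l _; apply: cvgM; first exact: cvg_cst.
  exact: expmx_cvg.
under eq_fun do rewrite mxE.
exact/exp_bounded_derive/mxpow_bounded.
Qed.

Lemma expmxC t : F *m expmx t = expmx t *m F.
Proof.
apply/matrixP => i j; rewrite !mxE.
pose S N := \sum_l F i l * pseries (fun k => mxpow k l j / k`!%:R) t N.
have : S N @[N --> \oo] --> \sum_l F i l * expmx t l j.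
  by apply: cvg_sumr => l _; apply: cvgM; [exact: cvg_cst|exact: expmx_cvg].
have -> : S = (fun N => \sum_l pseries (fun k => mxpow k i l / k`!%:R) t N * F l j).
  apply/funext => N; rewrite /S /pseries /series /=.
  transitivity (\sum_(0 <= k < N) mxpow k.+1 i j / k`!%:R * t ^+ k).
    under [RHS]eq_bigr => k _ do rewrite /= mxE 2!mulr_suml.
    rewrite exchange_big; apply: eq_bigr => l _; rewrite mulr_sumr.
    by apply: eq_bigr => k _; rewrite !mulrA.
  under [LHS]eq_bigr => k _ do rewrite mxpowSr mxE 2!mulr_suml.
  rewrite exchange_big; apply: eq_bigr => l _; rewrite mulr_suml.
  by apply: eq_bigr => k _; ring.
have : \sum_l pseries (fun k => mxpow k i l / k`!%:R) t N * F l j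
    @[N --> \oo] --> \sum_l expmx t i l * F l j.
  by apply: cvg_sumr => l _; apply: cvgM; [exact: expmx_cvg|exact: cvg_cst].
by move=> h1 h2; apply: cvg_unique h2 h1.
Qed.

Lemma expmx0 : expmx 0 = 1%:M.
Proof.
apply/matrixP => i j; apply: (cvg_unique _ (@expmx_cvg 0 i j)) => //.
apply: (@cvg_near_cst _ _ _ _ _ _); exists 1%N => // N /= N0.
rewrite /pseries /series /= big_ltn // big_nat_cond big1 ?addr0.
  by rewrite expr0 fact0 divr1 mulr1.
by move=> k /andP[/andP[k0 _] _]; rewrite expr0n gtn_eqF // mulr0.
Qed.

Lemma expmxN_derive (t : R) :
  is_derive t (1 : R) (fun u => expmx (- u)) (- (expmx (- t) *m F)).
Proof.
apply: is_derive_mx => i j; rewrite mxNE -expmxC.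
have d := is_derive_entry i j (@expmx_derivel (- t)).
have := @is_derive1_comp R (fun u => expmx u i j) (-%R) t _ _ d (is_deriveNid t 1).
by rewrite mulrN1 /comp.
Qed.

(** The product has zero derivative because F commutes with its exponential, and it is the identity
    at time 0. *)
Lemma expmxK t : expmx t *m expmx (- t) = 1%:M.
Proof.
apply/matrixP => i j.
have d (u : R) : is_derive u (1 : R) (fun u => (expmx u *m expmx (- u)) i j) 0.
  have := is_derive_mulmx (expmx_derivel u) (expmxN_derive u).
  rewrite expmxC mulmxN -!mulmxA expmxC subrr => /(is_derive_entry i j).
  by rewrite [X in is_derive _ _ _ X]mxE.
have := is_derive_0_is_cst t 0 d; rewrite oppr0 expmx0 mul1mx => ->.
by [].
Qed.

End MatrixExponential.

Section LinearODE.
Context {R : realType} {n : nat}.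
Implicit Types (x h g : R -> 'cV[R]_n) (F M X : 'M[R]_n).
Notation mu := (@lebesgue_measure R).

Definition vcont h := forall k, continuous (fun t => h t k 0).

(** The right-hand side is a function of time alone, so that one trajectory can be read as a
    solution of several equations through [eq_vsol]. Continuity is required on the whole line, which
    keeps subspace topologies out of the calculus. *)
Definition vsol x g :=
  vcont x /\ forall t : R, 0 < t -> is_derive t (1 : R) x (g t).

Lemma eq_vsol x g1 g2 : (forall t, 0 < t -> g1 t = g2 t) -> vsol x g1 -> vsol x g2.
Proof. by move=> g12 [xc xd]; split => // t t0; rewrite -g12 //; exact: xd. Qed.

Lemma vcontD h1 h2 : vcont h1 -> vcont h2 -> vcont (fun t => h1 t + h2 t).
Proof.
move=> c1 c2 k; under eq_fun do rewrite mxE; move=> t.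
by apply: cvgD; [exact: c1|exact: c2].
Qed.

Lemma vcontN h : vcont h -> vcont (fun t => - h t).
Proof.
by move=> c1 k; under eq_fun do rewrite mxE; move=> t; apply: cvgN; exact: c1.
Qed.

Lemma vcont_cst v : vcont (fun=> v).
Proof. by move=> k t; exact: cvg_cst. Qed.

Lemma vcontZ (a : R -> R) h : continuous a -> vcont h -> vcont (fun t => a t *: h t).
Proof.
move=> ac c1 k; under eq_fun do rewrite mxE; move=> t.
by apply: cvgM; [exact: ac|exact: c1].
Qed.

Lemma vcont_clamp h : {within `[0, +oo[, continuous h} <-> vcont (fun t => h (clamp t)).
Proof.
rewrite within_entry; split=> hc; first by move=> k; exact: hc.
by move=> i j; rewrite ord1; exact: hc.
Qed.

Lemma vcont_within x : vcont x -> {within `[0, +oo[, continuous x}.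
Proof.
move=> xc; apply: continuous_subspaceT; apply: continuous_mx => i j.
by rewrite ord1; exact: xc.
Qed.

Lemma qfE X (u v : 'cV[R]_n) : qf X u v = \sum_i \sum_j X i j * (u i 0 * v j 0).
Proof.
rewrite /qf mxE exchange_big; apply: eq_bigr => j _.
rewrite mxE mulr_suml; apply: eq_bigr => i _; rewrite !mxE; ring.
Qed.

Lemma continuous_qf X x h : vcont x -> vcont h -> continuous (fun t => qf X (x t) (h t)).
Proof.
move=> xc hc; under eq_fun do rewrite qfE.
apply: continuous_sumr => i _; apply: continuous_sumr => j _ t.
apply: cvgM; first exact: cvg_cst.
by apply: cvgM; [exact: xc|exact: hc].
Qed.

Lemma continuous_sqnorm x : vcont x -> continuous (fun t => sqnorm (x t)).
Proof.
by move=> xc; under eq_fun do rewrite sqnormE; exact: continuous_qf.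
Qed.

Lemma is_derive_qf X x h (x' h' : 'cV[R]_n) (t : R) :
  is_derive t (1 : R) x x' -> is_derive t (1 : R) h h' ->
  is_derive t (1 : R) (fun t => qf X (x t) (h t)) (qf X x' (h t) + qf X (x t) h').
Proof.
move=> xd hd; under eq_fun do rewrite qfE; rewrite !qfE -big_split.
apply: is_derive_sumr => i _; rewrite -big_split; apply: is_derive_sumr => j _.
have dx := is_derive_entry i 0 xd; have dh := is_derive_entry j 0 hd.
have := is_deriveZ (X i j) (is_deriveM dx dh).
by move=> H; apply: (is_derive_eq H); rewrite /= /GRing.scale /=; ring.
Qed.

Lemma vcont_mulmx (U : R -> 'M[R]_n) h : (forall i j, continuous (fun t => U t i j)) ->
  vcont h -> vcont (fun t => U t *m h t).
Proof.
move=> Uc hc k; under eq_fun do rewrite mxE.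
by apply: continuous_sumr => l _ t; apply: cvgM; [exact: Uc|exact: hc].
Qed.

Definition vprim h (t : R) : 'cV[R]_n := \col_k prim (fun u => h u k 0) t.

Lemma vprim_sol h : vcont h -> vsol (vprim h) h.
Proof.
move=> hc; split.
  by move=> k; under eq_fun do rewrite mxE; exact: prim_continuous.
move=> t t0; apply: is_derive_mx => i j; under eq_fun do rewrite mxE.
by rewrite ord1; exact: prim_derive.
Qed.

Lemma expmx_continuous F i j : continuous (fun t => expmx F t i j).
Proof.
move=> t; apply: differentiable_continuous; apply/derivable1_diffP.
by have [] := is_derive_entry i j (expmx_derivel F t).
Qed.

Lemma expmxN_continuous F i j : continuous (fun t => expmx F (- t) i j).
Proof.
move=> t; apply: differentiable_continuous; apply/derivable1_diffP.
by have [] := is_derive_entry i j (expmxN_derive F t).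
Qed.

Definition duhamel F (x0 : 'cV[R]_n) h (t : R) : 'cV[R]_n :=
  expmx F t *m (x0 + vprim (fun u => expmx F (- u) *m h u) t).

Lemma duhamel0 F (x0 : 'cV[R]_n) h : duhamel F x0 h 0 = x0.
Proof.
rewrite /duhamel expmx0 mul1mx; apply/matrixP => i j.
by rewrite ord1 !mxE prim0 addr0.
Qed.

Lemma duhamel_sol F (x0 : 'cV[R]_n) h : vcont h ->
  vsol (duhamel F x0 h) (fun t => F *m duhamel F x0 h t + h t).
Proof.
move=> hc.
have hc' : vcont (fun u => expmx F (- u) *m h u).
  by apply: vcont_mulmx => // i j; exact: expmxN_continuous.
have [pc pd] := vprim_sol hc'.
split.
  apply: vcont_mulmx; first exact: expmx_continuous.
  by apply: vcontD => //; exact: vcont_cst.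
move=> t t0; have d1 := is_deriveD (is_derive_cstmx x0 t) (pd t t0).
have := is_derive_mulmx (expmx_derivel F t) d1.
move=> H; apply: (is_derive_eq H); rewrite /duhamel add0r -!mulmxA; congr (_ + _).
by rewrite mulmxA expmxK mul1mx.
Qed.

Lemma homogeneous_sol F v : vsol (fun t => expmx F t *m v) (fun t => F *m (expmx F t *m v)).
Proof.
split.
  apply: vcont_mulmx; first exact: expmx_continuous.
  exact: vcont_cst.
move=> t t0; have := is_derive_mulmx (expmx_derivel F t) (is_derive_cstmx v t).
by move=> H; apply: (is_derive_eq H); rewrite mulmx0 addr0 mulmxA.
Qed.

End LinearODE.

(** * Energy estimates for stable linear equations, forward and backward in time *)

Section Energy.
Context {R : realType} {n : nat}.
Implicit Types (x h g : R -> 'cV[R]_n) (F M X : 'M[R]_n).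

(** The dissipation - 2 c X(x, x) is split in two: one half is kept, the other absorbs the cross
    term 2 X(x, h) by Young's inequality, which leaves X(h, h) / c. *)
Lemma lyapunov_energy M X c x h (T : R) : lyapunov M X c -> vcont h ->
  vsol x (fun t => M *m x t + h t) -> 0 <= T ->
  qf X (x T) (x T) + c * prim (fun t => qf X (x t) (x t)) T
  <= qf X (x 0) (x 0) + c^-1 * prim (fun t => qf X (h t) (h t)) T.
Proof.
move=> [Xp c0 XM] hc [xc xd] T0.
have [Xs _] := Xp; have Xpsd := pdmx_psd Xp.
have qxc := continuous_qf (X := X) xc xc; have qhc := continuous_qf (X := X) hc hc.
have := @energy_integral R (fun t => qf X (x t) (x t))
  (fun t => qf X (M *m x t + h t) (x t) + qf X (x t) (M *m x t + h t))
  (fun t => c * qf X (x t) (x t)) (fun t => c^-1 * qf X (h t) (h t)) T qxc.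
rewrite !primZ //; apply => //.
- by move=> t; apply: cvgM; [exact: cvg_cst|exact: qxc].
- by move=> t; apply: cvgM; [exact: cvg_cst|exact: qhc].
- by move=> t t0; apply: is_derive_qf; exact: xd.
- move=> t t0; rewrite [qf X (_ + _) _]qfC Xs qfDr.
  have := XM (x t); have := psd_young (x t) (h t) Xpsd c0.
  lra.
Qed.

(* The time-reversed estimate: x' = - M x - h expands, so the final state
   controls the whole trajectory. *)
Lemma lyapunov_energy_backward M X c x h (T : R) : lyapunov M X c -> vcont h ->
  vsol x (fun t => - (M *m x t) - h t) -> 0 <= T ->
  qf X (x 0) (x 0) + c * prim (fun t => qf X (x t) (x t)) T
  <= qf X (x T) (x T) + c^-1 * prim (fun t => qf X (h t) (h t)) T.
Proof.
move=> [Xp c0 XM] hc [xc xd] T0.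
have [Xs _] := Xp; have Xpsd := pdmx_psd Xp.
have qxc := continuous_qf (X := X) xc xc; have qhc := continuous_qf (X := X) hc hc.
have := @energy_integral R (fun t => - qf X (x t) (x t))
  (fun t => - (qf X (- (M *m x t) - h t) (x t) + qf X (x t) (- (M *m x t) - h t)))
  (fun t => c * qf X (x t) (x t)) (fun t => c^-1 * qf X (h t) (h t)) T.
rewrite !primZ // => H.
have : - qf X (x T) (x T) + c * prim (fun t => qf X (x t) (x t)) T <=
  - qf X (x 0) (x 0) + c^-1 * prim (fun t => qf X (h t) (h t)) T.
  apply: H => //.
  - by move=> t; apply: cvgN; exact: qxc.
  - by move=> t; apply: cvgM; [exact: cvg_cst|exact: qxc].
  - by move=> t; apply: cvgM; [exact: cvg_cst|exact: qhc].
  - by move=> t t0; apply: is_deriveN; apply: is_derive_qf; exact: xd.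
  - move=> t t0; rewrite [qf X (_ - _) _]qfC Xs qfDr !qfNr.
    have := XM (x t); have := psd_young (x t) (h t) Xpsd c0.
    lra.
lra.
Qed.

(** Common to both time directions: (s, s') is (T, 0) forward and (0, T) backward. With a and b the
    lower and upper bounds of the form X, one factor 1 + 1/c raises the weight c of the integral on
    the left to at least 1, the other absorbs the weight 1/c on the right. *)
Lemma lyapunov_sqnorm M X c : lyapunov M X c -> exists C : R, 0 < C /\
  forall (x h : R -> 'cV[R]_n) (T s s' : R), vcont x -> vcont h ->
  qf X (x s) (x s) + c * prim (fun t => qf X (x t) (x t)) T
    <= qf X (x s') (x s') + c^-1 * prim (fun t => qf X (h t) (h t)) T ->
  0 <= T ->
  sqnorm (x s) + prim (fun t => sqnorm (x t)) T
    <= C * (sqnorm (x s') + prim (fun t => sqnorm (h t)) T).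
Proof.
move=> [Xp c0 XM].
have [a a0 Xa] := pdmx_lb Xp; have [b b0 Xb] := qf_ub X.
exists ((1 + c^-1) * (1 + c^-1) * (b / a)).
have ci : 0 < c^-1 by rewrite invr_gt0.
split; first by rewrite !mulr_gt0 ?invr_gt0 // addr_gt0.
move=> x h T s s' xc hc H T0.
have qxc := continuous_qf (X := X) xc xc; have qhc := continuous_qf (X := X) hc hc.
have sxc := continuous_sqnorm xc; have shc := continuous_sqnorm hc.
have p1 : a * prim (fun t => sqnorm (x t)) T <= prim (fun t => qf X (x t) (x t)) T.
  by rewrite -primZ //; apply: le_prim => // t; apply: cvgM; [exact: cvg_cst|exact: sxc].
have p2 : prim (fun t => qf X (h t) (h t)) T <= b * prim (fun t => sqnorm (h t)) T.
  by rewrite -primZ //; apply: le_prim => // t; apply: cvgM; [exact: cvg_cst|exact: shc].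
have q1 := Xa (x s); have q2 := Xb (x s').
set S := prim (fun t => sqnorm (x t)) T in p1 *.
set D := prim (fun t => sqnorm (h t)) T in p2 *.
set S' := prim _ _ in H p1; set D' := prim _ _ in H p2.
have S0 : 0 <= S by apply: prim_ge0 => t _; exact: sqnorm_ge0.
have D0 : 0 <= D by apply: prim_ge0 => t _; exact: sqnorm_ge0.
have xs0 := sqnorm_ge0 (x s); have xs'0 := sqnorm_ge0 (x s').
have L : a * sqnorm (x s) + c * a * S <= b * sqnorm (x s') + c^-1 * b * D.
  apply: (le_trans _ (le_trans H _)).
    by rewrite lerD // -mulrA ler_wpM2l // ltW.
  by rewrite lerD // -mulrA ler_wpM2l // ltW.
have L2 : b * sqnorm (x s') + c^-1 * b * D <= (1 + c^-1) * b * (sqnorm (x s') + D).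
  have : 0 <= b * D by rewrite mulr_ge0 // ltW.
  have : 0 <= c^-1 * (b * sqnorm (x s')) by rewrite mulr_ge0 ?(ltW ci) // mulr_ge0 // ltW.
  lra.
have L3 : a * (sqnorm (x s) + S) <= (1 + c^-1) * (a * sqnorm (x s) + c * a * S).
  have -> : (1 + c^-1) * (a * sqnorm (x s) + c * a * S) =
     a * (sqnorm (x s) + S) + c^-1 * (a * sqnorm (x s)) + c * (a * S).
    by field; rewrite gt_eqF.
  by rewrite -addrA lerDl addr_ge0 // mulr_ge0 ?(ltW ci) ?(ltW c0) // mulr_ge0 // ltW.
have -> : (1 + c^-1) * (1 + c^-1) * (b / a) * (sqnorm (x s') + D) =
   ((1 + c^-1) * ((1 + c^-1) * b * (sqnorm (x s') + D))) / a by ring.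
rewrite ler_pdivlMr // mulrC; apply: le_trans L3 _.
by rewrite ler_wpM2l ?addr_ge0 ?(ltW ci) // (le_trans L).
Qed.

Lemma hurwitz_energy M : hurwitz M -> exists C : R, 0 < C /\
  forall x h (T : R), vcont h -> vsol x (fun t => M *m x t + h t) -> 0 <= T ->
  sqnorm (x T) + prim (fun t => sqnorm (x t)) T
    <= C * (sqnorm (x 0) + prim (fun t => sqnorm (h t)) T).
Proof.
move=> /hurwitz_lyapunov[X [c L]]; have [C [C0 H]] := lyapunov_sqnorm L.
exists C; split => // x h T hc xs T0; apply: H => //; first by case: xs.
exact: lyapunov_energy L hc xs T0.
Qed.

Lemma hurwitz_energy_backward M : hurwitz M -> exists C : R, 0 < C /\
  forall x h (T : R), vcont h -> vsol x (fun t => - (M *m x t) - h t) -> 0 <= T ->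
  sqnorm (x 0) + prim (fun t => sqnorm (x t)) T
    <= C * (sqnorm (x T) + prim (fun t => sqnorm (h t)) T).
Proof.
move=> /hurwitz_lyapunov[X [c L]]; have [C [C0 H]] := lyapunov_sqnorm L.
exists C; split => // x h T hc xs T0; apply: H => //; first by case: xs.
exact: lyapunov_energy_backward L hc xs T0.
Qed.

End Energy.

Section ImproperIntegrals.
Context {R : realType}.
Notation mu := (@lebesgue_measure R).
Implicit Types (p : R -> R) (T K : R).

Lemma measurable_continuous (D : set R) p : measurable D -> continuous p ->
  measurable_fun D (EFin \o p).
Proof.
move=> mD pc; apply/measurable_EFinP; apply: measurable_funS (measurableT) _ _ => //.
exact: continuous_measurable_fun.
Qed.

Lemma prim_nondecreasing p T1 T2 : continuous p -> (forall u, 0 <= u -> 0 <= p u) ->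
  T1 <= T2 -> prim p T1 <= prim p T2.
Proof.
move=> pc p0 T12; rewrite -lee_fin -!prim_ereal //.
apply: ge0_subset_integral => //.
- exact: measurable_continuous.
- by move=> u /=; rewrite in_itv /= lee_fin => /andP[u0 _]; exact: p0.
- by move=> u /=; rewrite !in_itv /= => /andP[-> uT]; exact: le_trans uT T12.
Qed.

Lemma ge0_integral_le p K : continuous p -> (forall u, 0 <= u -> 0 <= p u) ->
  (forall T, 0 <= T -> prim p T <= K) ->
  (\int[mu]_(u in `[0%R, +oo[) (p u)%:E <= K%:E)%E.
Proof.
move=> pc p0 pK.
have -> : `[0%R, +oo[%classic = \bigcup_(i : nat) `[0%R, (i%:R : R)]%classic.
  apply/seteqP; split => u /=.
    rewrite in_itv /= andbT => u0; exists (Num.bound u) => //=.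
    by rewrite in_itv /= u0 ltW // archi_boundP.
  by move=> [i _] /=; rewrite !in_itv /= => /andP[->].
apply: (cvge_le _ (ge0_nondecreasing_set_cvg_integral _ _ _ _)) => //.
- by apply: nearW => i; rewrite prim_ereal // lee_fin pK.
- move=> i j ij; apply/subsetPset => u /=; rewrite !in_itv /= => /andP[-> ui].
  by rewrite (le_trans ui) // ler_nat.
- by move=> i; exact: measurable_continuous.
- by move=> i u /=; rewrite in_itv /= lee_fin => /andP[u0 _]; exact: p0.
Qed.

Lemma ge0_integral_bounded p : continuous p -> (forall u, 0 <= u -> 0 <= p u) ->
  (\int[mu]_(u in `[0%R, +oo[) (p u)%:E < +oo)%E ->
  exists K, forall T, 0 <= T -> prim p T <= K.
Proof.
move=> pc p0 pfin; exists (fine (\int[mu]_(u in `[0%R, +oo[) (p u)%:E)) => T T0.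
have I0 : (0 <= \int[mu]_(u in `[0%R, +oo[) (p u)%:E)%E.
  by apply: integral_ge0 => u /=; rewrite in_itv /= andbT lee_fin; exact: p0.
suff H : ((prim p T)%:E <= \int[mu]_(u in `[0%R, +oo[) (p u)%:E)%E.
  have finI : (\int[mu]_(u in `[0%R, +oo[) (p u)%:E)%E \is a fin_num.
    by rewrite ge0_fin_numE.
  by move: H; rewrite -{1}(fineK finI) lee_fin.
rewrite -prim_ereal //; apply: ge0_subset_integral => //.
- exact: measurable_continuous.
- by move=> u /=; rewrite in_itv /= andbT lee_fin; exact: p0.
- by move=> u /=; rewrite !in_itv /= => /andP[->].
Qed.

(** Polarization: 4 e g = (e + g)^2 - (e - g)^2, and the primitives of both squares are
    nondecreasing and bounded. *)
Lemma prim_mul_cvg (e g : R -> R) K1 K2 : continuous e -> continuous g ->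
  (forall T, 0 <= T -> prim (fun u => e u ^+ 2) T <= K1) ->
  (forall T, 0 <= T -> prim (fun u => g u ^+ 2) T <= K2) ->
  exists l : R, prim (fun u => e u * g u) m%:R @[m --> \oo] --> l.
Proof.
move=> ec gc eK gK.
have sqc (q : R -> R) : continuous q -> continuous (fun u => q u ^+ 2).
  by move=> qc u; under eq_fun do rewrite expr2; apply: cvgM; exact: qc.
have pos (b : R) : `|b| <= 1 -> exists l : R,
    prim (fun u => (e u + b * g u) ^+ 2) m%:R @[m --> \oo] --> l.
  move=> b1.
  have bc : continuous (fun u => e u + b * g u).
    by move=> u; apply: cvgD; [exact: ec|apply: cvgM; [exact: cvg_cst|exact: gc]].
  apply/cvg_ex; apply: (@nondecreasing_is_cvgn _ (fun m : nat => prim _ m%:R)).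
    move=> i j ij; apply: prim_nondecreasing; first exact: sqc.
      by move=> u _; rewrite sqr_ge0.
    by rewrite ler_nat.
  exists (2 * K1 + 2 * K2) => _ [m _ <-].
  have m0 : 0 <= m%:R :> R by [].
  apply: (@le_trans _ _ (prim (fun u => 2 * e u ^+ 2 + 2 * g u ^+ 2) m%:R)).
    apply: le_prim; first exact: sqc.
      move=> u; apply: cvgD; apply: cvgM; (try exact: cvg_cst); exact: sqc.
    move=> u _; have := sqr_ge0 (e u - b * g u).
    have : (b * g u) ^+ 2 <= g u ^+ 2.
      by rewrite exprMn ler_piMl ?sqr_ge0 // -[b ^+ 2]ger0_norm ?sqr_ge0 // normrX expr_le1.
    nra.
  rewrite primD ?primZ; try (by apply: sqc); last 2 first.
  - by move=> u; apply: cvgM; [exact: cvg_cst|exact: sqc].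
  - by move=> u; apply: cvgM; [exact: cvg_cst|exact: sqc].
  by rewrite lerD // ler_wpM2l // ?eK ?gK.
have [lp lpP] := pos 1 ltac:(by rewrite normr1).
have [lm lmP] := pos (-1) ltac:(by rewrite normrN1).
exists (4^-1 * (lp - lm)).
have -> : (fun m : nat => prim (fun u => e u * g u) m%:R) = (fun m : nat => 4^-1 *
   (prim (fun u => (e u + 1 * g u) ^+ 2) m%:R - prim (fun u => (e u + -1 * g u) ^+ 2) m%:R)).
  have c (b : R) : continuous (fun u => (e u + b * g u) ^+ 2).
    by apply: sqc => u; apply: cvgD; [exact: ec|apply: cvgM; [exact: cvg_cst|exact: gc]].
  apply/funext => m; rewrite -primB // -primZ; last first.
    by move=> u; apply: cvgB; exact: c.
  by apply: eq_prim => u _; field.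
by apply: cvgM; [exact: cvg_cst|exact: cvgB].
Qed.

Lemma prim_cst (a T : R) : 0 <= T -> prim (fun=> a) T = a * T.
Proof.
move=> T0; rewrite /prim Rintegral_cst //; congr (_ * _).
have e : lebesgue_measure (`[0, T]%classic : set R) = T%:E.
  rewrite lebesgue_measure_itv /= lte_fin.
  by case: ltgtP T0 => // [_|<-] _; rewrite -?EFinD ?subr0.
by transitivity (fine T%:E) => //; congr fine; exact: e.
Qed.

(** Otherwise p >= e throughout, and the integral up to (K + 1) / e exceeds K. A single small time
    is what the later proofs use in place of convergence at infinity. *)
Lemma prim_bounded_small p K : continuous p -> (forall u, 0 <= u -> 0 <= p u) ->
  (forall T, 0 <= T -> prim p T <= K) -> forall e : R, 0 < e ->
  exists2 T, 0 <= T & p T < e.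
Proof.
move=> pc p0 pK e e0; apply: contrapT => H.
have pe u : 0 <= u -> e <= p u.
  by move=> u0; rewrite leNgt; apply/negP => pu; apply: H; exists u.
have K0 : 0 <= K by have := pK 0 (lexx _); rewrite prim0.
pose T := (K + 1) / e.
have T0 : 0 <= T by rewrite divr_ge0 ?addr_ge0 // ltW.
have : prim (fun=> e * 1) T <= prim p T.
  apply: le_prim => //; first by move=> u; exact: cvg_cst.
  by move=> u u0; rewrite mulr1; exact: pe.
rewrite primZ; last by move=> u; exact: cvg_cst.
rewrite prim_cst // mul1r.
have eT : e * T = K + 1 by rewrite /T mulrC divfK // gt_eqF.
by have := pK _ T0; rewrite eT; lra.
Qed.

End ImproperIntegrals.

Section StableSystems.
Context {R : realType} {n : nat}.
Implicit Types (x h g : R -> 'cV[R]_n) (F M X : 'M[R]_n) (K T : R).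

Definition L2bounded h := exists K, forall T, 0 <= T -> prim (fun t => sqnorm (h t)) T <= K.

Lemma sqnorm_entry (v : 'cV[R]_n) k : v k 0 ^+ 2 <= sqnorm v.
Proof.
by rewrite /sqnorm (bigD1 k) //= lerDl sumr_ge0 // => ? _; rewrite sqr_ge0.
Qed.

Lemma sqnorm_mulmx_frobenius (U : 'M[R]_n) (v : 'cV[R]_n) :
  sqnorm (U *m v) <= (\sum_i \sum_j U i j ^+ 2) * sqnorm v.
Proof.
rewrite mulr_suml; apply: ler_sum => i _.
have p1 : psdmx (1%:M : 'M[R]_n).
  by split; [rewrite trmx1|move=> w; rewrite -/(qf _ _ _) -sqnormE sqnorm_ge0].
have := psd_cauchy (row i U)^T v p1; rewrite -!sqnormE.
have -> : qf 1%:M (row i U)^T v = (U *m v) i 0.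
  by rewrite /qf trmxK mulmx1 -row_mul mxE.
have -> // : sqnorm (row i U)^T = \sum_j U i j ^+ 2.
by apply: eq_bigr => j _; rewrite !mxE.
Qed.

Lemma L2bounded_entry h k K : vcont h ->
  (forall T, 0 <= T -> prim (fun t => sqnorm (h t)) T <= K) ->
  forall T, 0 <= T -> prim (fun t => h t k 0 ^+ 2) T <= K.
Proof.
move=> hc hK T T0; apply: le_trans (hK _ T0); apply: le_prim.
- by move=> t; under eq_fun do rewrite expr2; apply: cvgM; exact: hc.
- exact: continuous_sqnorm.
- by move=> t _; exact: sqnorm_entry.
Qed.

Lemma L2boundedD h1 h2 : vcont h1 -> vcont h2 -> L2bounded h1 -> L2bounded h2 ->
  L2bounded (fun t => h1 t + h2 t).
Proof.
move=> c1 c2 [K1 H1] [K2 H2]; exists (2 * K1 + 2 * K2) => T T0.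
have s1 := continuous_sqnorm c1; have s2 := continuous_sqnorm c2.
have m (q : R -> R) : continuous q -> continuous (fun t => 2 * q t).
  by move=> qc t; apply: cvgM; [exact: cvg_cst|exact: qc].
apply: (@le_trans _ _ (prim (fun t => 2 * sqnorm (h1 t) + 2 * sqnorm (h2 t)) T)).
  apply: le_prim; first by apply: continuous_sqnorm; exact: vcontD.
    by move=> t; apply: cvgD; exact: m.
  by move=> t _; exact: sqnormD_le.
rewrite primD; [|exact: m|exact: m].
by rewrite !primZ // lerD // ler_wpM2l // ?H1 ?H2.
Qed.

Lemma L2bounded_le h1 (C : R) (h2 : R -> 'cV[R]_n) : vcont h1 -> vcont h2 -> 0 <= C ->
  (forall t, 0 <= t -> sqnorm (h1 t) <= C * sqnorm (h2 t)) -> L2bounded h2 -> L2bounded h1.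
Proof.
move=> c1 c2 C0 h12 [K H]; exists (C * K) => T T0.
have s1 := continuous_sqnorm c1; have s2 := continuous_sqnorm c2.
apply: (@le_trans _ _ (prim (fun t => C * sqnorm (h2 t)) T)).
  by apply: le_prim => // t; apply: cvgM; [exact: cvg_cst|exact: s2].
by rewrite primZ // ler_wpM2l // H.
Qed.

Lemma hurwitz_flow_L2 M (v : 'cV[R]_n) x : hurwitz M ->
  vsol x (fun t => M *m x t) -> L2bounded x.
Proof.
move=> /hurwitz_energy[C [C0 H]] xs; exists (C * sqnorm (x 0)) => T T0.
have := H x (fun=> 0) T (@vcont_cst _ _ 0).
have -> : (fun t => M *m x t + 0) = (fun t => M *m x t) by apply/funext => t; rewrite addr0.
move=> /(_ xs T0).
rewrite sqnorm0 prim_cst // mul0r addr0; apply: le_trans.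
by rewrite lerDr sqnorm_ge0.
Qed.

(** The solution is the integral of exp(M (tau - t)) h(tau) over tau >= t. It is approximated by the
    solutions that vanish at time m: the backward energy estimate bounds these by C K uniformly in
    m, and they converge on bounded intervals because their initial values do. *)
Lemma antistable_L2 M h : hurwitz M -> vcont h -> L2bounded h ->
  exists z, vsol z (fun t => - (M *m z t) - h t) /\ L2bounded z.
Proof.
move=> Mh hc [K hK].
have [C [C0 H]] := hurwitz_energy_backward Mh.
pose E (u : R) := expmx (- M) (- u).
pose g u := E u *m - h u.
have Ec i j : continuous (fun u => E u i j) by exact: expmxN_continuous.
have gc : vcont g by apply: vcont_mulmx => //; exact: vcontN.
pose z c := duhamel (- M) c (fun t => - h t).
have zs c : vsol (z c) (fun t => - (M *m z c t) - h t).
  by apply: eq_vsol (duhamel_sol (- M) c (vcontN hc)) => t _; rewrite mulNmx.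
have z0 c : z c 0 = c by exact: duhamel0.
(* Starting Duhamel's formula at [- vprim g T] amounts to integrating backward from 0 at time T. *)
have zT T : z (- vprim g T) T = 0 by rewrite /z /duhamel addNr mulmx0.
have zK T : 0 <= T -> prim (fun t => sqnorm (z (- vprim g T) t)) T <= C * K.
  move=> T0; have := H _ h T hc (zs (- vprim g T)) T0.
  rewrite zT sqnorm0 add0r => L.
  apply: (le_trans _ (le_trans L _)); first by rewrite lerDr sqnorm_ge0.
  by rewrite ler_wpM2l ?(ltW C0) // hK.
(* [E u] is exp(M u), whose columns are trajectories of a Hurwitz system. *)
have Ecol j : L2bounded (fun u => E u *m delta_mx j 0).
  apply: (hurwitz_flow_L2 0 Mh); split.
    by apply: vcont_mulmx => //; exact: vcont_cst.
  move=> t t0; have := is_derive_mulmx (expmxN_derive (- M) t) (is_derive_cstmx (delta_mx j 0 : 'cV[R]_n) t).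
  move=> D; apply: (is_derive_eq D).
  by rewrite mulmx0 addr0 -expmxC -[- (- M *m _)]mulNmx opprK mulmxA.
(* Each coordinate of the limit is a sum of improper integrals of products of two square integrable
   functions. *)
have [c cP] : exists c : 'cV[R]_n, forall k, vprim g m%:R k 0 @[m --> \oo] --> c k 0.
  suff H1 k : exists l : R, vprim g m%:R k 0 @[m --> \oo] --> l.
    by exists (\col_k sval (cid (H1 k))) => k; rewrite mxE; exact: svalP (cid (H1 k)).
  have H2 j : exists l : R, prim (fun u => E u k j * - h u j 0) m%:R @[m --> \oo] --> l.
    have [K1 EK] := Ecol j.
    apply: (@prim_mul_cvg _ _ _ K1 K) => //.
    - by move=> u; apply: cvgN; exact: hc.
    - have -> : (fun u => E u k j ^+ 2) = (fun u => (E u *m (delta_mx j 0 : 'cV[R]_n)) k 0 ^+ 2).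
        by apply/funext => u; rewrite -colE [in RHS]mxE.
      by apply: L2bounded_entry => //; apply: vcont_mulmx => //; exact: vcont_cst.
    - under eq_fun do rewrite sqrrN.
      by move=> T T0; apply: L2bounded_entry.
  exists (\sum_j sval (cid (H2 j))).
  have -> : (fun m : nat => vprim g m%:R k 0) =
      (fun m : nat => \sum_j prim (fun u => E u k j * - h u j 0) m%:R).
    apply/funext => m; rewrite mxE -prim_sum; last first.
      move=> j u; apply: cvgM; first exact: Ec.
      by apply: cvgN; exact: hc.
    by apply: eq_prim => u _; rewrite mxE; apply: eq_bigr => j _; rewrite [(- h u) j 0]mxE.
  by apply: cvg_sumr => j _; exact: svalP (cid (H2 j)).
exists (z (- c)); split; first exact: zs.
exists (2 * (C * K) + 1) => S S0.
pose B t := \sum_i \sum_j expmx (- M) t i j ^+ 2.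
have Bc : continuous B.
  apply: continuous_sumr => i _; apply: continuous_sumr => j _ t.
  by under eq_fun do rewrite expr2; apply: cvgM; exact: expmx_continuous.
pose b := prim B S.
have b0 : 0 <= b.
  by apply: prim_ge0 => t _; apply: sumr_ge0 => i _; apply: sumr_ge0 => j _; rewrite sqr_ge0.
pose dl (m : nat) := vprim g m%:R - c.
have dl0 : sqnorm (dl m) @[m --> \oo] --> 0.
  have -> : 0 = \sum_(k < n) (0 : R) * 0 by rewrite big1 // => k _; rewrite mul0r.
  apply: cvg_sumr => k _; under eq_fun do rewrite expr2.
  have H3 : dl m k 0 @[m --> \oo] --> (0 : R).
    rewrite -(subrr (c k 0)); under eq_fun do rewrite mxBE.
    by apply: cvgB => //; exact: cvg_cst.
  by apply: cvgM.
(* On [0, S] the limit differs from the m-th approximation by exp(- M t) applied to [dl m]. As b is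
   the integral over [0, S] of the squared Frobenius norm of exp(- M t), the tolerance 1 / (2 (b +
   1)) makes this contribute at most 1. *)
have [m [mS mdl]] : exists m : nat, S <= m%:R /\ sqnorm (dl m) <= (2 * (b + 1))^-1.
  have e0 : 0 < (2 * (b + 1))^-1 by rewrite invr_gt0 mulr_gt0 // ltr_wpDl.
  have /cvgrPdist_le /(_ _ e0) [N _ HN] := dl0.
  exists (maxn N (Num.bound S)); split.
    by rewrite (le_trans (ltW (archi_boundP S0))) // ler_nat leq_maxr //.
  have := HN (maxn N (Num.bound S)) (leq_maxl _ _).
  by rewrite sub0r normrN ger0_norm // sqnorm_ge0.
have m0 : 0 <= m%:R :> R by [].
have zE t : z (- c) t = z (- vprim g m%:R) t + expmx (- M) t *m dl m.
  rewrite /z /duhamel -mulmxDr; congr (_ *m _).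
  by rewrite /dl addrAC [X in _ = X + _]addrA addNr add0r.
have zc (d : 'cV[R]_n) : vcont (z d) by case: (zs d).
have ec : vcont (fun t => expmx (- M) t *m dl m).
  by apply: vcont_mulmx; [exact: expmx_continuous|exact: vcont_cst].
have mc (a : R) (q : R -> R) : continuous q -> continuous (fun t => a * q t).
  by move=> qc t; apply: cvgM; [exact: cvg_cst|exact: qc].
have sc d := continuous_sqnorm (zc d).
apply: (@le_trans _ _ (prim (fun t => 2 * sqnorm (z (- vprim g m%:R) t)
    + 2 * sqnorm (dl m) * B t) S)).
  apply: le_prim; first exact: sc.
    by move=> t; apply: cvgD; apply: mc => //; exact: sc.
  move=> t _; rewrite zE; apply: le_trans (sqnormD_le _ _) _.
  by rewrite lerD2l -mulrA ler_wpM2l // mulrC; exact: sqnorm_mulmx_frobenius.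
rewrite primD; [|apply: mc; exact: sc|exact: mc].
rewrite !primZ //.
apply: lerD.
  rewrite ler_wpM2l //; apply: le_trans (zK _ m0).
  by apply: prim_nondecreasing => // t _; exact: sqnorm_ge0.
apply: (@le_trans _ _ (2 * (2 * (b + 1))^-1 * b)).
  by rewrite ler_wpM2r // ler_wpM2l.
have -> : 2 * (2 * (b + 1))^-1 * b = b / (b + 1) by field; rewrite gt_eqF // ltr_wpDl.
by rewrite ler_pdivrMr ?ltr_wpDl // mul1r lerDl.
Qed.

End StableSystems.

Section Discount.
Context {R : realType} {n : nat}.
Implicit Types (x h g : R -> 'cV[R]_n) (F M X : 'M[R]_n) (K T rho : R).
Notation mu := (@lebesgue_measure R).

Definition discount (a : R) h (t : R) : 'cV[R]_n := expR (a * t) *: h t.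

Lemma is_derive_expRM (a t : R) :
  is_derive t (1 : R) (fun t => expR (a * t)) (a * expR (a * t)).
Proof.
have d : is_derive t (1 : R) ( *%R a) a.
  by have := is_deriveZ a (is_derive_id t (1 : R)) => D; apply: (is_derive_eq D); rewrite /GRing.scale /= mulr1.
have := @is_derive1_comp R expR ( *%R a) t _ _ (is_derive_expR _) d.
by rewrite mulrC.
Qed.

Lemma continuous_expRM (a : R) : continuous (fun t : R => expR (a * t)).
Proof.
move=> t; apply: differentiable_continuous; apply/derivable1_diffP.
by have [] := is_derive_expRM a t.
Qed.

Lemma discount_vcont a h : vcont h -> vcont (discount a h).
Proof. by move=> hc; apply: vcontZ => //; exact: continuous_expRM. Qed.

Lemma is_derive_scale (a : R -> R) x a' (x' : 'cV[R]_n) (t : R) :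
  is_derive t (1 : R) a a' -> is_derive t (1 : R) x x' ->
  is_derive t (1 : R) (fun t => a t *: x t) (a' *: x t + a t *: x').
Proof.
move=> ad xd; apply: is_derive_mx => i j; under eq_fun do rewrite mxZE.
rewrite mxDE !mxZE.
have dx := is_derive_entry i j xd.
have D := is_deriveM ad dx; apply: (is_derive_eq D).
by rewrite /GRing.scale /=; ring.
Qed.

Lemma discount_vsol a x g : vsol x g ->
  vsol (discount a x) (fun t => a *: discount a x t + discount a g t).
Proof.
move=> [xc xd]; split; first exact: discount_vcont.
move=> t t0; have D := is_derive_scale (is_derive_expRM a t) (xd _ t0).
by apply: (is_derive_eq D); rewrite /discount scalerA.
Qed.

Lemma sqnorm_discount rho x t :
  sqnorm (discount (- (rho / 2)) x t) = expR (- rho * t) * sqnorm (x t).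
Proof.
rewrite /discount sqnormZ -expRM_natl; congr (expR _ * _).
by field.
Qed.

Lemma discountK a x : discount a (discount (- a) x) = x.
Proof.
by apply/funext => t; rewrite /discount scalerA -expRD mulNr subrr expR0 scale1r.
Qed.

Lemma discount_linear a M x : discount a (fun t => M *m x t) = (fun t => M *m discount a x t).
Proof. by apply/funext => t; rewrite /discount scalemxAr. Qed.

Lemma discountD a x h : discount a (fun t => x t + h t) = (fun t => discount a x t + discount a h t).
Proof. by apply/funext => t; rewrite /discount scalerDr. Qed.

Lemma CrhoP rho g : Crho rho g <->
  {within `[0, +oo[, continuous g} /\ L2bounded (discount (- (rho / 2)) (g \o clamp)).
Proof.
have E t : 0 <= t -> sqnorm (discount (- (rho / 2)) (g \o clamp) t) =
    expR (- rho * t) * sqnorm (g t).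
  by move=> t0; rewrite sqnorm_discount /= clamp_id.
have IE : (\int[mu]_(t in `[0%R, +oo[) (expR (- rho * t) * sqnorm (g t))%:E =
    \int[mu]_(t in `[0%R, +oo[) (sqnorm (discount (- (rho / 2)) (g \o clamp) t))%:E)%E.
  by apply: eq_integral => t; rewrite inE /= in_itv /= andbT => /E ->.
have pos u : 0 <= u -> 0 <= sqnorm (discount (- (rho / 2)) (g \o clamp) u).
  by move=> _; exact: sqnorm_ge0.
split=> -[gc].
- rewrite IE => H; split => //; apply: ge0_integral_bounded => //.
  by apply: continuous_sqnorm; apply: discount_vcont; exact/vcont_clamp.
- move=> [K HK]; split => //; rewrite IE.
  apply: le_lt_trans (ltry K); apply: ge0_integral_le => //.
  by apply: continuous_sqnorm; apply: discount_vcont; exact/vcont_clamp.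
Qed.

End Discount.

Section EigenSolutions.
Context {R : realType} {n : nat}.
Implicit Types (x h g : R -> 'cV[R]_n) (F M X : 'M[R]_n) (K T rho : R).

Lemma is_derive_cosM (b t : R) :
  is_derive t (1 : R) (fun t => cos (b * t)) (- b * sin (b * t)).
Proof.
have d : is_derive t (1 : R) ( *%R b) b.
  by have := is_deriveZ b (is_derive_id t (1 : R)) => D; apply: (is_derive_eq D); rewrite /GRing.scale /= mulr1.
have D := @is_derive1_comp R cos ( *%R b) t _ _ (is_derive_cos _) d.
by apply: (is_derive_eq D); rewrite mulrC mulrN mulNr.
Qed.

Lemma is_derive_sinM (b t : R) :
  is_derive t (1 : R) (fun t => sin (b * t)) (b * cos (b * t)).
Proof.
have d : is_derive t (1 : R) ( *%R b) b.
  by have := is_deriveZ b (is_derive_id t (1 : R)) => D; apply: (is_derive_eq D); rewrite /GRing.scale /= mulr1.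
have D := @is_derive1_comp R sin ( *%R b) t _ _ (is_derive_sin _) d.
by apply: (is_derive_eq D); rewrite mulrC.
Qed.

(* The real and imaginary parts of exp((al + i be) t) (a + i b). *)
Definition eigen_re (al be : R) (a b : 'cV[R]_n) (t : R) : 'cV[R]_n :=
  expR (al * t) *: (cos (be * t) *: a - sin (be * t) *: b).
Definition eigen_im (al be : R) (a b : 'cV[R]_n) (t : R) : 'cV[R]_n :=
  expR (al * t) *: (sin (be * t) *: a + cos (be * t) *: b).

Lemma vsol_everywhere x g : (forall t : R, is_derive t (1 : R) x (g t)) -> vsol x g.
Proof.
move=> xd; split=> [k t|t _]; last exact: xd.
apply: differentiable_continuous; apply/derivable1_diffP.
by have [] := is_derive_entry k 0 (xd t).
Qed.

Lemma eigen_re_sol M al be a b :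
  M *m a = al *: a - be *: b -> M *m b = be *: a + al *: b ->
  vsol (eigen_re al be a b) (fun t => M *m eigen_re al be a b t).
Proof.
move=> Ma Mb; apply: vsol_everywhere => t.
have D := is_derive_scale (is_derive_expRM al t) (is_deriveB
  (is_derive_scale (is_derive_cosM be t) (is_derive_cstmx a t))
  (is_derive_scale (is_derive_sinM be t) (is_derive_cstmx b t))).
apply: (is_derive_eq D).
rewrite /eigen_re -scalemxAr mulmxBr -!scalemxAr Ma Mb.
by apply/matrixP => i j; rewrite !mxE; ring.
Qed.

Lemma eigen_im_sol M al be a b :
  M *m a = al *: a - be *: b -> M *m b = be *: a + al *: b ->
  vsol (eigen_im al be a b) (fun t => M *m eigen_im al be a b t).
Proof.
move=> Ma Mb; apply: vsol_everywhere => t.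
have D := is_derive_scale (is_derive_expRM al t) (is_deriveD
  (is_derive_scale (is_derive_sinM be t) (is_derive_cstmx a t))
  (is_derive_scale (is_derive_cosM be t) (is_derive_cstmx b t))).
apply: (is_derive_eq D).
rewrite /eigen_im -scalemxAr mulmxDr -!scalemxAr Ma Mb.
by apply/matrixP => i j; rewrite !mxE; ring.
Qed.

Lemma eigen_sqnorm al be a b t :
  sqnorm (eigen_re al be a b t) + sqnorm (eigen_im al be a b t) =
  expR (al * t) ^+ 2 * (sqnorm a + sqnorm b).
Proof.
rewrite /eigen_re /eigen_im !sqnormZ -mulrDr; congr (_ * _).
rewrite /sqnorm -!big_split; apply: eq_bigr => k _ /=; rewrite !mxE.
have := cos2Dsin2 (be * t).
set c := cos _; set s := sin _ => cs.
transitivity ((c ^+ 2 + s ^+ 2) * (a k 0 ^+ 2 + b k 0 ^+ 2)); first by ring.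
by rewrite cs mul1r.
Qed.

(** For an eigenvalue al + i be, the real and imaginary parts of the exponential solution have
    squared norms adding up to exp(2 al t) times a positive constant, which is not integrable when
    al >= 0. *)
Lemma hurwitz_of_L2 M :
  (forall x, vsol x (fun t => M *m x t) -> L2bounded x) -> hurwitz M.
Proof.
move=> H lam /eigenvalue_realP[a [b [ab0 Ma Mb]]].
set al := complex.Re lam in Ma Mb *; set be := complex.Im lam in Ma Mb.
rewrite ltNge; apply/negP => al0.
have s1 := eigen_re_sol Ma Mb; have s2 := eigen_im_sol Ma Mb.
have [K1 H1] := H _ s1; have [K2 H2] := H _ s2.
have c1 := continuous_sqnorm s1.1; have c2 := continuous_sqnorm s2.1.
have ab : 0 < sqnorm a + sqnorm b.
  rewrite lt_neqAle addr_ge0 ?sqnorm_ge0 // andbT eq_sym.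
  rewrite paddr_eq0 ?sqnorm_ge0 //; apply/negP => /andP[/eqP/sqnorm_eq0 a0 /eqP/sqnorm_eq0 b0].
  by case: ab0; rewrite ?a0 ?b0 eqxx.
have [| |T T0|T T0] := @prim_bounded_small R
  (fun t => sqnorm (eigen_re al be a b t) + sqnorm (eigen_im al be a b t)) (K1 + K2) _ _ _ _ ab.
- by move=> t; apply: cvgD; [exact: c1|exact: c2].
- by move=> t _; rewrite addr_ge0 ?sqnorm_ge0.
- rewrite primD; [|exact: c1|exact: c2].
  by apply: lerD; [exact: H1|exact: H2].
rewrite eigen_sqnorm; apply/negP; rewrite -leNgt ler_peMl ?(ltW ab) //.
by rewrite exprn_ege1 // -expR0 ler_expR mulr_ge0.
Qed.

Lemma vsol_ode (F : 'M[R]_n) x : vsol x (fun t => F *m x t) ->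
  ode_sol (fun _ v => F *m v) x.
Proof. by move=> [xc xd]; split => //; exact: vcont_within. Qed.

Lemma observable_vsol p F (C : 'M[R]_(p, n)) x : observable F C ->
  vsol x (fun t => F *m x t) -> (forall t, 0 <= t -> C *m x t = 0) -> x 0 = 0.
Proof.
move=> obs xs Cx; apply: (obs x (fun=> 0)); first exact: vsol_ode.
- apply: vsol_ode; split; first exact: vcont_cst.
  by move=> t _; rewrite mulmx0; exact: is_derive_cstmx.
- by move=> t t0; rewrite mulmx0 Cx.
Qed.

Lemma observable_eigen p M (C : 'M[R]_(p, n)) (al be : R) (a b : 'cV[R]_n) : observable M C ->
  M *m a = al *: a - be *: b -> M *m b = be *: a + al *: b ->
  C *m a = 0 -> C *m b = 0 -> a = 0 /\ b = 0.
Proof.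
move=> obs Ma Mb Ca Cb; split.
- have := observable_vsol obs (eigen_re_sol Ma Mb).
  rewrite {2}/eigen_re !mulr0 expR0 cos0 sin0 !scale1r scale0r subr0; apply => t _.
  by rewrite /eigen_re -scalemxAr mulmxBr -!scalemxAr Ca Cb !scaler0 subr0 scaler0.
- have := observable_vsol obs (eigen_im_sol Ma Mb).
  rewrite {2}/eigen_im !mulr0 expR0 cos0 sin0 !scale1r scale0r add0r; apply => t _.
  by rewrite /eigen_im -scalemxAr mulmxDr -!scalemxAr Ca Cb !scaler0 addr0 scaler0.
Qed.

End EigenSolutions.

(** * Lyapunov and Riccati equations *)

Section LyapunovEquation.
Context {R : realType} {n : nat}.
Implicit Types (F X P W : 'M[R]_n).

(** Polarization on pairs of basis vectors. *)
Lemma mxeq_qf X Y : X^T = X -> Y^T = Y -> (forall v, qf X v v = qf Y v v) -> X = Y.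
Proof.
move=> Xs Ys XY.
suff Z0 (Z : 'M[R]_n) : Z^T = Z -> (forall v, qf Z v v = 0) -> Z = 0.
  apply/eqP; rewrite -subr_eq0; apply/eqP/Z0; first by rewrite linearB /= Xs Ys.
  by move=> v; rewrite qfDx qfNx XY subrr.
move=> Zs Z0; apply/matrixP => i j; rewrite [RHS]mxE.
have e (a b : 'I_n) : qf Z (delta_mx a 0) (delta_mx b 0) = Z a b.
  by rewrite /qf trmx_delta -rowE -colE !mxE.
have := Z0 (delta_mx i 0 + delta_mx j 0); rewrite qfDl !qfDr !Z0 !e add0r addr0.
have -> : Z j i = Z i j by rewrite -{1}Zs mxE.
lra.
Qed.

Lemma psd_ge0 X v : psdmx X -> 0 <= qf X v v.
Proof. by case=> _; exact. Qed.

Lemma qf1_mulr X u v : qf 1%:M u (X *m v) = qf X u v.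
Proof. by rewrite /qf mulmx1 !mulmxA. Qed.

Lemma qf_lyapunov F P v : P^T = P ->
  qf (F^T *m P + P *m F) v v = 2 * qf P v (F *m v).
Proof.
move=> Ps; have e : qf P v (F *m v) = qf P (F *m v) v by rewrite qfC Ps.
by rewrite qfDx mulr2n mulrDl mul1r {1}e qf_mull qf_mulr.
Qed.

Lemma psd_antisym X : psdmx X -> psdmx (- X) -> X = 0.
Proof.
move=> [Xs X0] [_ NX0]; apply: mxeq_qf => //; first by rewrite trmx0.
move=> v; have := X0 v; have := NX0 v; rewrite -!/(qf _ _ _) qfNx.
have -> : qf 0 v v = 0 by rewrite /qf mulmx0 mul0mx mxE.
lra.
Qed.

(** The form does not increase along the flow of F, and the flow is square integrable, hence small
    at some time T. So P(v, v) >= P(x(T), x(T)) >= - e for every positive e. *)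
Lemma lyapunov_psd F P : hurwitz F -> P^T = P ->
  (forall v, qf P v (F *m v) <= 0) -> psdmx P.
Proof.
move=> Fh Ps PF; split => // v; rewrite -/(qf _ _ _).
pose x t := expmx F t *m v; have xs : vsol x (fun t => F *m x t) := homogeneous_sol F v.
have x0 : x 0 = v by rewrite /x expmx0 mul1mx.
have [K xK] := hurwitz_flow_L2 v Fh xs.
have [C C0 HC] := @qf_ub R n (- P).
have le T : 0 <= T -> qf P (x T) (x T) <= qf P v v.
  move=> T0; rewrite -x0; apply: (@continuous_le_of_derive R (fun t => qf P (x t) (x t))
    (fun t => qf P (F *m x t) (x t) + qf P (x t) (F *m x t))) => //.
  - by apply: continuous_qf; exact: xs.1.
  - by move=> t t0; apply: is_derive_qf; exact: xs.2.
  - by move=> t t0; rewrite [qf P (_ *m _) _]qfC Ps; have := PF (x t); lra.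
apply/ler_addgt0Pr => e e0; rewrite -lerBlDl sub0r.
have [|||T T0 TH] := @prim_bounded_small R (fun t => sqnorm (x t)) K _ _ xK (e / C).
- by apply: continuous_sqnorm; exact: xs.1.
- by move=> u _; exact: sqnorm_ge0.
- exact: divr_gt0.
rewrite lerNl; apply: le_trans (le _ T0); rewrite lerNl -qfNx.
by apply: le_trans (HC _) _; rewrite mulrC -ler_pdivlMr // ltW.
Qed.

(** The equation makes X(x(t), y(t)) constant along any two trajectories of F, and both are small at
    some time. *)
Lemma lyapunov_inj F X : hurwitz F -> F^T *m X + X *m F = 0 -> X = 0.
Proof.
move=> Fh XF.
have z u v : qf X u v <= 0.
  pose x t := expmx F t *m u; pose y t := expmx F t *m v.
  have xs : vsol x (fun t => F *m x t) := homogeneous_sol F u.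
  have ys : vsol y (fun t => F *m y t) := homogeneous_sol F v.
  have [Kx xK] := hurwitz_flow_L2 u Fh xs; have [Ky yK] := hurwitz_flow_L2 v Fh ys.
  have [C C0 HC] := sqnorm_mulmx X.
  have cst T : 0 <= T -> - qf X (x T) (y T) <= - qf X u v.
    have -> : - qf X u v = - qf X (x 0) (y 0) by rewrite /x /y expmx0 !mul1mx.
    move=> T0; apply: (@continuous_le_of_derive R (fun t => - qf X (x t) (y t))
      (fun t => - (qf X (F *m x t) (y t) + qf X (x t) (F *m y t)))) => //.
    - by move=> t; apply: cvgN; apply: continuous_qf; [exact: xs.1|exact: ys.1].
    - by move=> t t0; apply: is_deriveN; apply: is_derive_qf; [exact: xs.2|exact: ys.2].
    - move=> t t0; rewrite qf_mull qf_mulr.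
      suff -> : (((x t)^T *m (F^T *m X) *m y t) 0 0 + ((x t)^T *m (X *m F) *m y t) 0 0) = 0 by rewrite oppr0.
      by rewrite -mxDE -mulmxDl -mulmxDr XF mulmx0 mul0mx mxE.
  apply/ler_addgt0Pr => e e0; rewrite add0r.
  have sx := continuous_sqnorm xs.1; have sy := continuous_sqnorm ys.1.
  (* Adding the two energies provides one time at which both trajectories are small. *)
  have [||T T0|T T0 TH] := @prim_bounded_small R (fun t => sqnorm (x t) + C * sqnorm (y t)) (Kx + C * Ky) _ _ _ e e0.
  - move=> t; apply: cvgD; first exact: sx.
    by apply: cvgM; [exact: cvg_cst|exact: sy].
  - by move=> t _; rewrite addr_ge0 ?sqnorm_ge0 // mulr_ge0 ?sqnorm_ge0 // ltW.
  - rewrite primD ?primZ //; first by apply: lerD; [exact: xK|rewrite ler_wpM2l ?yK // ltW].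
    by move=> t; apply: cvgM; [exact: cvg_cst|exact: sy].
  have := cst T T0; rewrite lerN2 => /le_trans; apply.
  have p1 : psdmx (1%:M : 'M[R]_n).
    by split; [rewrite trmx1|move=> w; rewrite -/(qf _ _ _) -sqnormE sqnorm_ge0].
  have := psd_young (x T) (X *m y T) p1 ltr01.
  have -> : qf 1%:M (x T) (X *m y T) = qf X (x T) (y T) by exact: qf1_mulr.
  rewrite invr1 !mul1r -!sqnormE.
  have := HC (y T); have := sqnorm_ge0 (x T); have := sqnorm_ge0 (y T); move: TH.
  set a := C * _; have := sqnorm_ge0 (X *m y T).
  lra.
(* Replacing u by - u reverses the inequality. *)
have {}z u v : qf X u v = 0.
  by apply/eqP; rewrite eq_le z /=; have := z (- u) v; rewrite qfNl oppr_le0.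
apply/matrixP => i j; rewrite [RHS]mxE -(z (delta_mx i 0) (delta_mx j 0)).
by rewrite /qf trmx_delta -rowE -colE !mxE.
Qed.

(** Injectivity is enough: the Lyapunov operator is an endomorphism of the finite-dimensional space
    of matrices. *)
Lemma lyapunov_solve F W : hurwitz F -> exists X, F^T *m X + X *m F = W.
Proof.
move=> Fh.
pose f (X : 'M[R]_n) := F^T *m X + X *m F.
have fl : linear f.
  by move=> a X Y; rewrite /f mulmxDr mulmxDl -scalemxAr -scalemxAl scalerDr addrACA.
pose fL : {linear 'M[R]_n -> 'M[R]_n} := HB.pack f (GRing.isLinear.Build _ _ _ _ f fl).
have inj : lker (linfun fL) == 0%VS.
  apply/lker0P => X Y; rewrite !lfunE /= => /eqP; rewrite -subr_eq0 => /eqP XY.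
  apply/eqP; rewrite -subr_eq0; apply/eqP/(lyapunov_inj Fh).
  by rewrite -[RHS]XY /f mulmxBr mulmxBl addrACA opprD.
exists ((linfun fL)^-1%VF W).
by have := lker0_lfunVK inj W; rewrite lfunE.
Qed.

Lemma lyapunov_solve_sym F W : hurwitz F -> W^T = W ->
  exists2 X, X^T = X & F^T *m X + X *m F = W.
Proof.
move=> Fh Ws; have [X XW] := lyapunov_solve W Fh; exists X => //.
apply/eqP; rewrite -subr_eq0; apply/eqP/(lyapunov_inj Fh).
have : (F^T *m X + X *m F)^T = W by rewrite XW.
rewrite linearD /= !trmx_mul trmxK => XW'.
rewrite mulmxBr mulmxBl addrACA -opprD XW.
by rewrite [X in X - _]addrC XW' subrr.
Qed.

End LyapunovEquation.

(** Each equation is solved for [A^T *m P1] or [A^T *m P2] and substituted; what remains is linear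
    in folded products, within reach of [ring] entry by entry. *)
Lemma are_difference (R : realType) n (A T P1 P2 Q : 'M[R]_n) :
  T^T = T -> P1^T = P1 ->
  A^T *m P1 + P1 *m A - P1 *m T *m P1 + Q = 0 ->
  A^T *m P2 + P2 *m A - P2 *m T *m P2 + Q = 0 ->
  (A - T *m P1)^T *m (P1 - P2) + (P1 - P2) *m (A - T *m P1)
  = - ((P1 - P2) *m T *m (P1 - P2)).
Proof.
move=> Ts s1 e1 e2.
have f1 : A^T *m P1 = - (P1 *m A) + P1 *m T *m P1 - Q.
  by apply/eqP; rewrite -subr_eq0 -e1; apply/eqP/matrixP => i j; rewrite !(mxDE, mxNE); ring.
have f2 : A^T *m P2 = - (P2 *m A) + P2 *m T *m P2 - Q.
  by apply/eqP; rewrite -subr_eq0 -e2; apply/eqP/matrixP => i j; rewrite !(mxDE, mxNE); ring.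
have -> : (A - T *m P1)^T = A^T - P1 *m T by rewrite linearB /= trmx_mul Ts s1.
rewrite !(mulmxBl, mulmxBr) f1 f2 !mulmxA.
by apply/matrixP => i j; rewrite !(mxDE, mxNE); ring.
Qed.

Section Riccati.
Context {R : realType} {n r p : nat}.
Variables (A : 'M[R]_n) (B : 'M[R]_(n, r)) (Rm : 'M[R]_r) (C : 'M[R]_(p, n)).
Hypotheses (Rpd : pdmx Rm) (obs : observable A C).
Implicit Types (F X P W M : 'M[R]_n) (K : 'M[R]_(r, n)).

(* LaSalle's principle for the form [P]: the derivative - W vanishes only on
   unobservable trajectories of A. *)
Definition lasalle P M W :=
  [/\ psdmx W, forall v, 2 * qf P v (M *m v) = - qf W v v &
      forall v, qf W v v = 0 -> M *m v = A *m v /\ C *m v = 0].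

(** For an eigenvector a + i b of M with real part al of the eigenvalue, adding the identities at a
    and b gives 2 al (P(a) + P(b)) = - (W(a) + W(b)). If al >= 0 both W(a) and W(b) vanish, so a + i
    b is an eigenvector of A killed by C, against observability. *)
Lemma lasalle_hurwitz P M W : psdmx P -> lasalle P M W -> hurwitz M.
Proof.
move=> Pp [Wp PM Wz] lam /eigenvalue_realP[a [b [ab0 Ma Mb]]].
set al := complex.Re lam in Ma Mb *; set be := complex.Im lam in Ma Mb.
rewrite ltNge; apply/negP => al0.
have Pab : qf P b a = qf P a b by rewrite qfC Pp.1.
have := PM a; have := PM b; rewrite {1}Ma {1}Mb qfDr qfDr qfNr !qfZr Pab => Wb Wa.
have Pa := psd_ge0 a Pp; have Pb := psd_ge0 b Pp.
have Wa0 := psd_ge0 a Wp; have Wb0 := psd_ge0 b Wp.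
have Pa' := mulr_ge0 al0 Pa; have Pb' := mulr_ge0 al0 Pb.
have [E1 E2] : qf W a a = 0 /\ qf W b b = 0 by split; lra.
have [Aa Ca] := Wz _ E1; have [Ab Cb] := Wz _ E2.
have [a0 b0] := observable_eigen obs (esym (etrans (esym Ma) Aa)) (esym (etrans (esym Mb) Ab)) Ca Cb.
by case: ab0; rewrite ?a0 ?b0 eqxx.
Qed.

(** If P(v, v) = 0 then P stays 0 along the flow of M, so W vanishes there too: the trajectory is
    one of A with zero output, and v = 0. *)
Lemma lasalle_pd P M W : psdmx P -> lasalle P M W -> pdmx P.
Proof.
move=> Pp [Wp PM Wz]; split; first exact: Pp.1.
move=> v v0; rewrite -/(qf _ _ _) lt_neqAle psd_ge0 // andbT eq_sym.
apply: contra v0 => /eqP Pv.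
pose x t := expmx M t *m v; have xs : vsol x (fun t => M *m x t) := homogeneous_sol M v.
have x0 : x 0 = v by rewrite /x expmx0 mul1mx.
have Px t : 0 <= t -> P *m x t = 0.
  move=> t0; apply: psd_qf0 => //; apply/eqP; rewrite eq_le psd_ge0 // andbT -Pv -x0.
  apply: (@continuous_le_of_derive R (fun t => qf P (x t) (x t))
    (fun t => qf P (M *m x t) (x t) + qf P (x t) (M *m x t))) => //.
  - by apply: continuous_qf; exact: xs.1.
  - by move=> u u0; apply: is_derive_qf; exact: xs.2.
  - move=> u u0; rewrite [qf P (_ *m _) _]qfC Pp.1.
    by have := PM (x u); have := psd_ge0 (x u) Wp; lra.
have Wx t : 0 <= t -> M *m x t = A *m x t /\ C *m x t = 0.
  move=> t0; apply: Wz; have := PM (x t); rewrite qfC Pp.1.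
  by rewrite /qf -mulmxA Px // mulmx0 mxE mulr0 => /esym/eqP; rewrite oppr_eq0 => /eqP.
rewrite -x0; apply/eqP; apply: (observable_vsol obs) => [|t t0]; last by case: (Wx t t0).
by apply: eq_vsol xs => t t0; case: (Wx t (ltW t0)).
Qed.

Definition gainmx P : 'M[R]_(r, n) := - (invmx Rm *m B^T *m P).

(** The undiscounted equation with weight C^T C; [riccati_are] reduces the discounted one to it by
    shifting A by rho / 2. *)
Definition are P := A^T *m P + P *m A - P *m B *m invmx Rm *m B^T *m P + C^T *m C = 0.

Definition closed_loop P := A - B *m invmx Rm *m B^T *m P.

Lemma closed_loopE P : A + B *m gainmx P = closed_loop P.
Proof. by rewrite /gainmx /closed_loop mulmxN !mulmxA. Qed.

Let Ru : Rm \in unitmx := pdmx_unit Rpd.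
Let Rs : Rm^T = Rm := Rpd.1.

(** The stationarity condition R K + B^T P = 0 of the optimal gain K, transposed. Through this
    relation alone the gain enters [lasalle_gain]. *)
Lemma gain_adj P : P^T = P -> P *m B = - ((gainmx P)^T *m Rm).
Proof.
move=> Ps; rewrite /gainmx linearN /= mulNmx opprK !trmx_mul trmxK trmx_inv Rs Ps.
by rewrite -!mulmxA mulVmx // mulmx1.
Qed.

Lemma qf_gram m (D : 'M[R]_(m, n)) (S : 'M[R]_m) v : qf (D^T *m S *m D) v v = qf S (D *m v) (D *m v).
Proof. by rewrite /qf trmx_mul !mulmxA. Qed.

Lemma psd_gram m (D : 'M[R]_(m, n)) (S : 'M[R]_m) : psdmx S -> psdmx (D^T *m S *m D).
Proof.
move=> [Ss S0]; split; first by rewrite !trmx_mul trmxK Ss mulmxA.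
by move=> v; rewrite -/(qf _ _ _) qf_gram; exact: S0.
Qed.

Lemma psdD X Y : psdmx X -> psdmx Y -> psdmx (X + Y).
Proof.
move=> [Xs X0] [Ys Y0]; split; first by rewrite linearD /= Xs Ys.
by move=> v; rewrite -/(qf _ _ _) qfDx addr_ge0 //; [exact: X0|exact: Y0].
Qed.

Lemma psd1 m : psdmx (1%:M : 'M[R]_m).
Proof.
by split; [rewrite trmx1|move=> w; rewrite -/(qf _ _ _) -sqnormE sqnorm_ge0].
Qed.

Lemma psd_CC : psdmx (C^T *m C).
Proof. by rewrite -(mulmx1 C^T); apply: psd_gram; exact: psd1. Qed.

(* The two-gain form of the Lyapunov identity behind policy iteration. *)
Lemma lasalle_gain K K' P : P^T = P -> P *m B = - (K'^T *m Rm) ->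
  (A + B *m K)^T *m P + P *m (A + B *m K) = - (C^T *m C + K^T *m Rm *m K) ->
  lasalle P (A + B *m K') (C^T *m C + K'^T *m Rm *m K' + (K - K')^T *m Rm *m (K - K')).
Proof.
move=> Ps PB PK.
have BP : B^T *m P = - (Rm *m K').
  by have := congr1 trmx PB; rewrite trmx_mul Ps linearN /= trmx_mul trmxK Rs.
have Rpsd := pdmx_psd Rpd.
have q1 v : 0 <= qf (C^T *m C) v v by apply: psd_ge0; exact: psd_CC.
have q2 (D : 'M[R]_(r, n)) v : 0 <= qf (D^T *m Rm *m D) v v by apply: psd_ge0; exact: psd_gram.
split.
- by apply: psdD; [apply: psdD; [exact: psd_CC|exact: psd_gram]|exact: psd_gram].
- move=> v.
  have E : 2 * qf P v ((A + B *m K) *m v) = - qf (C^T *m C + K^T *m Rm *m K) v v.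
    by rewrite -qfNx -PK qf_lyapunov.
  have -> : (A + B *m K') *m v = (A + B *m K) *m v - B *m (K - K') *m v.
    by rewrite -mulmxBl; congr (_ *m _); rewrite mulmxBr opprB addrACA subrr addr0.
  rewrite qfDr qfNr mulrDr E.
  have -> : qf P v (B *m (K - K') *m v) = - qf Rm (K' *m v) ((K - K') *m v).
    rewrite /qf trmx_mul -!mulmxA [P *m _]mulmxA PB.
    by rewrite !(mulNmx, mulmxN) mxNE !mulmxA.
  rewrite !qfDx !qf_gram mulmxBl.
  (* Completing the square: with K v = a + d the cross terms 2 R(a, d) cancel and - R(a, a) - R(d,
     d) remains. *)
  have [d ->] : exists d, K *m v = K' *m v + d.
    by exists (K *m v - K' *m v); rewrite addrC subrK.
  set a := K' *m v.
  rewrite [a + d - a]addrAC subrr add0r !(qfDl, qfDr).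
  have -> : qf Rm d a = qf Rm a d by rewrite qfC Rs.
  ring.
- move=> v; rewrite !qfDx => W0.
  have := q1 v; have := q2 K' v; have := q2 (K - K') v => h3 h2 h1.
  have z1 : qf (C^T *m C) v v = 0 by lra.
  have z2 : qf (K'^T *m Rm *m K') v v = 0 by lra.
  split.
    have : K' *m v = 0.
      apply/eqP; apply: contraT => kv; have := Rpd.2 _ kv.
      by rewrite -/(qf _ _ _) -qf_gram z2 ltxx.
    by rewrite mulmxDl -mulmxA => ->; rewrite mulmx0 addr0.
  by apply: sqnorm_eq0; rewrite sqnormE -qf_gram mulmx1.
Qed.

Lemma are_lyapunov P : P^T = P -> are P ->
  (A + B *m gainmx P)^T *m P + P *m (A + B *m gainmx P)
  = - (C^T *m C + (gainmx P)^T *m Rm *m gainmx P).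
Proof.
move=> Ps.
have g1 : (gainmx P)^T *m Rm = - (P *m B) by rewrite gain_adj // opprK.
have g2 : P *m B *m gainmx P = - (P *m B *m invmx Rm *m B^T *m P).
  by rewrite /gainmx mulmxN !mulmxA.
have g3 : (B *m gainmx P)^T *m P = P *m B *m gainmx P.
  rewrite g2 /gainmx mulmxN linearN /= mulNmx !trmx_mul trmxK trmx_inv Rs Ps !mulmxA.
  by [].
rewrite /are linearD /= mulmxDl mulmxDr g3 g1 mulNmx mulmxA g2 opprK => H.
set S := P *m B *m invmx Rm *m B^T *m P in H *.
have -> : A^T *m P = - (P *m A) + S - C^T *m C.
  by apply/eqP; rewrite -subr_eq0 -H; apply/eqP/matrixP => i j; rewrite !mxE; ring.
by apply/matrixP => i j; rewrite !mxE; ring.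
Qed.

(** The two gains of [lasalle_gain] coincide here: a Riccati solution is the cost matrix of its own
    gain. *)
Lemma are_lasalle P : P^T = P -> are P -> exists W, lasalle P (closed_loop P) W.
Proof.
move=> Ps /(are_lyapunov Ps) L; rewrite -closed_loopE; eexists.
by apply: lasalle_gain L => //; exact: gain_adj.
Qed.

Lemma are_stabilizing P : psdmx P -> are P -> hurwitz (closed_loop P).
Proof. by move=> Pp /(are_lasalle Pp.1)[W]; exact: lasalle_hurwitz. Qed.

Lemma are_pd P : psdmx P -> are P -> pdmx P.
Proof. by move=> Pp /(are_lasalle Pp.1)[W]; exact: lasalle_pd. Qed.

Lemma are_stabilizable P : psdmx P -> are P -> stabilizable A B.
Proof. by move=> Pp Pe; exists (gainmx P); rewrite closed_loopE; exact: are_stabilizing. Qed.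

(* With D = P1 - P2 the two equations combine to
   (A - S P1)^T D + D (A - S P1) = - D S D <= 0. *)
Lemma are_le P1 P2 : P1^T = P1 -> P2^T = P2 -> are P1 -> are P2 ->
  hurwitz (closed_loop P1) -> psdmx (P1 - P2).
Proof.
move=> s1 s2 e1 e2 h1; apply: (lyapunov_psd h1); first by rewrite linearB /= s1 s2.
move=> v; set D := P1 - P2.
have Ds : D^T = D by rewrite linearB /= s1 s2.
have E : (closed_loop P1)^T *m D + D *m closed_loop P1
    = - (D *m B *m invmx Rm *m B^T *m D).
  have Ts : (B *m invmx Rm *m B^T)^T = B *m invmx Rm *m B^T.
    by rewrite !trmx_mul trmxK trmx_inv Rs mulmxA.
  have := @are_difference _ _ A _ P1 P2 (C^T *m C) Ts s1.
  by rewrite !mulmxA; apply.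
have : 2 * qf D v (closed_loop P1 *m v) = - qf (D *m B *m invmx Rm *m B^T *m D) v v.
  by rewrite -qfNx -E qf_lyapunov.
have : 0 <= qf (D *m B *m invmx Rm *m B^T *m D) v v.
  have -> : D *m B *m invmx Rm *m B^T *m D = (invmx Rm *m B^T *m D)^T *m Rm *m (invmx Rm *m B^T *m D).
    by rewrite !trmx_mul trmxK trmx_inv Rs Ds -!mulmxA [Rm *m _]mulKVmx.
  by rewrite qf_gram; apply: psd_ge0; exact: pdmx_psd.
lra.
Qed.

Lemma are_unique P1 P2 : P1^T = P1 -> P2^T = P2 -> are P1 -> are P2 ->
  hurwitz (closed_loop P1) -> hurwitz (closed_loop P2) -> P1 = P2.
Proof.
move=> s1 s2 e1 e2 h1 h2; apply/eqP; rewrite -subr_eq0; apply/eqP/psd_antisym.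
  exact: are_le.
by rewrite opprB; exact: are_le.
Qed.

End Riccati.

Section PolicyIteration.
Context {R : realType} {n r p : nat}.
Variables (A : 'M[R]_n) (B : 'M[R]_(n, r)) (Rm : 'M[R]_r) (C : 'M[R]_(p, n)).
Hypotheses (Rpd : pdmx Rm) (obs : observable A C).
Implicit Types (F X P W M : 'M[R]_n) (K : 'M[R]_(r, n)).
Notation gain := (gainmx B Rm).

(** P is the cost matrix of the fixed feedback K: when the closed loop is stable, v^T P v is the
    integral of |C x|^2 + (K x)^T R (K x) along the trajectory x from v. *)
Definition policy_eq K P :=
  (A + B *m K)^T *m P + P *m (A + B *m K) = - (C^T *m C + K^T *m Rm *m K).

Lemma policy_eval K : hurwitz (A + B *m K) -> exists P, psdmx P /\ policy_eq K P.
Proof.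
move=> Kh.
have Wp : psdmx (C^T *m C + K^T *m Rm *m K).
  by apply: psdD; [exact: psd_CC|apply: psd_gram; exact: pdmx_psd].
have [|P Ps PE] := @lyapunov_solve_sym R n _ (- (C^T *m C + K^T *m Rm *m K)) Kh.
  by rewrite linearN /= Wp.1.
exists P; split => //; apply: (lyapunov_psd Kh Ps) => v.
by have := qf_lyapunov (A + B *m K) v Ps; rewrite PE qfNx; have := psd_ge0 v Wp; lra.
Qed.

(** The cost matrix of the old gain serves as Lyapunov function of the improved one, through
    LaSalle's principle. *)
Lemma policy_improve K P : psdmx P -> policy_eq K P -> hurwitz (A + B *m gain P).
Proof.
move=> Pp PE; apply: (lasalle_hurwitz obs Pp).
by apply: (lasalle_gain Rpd Pp.1 _ PE); exact: gain_adj Pp.1.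
Qed.

(** Along the improved closed loop the two costs decrease at rates differing by the form R of K
    minus the new gain, so the difference decreases and [lyapunov_psd] applies. *)
Lemma policy_le K P1 P2 : psdmx P1 -> psdmx P2 -> policy_eq K P1 ->
  policy_eq (gain P1) P2 -> psdmx (P1 - P2).
Proof.
move=> p1 p2 e1 e2; have h := policy_improve p1 e1.
apply: (lyapunov_psd h); first by rewrite linearB /= p1.1 p2.1.
move=> v; have [_ L _] := lasalle_gain Rpd p1.1 (gain_adj B Rpd p1.1) e1.
have := L v; have := qf_lyapunov (A + B *m gain P1) v p2.1; rewrite e2 qfNx qfDx qfNx.
rewrite [in X in _ -> X -> _]qfDx.
have := psd_ge0 v (psd_gram (K - gain P1) (pdmx_psd Rpd)).
lra.
Qed.

Definition mxlim m1 m2 (U : nat -> 'M[R]_(m1, m2)) (L : 'M[R]_(m1, m2)) : Prop :=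
  forall i j, U k i j @[k --> \oo] --> L i j.

Lemma mxlim_mul m1 m2 m3 (U : nat -> 'M[R]_(m1, m2)) (V : nat -> 'M[R]_(m2, m3)) L1 L2 :
  mxlim U L1 -> mxlim V L2 -> mxlim (fun k => U k *m V k) (L1 *m L2).
Proof.
move=> UL VL i j; rewrite mxE; under eq_fun do rewrite mxE.
by apply: cvg_sumr => l _; apply: cvgM; [exact: UL|exact: VL].
Qed.

Lemma mxlimD m1 m2 (U V : nat -> 'M[R]_(m1, m2)) L1 L2 :
  mxlim U L1 -> mxlim V L2 -> mxlim (fun k => U k + V k) (L1 + L2).
Proof.
move=> UL VL i j; rewrite mxE; under eq_fun do rewrite mxE.
by apply: cvgD; [exact: UL|exact: VL].
Qed.

Lemma mxlimN m1 m2 (U : nat -> 'M[R]_(m1, m2)) L1 :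
  mxlim U L1 -> mxlim (fun k => - U k) (- L1).
Proof.
by move=> UL i j; rewrite mxE; under eq_fun do rewrite mxE; apply: cvgN; exact: UL.
Qed.

Lemma mxlim_tr m1 m2 (U : nat -> 'M[R]_(m1, m2)) L1 :
  mxlim U L1 -> mxlim (fun k => (U k)^T) L1^T.
Proof. by move=> UL i j; rewrite mxE; under eq_fun do rewrite mxE; exact: UL. Qed.

Lemma mxlim_cst m1 m2 (U : 'M[R]_(m1, m2)) : mxlim (fun=> U) U.
Proof. by move=> i j; exact: cvg_cst. Qed.

Lemma mxlim_unique m1 m2 (U : nat -> 'M[R]_(m1, m2)) L1 L2 :
  mxlim U L1 -> mxlim U L2 -> L1 = L2.
Proof.
by move=> U1 U2; apply/matrixP => i j; apply: cvg_unique (U1 i j) (U2 i j).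
Qed.

Lemma mxlim_shift m1 m2 (U : nat -> 'M[R]_(m1, m2)) L :
  mxlim U L -> mxlim (fun k => U k.+1) L.
Proof. by move=> UL i j; have := UL i j; rewrite -(cvg_shiftS (fun k => U k i j)). Qed.

Lemma mxlim_qf (U : nat -> 'M[R]_n) L v :
  mxlim U L -> qf (U k) v v @[k --> \oo] --> qf L v v.
Proof.
move=> UL.
have H := mxlim_mul (mxlim_mul (@mxlim_cst _ _ v^T) UL) (@mxlim_cst _ _ v).
have := H 0 0; rewrite /qf.
by [].
Qed.

(* Polarization turns monotone convergence of the forms into convergence. *)
Lemma psd_seq_lim (U : nat -> 'M[R]_n) : (forall k, psdmx (U k)) ->
  (forall k, psdmx (U k - U k.+1)) -> exists2 L, psdmx L & mxlim U L.
Proof.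
move=> Up Ud.
have qcvg v : exists l : R, qf (U k) v v @[k --> \oo] --> l.
  apply/cvg_ex; apply: nonincreasing_is_cvgn.
    apply/nonincreasing_seqP => k; rewrite -subr_ge0 -qfNx -qfDx.
    exact: psd_ge0.
  by exists 0 => _ [k _ <-]; exact: psd_ge0.
have e (X : 'M[R]_n) (a b : 'I_n) : qf X (delta_mx a 0) (delta_mx b 0) = X a b.
  by rewrite /qf trmx_delta -rowE -colE !mxE.
have ecvg i j : exists l : R, U k i j @[k --> \oo] --> l.
  have [l1 h1] := qcvg (delta_mx i 0 + delta_mx j 0).
  have [l2 h2] := qcvg (delta_mx i 0); have [l3 h3] := qcvg (delta_mx j 0).
  exists (2^-1 * (l1 - l2 - l3)).
  have -> : (fun k => U k i j) = (fun k => 2^-1 *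
    (qf (U k) (delta_mx i 0 + delta_mx j 0) (delta_mx i 0 + delta_mx j 0)
     - qf (U k) (delta_mx i 0) (delta_mx i 0) - qf (U k) (delta_mx j 0) (delta_mx j 0))).
    apply/funext => k; rewrite qfDl !qfDr !e.
    have -> : U k j i = U k i j by rewrite -{1}(Up k).1 mxE.
    by field.
  by apply: cvgM; [exact: cvg_cst|apply: cvgB => //; apply: cvgB].
pose L := \matrix_(i, j) sval (cid (ecvg i j)).
have UL : mxlim U L by move=> i j; rewrite mxE; exact: svalP (cid (ecvg i j)).
exists L => //; split.
  apply: mxlim_unique (UL); have := mxlim_tr UL.
  by have -> : (fun k => (U k)^T) = U by apply/funext => k; rewrite (Up k).1.
move=> v; rewrite -/(qf _ _ _).
have H := mxlim_qf (v := v) UL; have <- := cvg_lim (@Rhausdorff R) H; apply: limr_ge.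
  by apply/cvg_ex; exists (qf L v v).
by apply: nearW => k; exact: psd_ge0.
Qed.

(** Converse of [are_lyapunov]: a fixed point of the iteration solves the Riccati equation. *)
Lemma are_policy P : P^T = P -> policy_eq (gain P) P -> are A B Rm C P.
Proof.
move=> Ps.
have Rs : Rm^T = Rm := Rpd.1.
have g1 : (gain P)^T *m Rm = - (P *m B) by rewrite (gain_adj B Rpd Ps) opprK.
have g2 : P *m B *m gain P = - (P *m B *m invmx Rm *m B^T *m P).
  by rewrite /gainmx mulmxN !mulmxA.
have g3 : (B *m gain P)^T *m P = P *m B *m gain P.
  rewrite g2 /gainmx mulmxN linearN /= mulNmx !trmx_mul trmxK trmx_inv Rs Ps !mulmxA.
  by [].
rewrite /policy_eq linearD /= mulmxDl mulmxDr g3 g1 mulNmx mulmxA g2 opprK /are => H.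
set S := P *m B *m invmx Rm *m B^T *m P in H *.
have -> : A^T *m P = - (P *m A) + S - C^T *m C; last first.
  by apply/matrixP => i j; rewrite !(mxDE, mxNE) [RHS]mxE; ring.
transitivity (A^T *m P + - S + (P *m A + - S) - (P *m A) + S + S).
  by apply/matrixP => i j; rewrite !(mxDE, mxNE); ring.
by rewrite H; apply/matrixP => i j; rewrite !(mxDE, mxNE); ring.
Qed.

Theorem are_exists : stabilizable A B -> exists2 P, pdmx P & are A B Rm C P.
Proof.
move=> [K0 K0h].
(* Iterating on gains paired with a proof of stability makes each policy evaluation well defined. *)
pose evalP (k : {K | hurwitz (A + B *m K)}) := sval (cid (policy_eval (svalP k))).
have evalPP k : psdmx (evalP k) /\ policy_eq (sval k) (evalP k).
  exact: svalP (cid (policy_eval (svalP k))).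
pose next k : {K | hurwitz (A + B *m K)} :=
  exist _ (gain (evalP k)) (policy_improve (evalPP k).1 (evalPP k).2).
pose S m := iter m next (exist _ K0 K0h).
pose U m := evalP (S m).
have Uq m : policy_eq (gain (U m)) (U m.+1) := (evalPP (S m.+1)).2.
have [L Lp UL] : exists2 L, psdmx L & mxlim U L.
  apply: psd_seq_lim => m; first exact: (evalPP (S m)).1.
  exact: (policy_le (evalPP (S m)).1 (evalPP (S m.+1)).1 (evalPP (S m)).2 (Uq m)).
suff Le : are A B Rm C L by exists L => //; exact: (are_pd Rpd obs Lp Le).
apply: are_policy; first exact: Lp.1.
have gl : mxlim (fun m => gain (U m)) (gain L).
  by apply: mxlimN; apply: mxlim_mul => //; exact: mxlim_cst.
have cl : mxlim (fun m => A + B *m gain (U m)) (A + B *m gain L).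
  by apply: mxlimD; [exact: mxlim_cst|apply: mxlim_mul => //; exact: mxlim_cst].
have sl := mxlim_shift UL.
(* Both sides of the equation that links [U m] and [U m.+1] converge; its limit is the fixed point
   equation. *)
apply: (@mxlim_unique _ _ (fun m => (A + B *m gain (U m))^T *m U m.+1
   + U m.+1 *m (A + B *m gain (U m)))).
  by apply: mxlimD; apply: mxlim_mul => //; exact: mxlim_tr.
have -> : (fun m => (A + B *m gain (U m))^T *m U m.+1 + U m.+1 *m (A + B *m gain (U m)))
  = (fun m => - (C^T *m C + (gain (U m))^T *m Rm *m gain (U m))).
  by apply/funext => m; exact: Uq.
apply: mxlimN; apply: mxlimD; first exact: mxlim_cst.
by apply: mxlim_mul => //; apply: mxlim_mul; [exact: mxlim_tr|exact: mxlim_cst].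
Qed.

End PolicyIteration.

(** * Brownian motion and Wiener integrals *)

Section GaussianMoments.
Context {R : realType}.
Notation mu := (@lebesgue_measure R).
Implicit Types s x : R.

(** Change of variables goes through the Radon-Nikodym derivative, which agrees almost everywhere
    with the Gaussian density because both have the same integral over every measurable set. *)
Lemma ge0_integral_normal_prob s (f : R -> \bar R) : (forall x, 0 <= f x)%E ->
  measurable_fun setT f ->
  (\int[normal_prob 0 s]_x f x = \int[mu]_x (f x * (normal_pdf 0 s x)%:E))%E.
Proof.
move=> f0 mf.
have dom := @normal_prob_dominates R 0 s.
rewrite -(Radon_Nikodym_SigmaFinite.change_of_variables dom) //.
apply: ae_eq_integral => //.
- apply: emeasurable_funM => //; apply: (measurable_int mu).
  exact: Radon_Nikodym_SigmaFinite.f_integrable.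
- apply: emeasurable_funM => //; apply/measurable_EFinP; exact: measurable_normal_pdf.
- apply: ae_eqe_mul2l => /=.
  apply: integral_ae_eq => //=.
  + exact: Radon_Nikodym_SigmaFinite.f_integrable.
  + by apply/measurable_EFinP; exact: measurable_normal_pdf.
  + move=> E _ mE; rewrite -(Radon_Nikodym_SigmaFinite.f_integral dom) //.
Qed.

Variable s : R.
Hypothesis s0 : 0 < s.
Let pd := normal_pdf 0 s.
Let sn0 : s != 0. Proof. by rewrite gt_eqF. Qed.

Lemma normal_pdf0E x : pd x = normal_peak s * expR (- (s ^+ 2 *+ 2)^-1 * x ^+ 2).
Proof.
rewrite /pd normal_pdfE // /normal_fun subr0; congr (_ * expR _).
by rewrite !mulNr mulrC.
Qed.

Lemma normal_pdf_even x : pd (- x) = pd x.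
Proof. by rewrite !normal_pdf0E sqrrN. Qed.

Lemma normal_pdf_derive x : is_derive x (1 : R) pd (- (x / s ^+ 2) * pd x).
Proof.
have -> : pd = (fun x => normal_peak s * expR (- (s ^+ 2 *+ 2)^-1 * x ^+ 2)).
  by apply/funext => y; rewrite normal_pdf0E.
have d2 : is_derive x (1 : R) (fun x : R => x ^+ 2) (2 * x).
  have D := @is_deriveX R R id 2 x (1 : R) 1 (is_derive_id x (1:R)).
  by apply: (is_derive_eq D); rewrite expr1 /GRing.scale /=; ring.
have d1 := is_deriveZ (- (s ^+ 2 *+ 2)^-1) d2.
have D := is_deriveZ (normal_peak s) (@is_derive1_comp R expR _ x _ _ (is_derive_expR _) d1).
apply: (is_derive_eq D); rewrite /GRing.scale /=; field.
exact: sn0.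
Qed.

Lemma normal_pdf_continuous : continuous pd.
Proof. exact: continuous_normal_pdf. Qed.

Let P := prim pd.

Let P_cvg : exists l : R, P x @[x --> +oo] --> l.
Proof.
exists (sup (range P)); apply: nondecreasing_cvgr.
  move=> a b ab; apply: prim_nondecreasing => //; first exact: normal_pdf_continuous.
  by move=> u _; exact: normal_pdf_ge0.
have [||K HK] := @ge0_integral_bounded R pd normal_pdf_continuous.
- by move=> u _; exact: normal_pdf_ge0.
- apply: (@le_lt_trans _ _ (\int[mu]_u (pd u)%:E)%E).
    apply: ge0_subset_integral => //.
      by apply/measurable_EFinP; exact: measurable_normal_pdf.
    by move=> u _; rewrite lee_fin normal_pdf_ge0.
  by rewrite integral_normal_pdf ltry.
exists (Num.max K 0) => _ [T _ <-]; rewrite le_max.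
have [T0|T0] := leP 0 T; first by rewrite HK.
by rewrite /P prim_le0 ?lexx ?orbT // ltW.
Qed.

(** Integration by parts: [P x - x * pd x] is a primitive of x^2 / s^2 times the density, and its
    boundary term vanishes at infinity. Both integrals are thus the same limit [l], whose value is
    not computed here. *)
Lemma normal_moment_halfline : (\int[mu]_(x in `[0%R, +oo[) (x ^+ 2 / s ^+ 2 * pd x)%:E
  = \int[mu]_(x in `[0%R, +oo[) (pd x)%:E)%E.
Proof.
have [l Pl] := P_cvg.
have xc : x * pd x @[x --> +oo] --> (0 : R).
  (* The majorant comes from exp(- y) <= 1 / y at y = x^2 / (2 s^2). *)
  have inv0 : 2 * s ^+ 2 * normal_peak s * x^-1 @[x --> +oo] --> (0 : R).
    rewrite -[X in _ --> X](mulr0 (2 * s ^+ 2 * normal_peak s)).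
    apply: cvgM; first exact: cvg_cst.
    apply/gtr0_cvgV0; last exact: cvg_id.
    by apply: nbhs_pinfty_gt.
  apply: (@squeeze_cvgr _ _ _ _ (fun=> 0) (fun x => 2 * s ^+ 2 * normal_peak s * x^-1)) => //; last exact: cvg_cst.
  near=> x.
  have x0 : 0 < x by near: x; exact: nbhs_pinfty_gt.
  rewrite mulr_ge0 ?normal_pdf_ge0 ?(ltW x0) //=.
  rewrite normal_pdf0E mulNr expRN.
  have e0 : 0 < (s ^+ 2 *+ 2)^-1 * x ^+ 2.
    by rewrite mulr_gt0 ?invr_gt0 ?exprn_gt0 // pmulrn_rgt0 // exprn_gt0.
  have L : (expR ((s ^+ 2 *+ 2)^-1 * x ^+ 2))^-1 <= 2 * s ^+ 2 / x ^+ 2.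
    rewrite -[leRHS]invrK lef_pV2 ?posrE ?expR_gt0 //; last first.
      by rewrite invr_gt0 divr_gt0 ?mulr_gt0 ?exprn_gt0.
    have -> : (2 * s ^+ 2 / x ^+ 2)^-1 = (s ^+ 2 *+ 2)^-1 * x ^+ 2.
      by field; rewrite sn0 (gt_eqF x0).
    by apply: le_trans (expR_ge1Dx _); rewrite lerDr.
  have -> : 2 * s ^+ 2 * normal_peak s * x^-1 = x * (normal_peak s * (2 * s ^+ 2 / x ^+ 2)).
    by field; rewrite (gt_eqF x0).
  by rewrite ler_wpM2l ?(ltW x0) // ler_wpM2l // normal_peak_ge0.
have pc := normal_pdf_continuous.
have P0 : P x @[x --> 0^'+] --> P 0.
  by apply: cvg_at_right_filter; exact: prim_continuous.
have I2 := @ge0_continuous_FTC2y R pd P 0 l.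
rewrite I2 //; first last.
- move=> x; rewrite in_itv /= andbT => x0.
  by rewrite derive1E; have [_ ->] := prim_derive pc x0.
- by move=> x x0; have [] := prim_derive pc x0.
- exact: continuous_subspaceT.
- by move=> x _; exact: normal_pdf_ge0.
pose F1 x := P x - x * pd x.
have F1d x : 0 < x -> is_derive x (1 : R) F1 (x ^+ 2 / s ^+ 2 * pd x).
  move=> x0; have D := is_deriveB (prim_derive pc x0) (is_deriveM (is_derive_id x (1:R)) (normal_pdf_derive x)).
  by apply: (is_derive_eq D); rewrite /GRing.scale /=; field.
have I1 := @ge0_continuous_FTC2y R (fun x => x ^+ 2 / s ^+ 2 * pd x) F1 0 l.
rewrite I1 //; first last.
- move=> x; rewrite in_itv /= andbT => x0.
  by rewrite derive1E; have [_ ->] := F1d _ x0.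
- apply: cvg_at_right_filter; apply: cvgB; first exact: prim_continuous.
  by apply: cvgM; [exact: cvg_id|exact: pc].
- by move=> x x0; have [] := F1d _ x0.
- by rewrite -[l]subr0; apply: cvgB.
- apply: continuous_subspaceT => x; apply: cvgM; last exact: pc.
  by apply: cvgM; [exact: exprn_continuous|exact: cvg_cst].
- by move=> x _; rewrite mulr_ge0 ?normal_pdf_ge0 // divr_ge0 ?sqr_ge0.
by rewrite /F1 /P prim0 mul0r subr0.
Unshelve. all: by end_near. Qed.

Lemma normal_second_moment : (\int[normal_prob 0 s]_x (x ^+ 2)%:E = (s ^+ 2)%:E)%E.
Proof.
rewrite ge0_integral_normal_prob; last 2 first.
- by move=> x; rewrite lee_fin sqr_ge0.
- by apply/measurable_EFinP; exact: exprn_measurable.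
have E : (\int[mu]_x (x ^+ 2 / s ^+ 2 * pd x)%:E = 1)%E.
  rewrite ge0_symfun_integralT; last 3 first.
  - by move=> x; rewrite mulr_ge0 ?normal_pdf_ge0 // divr_ge0 ?sqr_ge0.
  - move=> x; apply: cvgM; last exact: normal_pdf_continuous.
    by apply: cvgM; [exact: exprn_continuous|exact: cvg_cst].
  - by move=> x /=; rewrite sqrrN normal_pdf_even.
  rewrite -set_itvcy normal_moment_halfline.
  have := @integral_normal_pdf R 0 s.
  rewrite ge0_symfun_integralT ?set_itvcy //.
  - by move=> x; exact: normal_pdf_ge0.
  - exact: normal_pdf_continuous.
  - by move=> x /=; rewrite -/pd normal_pdf_even.
transitivity ((s ^+ 2)%:E * \int[mu]_x (x ^+ 2 / s ^+ 2 * pd x)%:E)%E; last by rewrite E mule1.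
rewrite -ge0_integralZl //; last 3 first.
- apply/measurable_EFinP; apply: measurable_funM; last exact: measurable_normal_pdf.
  by apply: measurable_funM => //; exact: exprn_measurable.
- by move=> x _; rewrite lee_fin mulr_ge0 ?normal_pdf_ge0 // divr_ge0 ?sqr_ge0.
- by rewrite lee_fin sqr_ge0.
apply: eq_integral => x _; rewrite -!EFinM; congr EFin.
by rewrite mulrA mulrCA divff ?mulr1 // expf_neq0.
Qed.

Lemma ge0_integral_lebesgue_opp (f : R -> \bar R) : (forall x, 0 <= f x)%E ->
  measurable_fun setT f -> (\int[mu]_x f x = \int[mu]_x f (- x)%R)%E.
Proof.
move=> f0 mf.
transitivity (\int[pushforward mu (-%R : _ -> measurableTypeR R)]_x f x)%E.
  by apply: eq_measure_integral => A mA _; exact/esym/lebesgue_measureN.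
by rewrite ge0_integral_pushforward.
Qed.

(** Reflection x -> - x. Comparing positive and negative parts keeps all integrands nonnegative;
    mean zero of the increments follows by subtraction. *)
Lemma normal_symmetric :
  (\int[normal_prob 0 s]_x (Num.max x 0)%:E = \int[normal_prob 0 s]_x (Num.max (- x) 0)%:E)%E.
Proof.
have m1 : measurable_fun setT (fun x : R => (Num.max x 0)%:E).
  by apply/measurable_EFinP; apply: measurable_maxr.
have m2 : measurable_fun setT (fun x : R => (Num.max (- x) 0)%:E).
  by apply/measurable_EFinP; apply: measurable_maxr.
rewrite !ge0_integral_normal_prob //; try by move=> x; rewrite lee_fin le_max lexx orbT.
rewrite ge0_integral_lebesgue_opp.
- by apply: eq_integral => x _; rewrite -/pd normal_pdf_even.
- by move=> x; rewrite mule_ge0 // lee_fin ?normal_pdf_ge0 // le_max lexx orbT.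
- by apply: emeasurable_funM => //; apply/measurable_EFinP; exact: measurable_normal_pdf.
Qed.

End GaussianMoments.

Section SquareIntegrable.
Context {R : realType} {d : measure_display} {Om : measurableType d}.
Variable Pr : probability Om R.
Implicit Types X Y Z : Om -> R.

Definition L2rv X :=
  measurable_fun setT X /\ (\int[Pr]_w (X w ^+ 2)%:E < +oo)%E.

Definition Ex X : R := \int[Pr]_w X w.

Lemma measurable_sqr X : measurable_fun setT X -> measurable_fun setT (fun w => X w ^+ 2).
Proof. by move=> mX; apply: measurable_funX. Qed.

Lemma L2rv_sqr_integrable X : L2rv X -> Pr.-integrable setT (EFin \o (fun w => X w ^+ 2)).
Proof.
move=> [mX X2]; apply/integrableP; split.
  by apply/measurable_EFinP; exact: measurable_sqr.
by under eq_integral do rewrite /= ger0_norm ?sqr_ge0 //.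
Qed.

Lemma L2rv_mul_integrable X Y : L2rv X -> L2rv Y ->
  Pr.-integrable setT (EFin \o (fun w => X w * Y w)).
Proof.
move=> LX LY.
have H := integrableD measurableT (L2rv_sqr_integrable LX) (L2rv_sqr_integrable LY).
apply: (le_integrable _ _ _ H) => //.
  by apply/measurable_EFinP; apply: measurable_funM; [exact: LX.1|exact: LY.1].
move=> w _ /=; rewrite lee_fin [leRHS]ger0_norm ?addr_ge0 ?sqr_ge0 // ler_norml.
by have := sqr_ge0 (X w - Y w); have := sqr_ge0 (X w + Y w); nra.
Qed.

Lemma L2rv_cst (a : R) : L2rv (cst a).
Proof.
split; first exact: measurable_cst.
by rewrite (integral_cst _ measurableT ((a ^+ 2)%:E)) [X in (_ * X)%E]probability_setT mule1 ltry.
Qed.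

Lemma L2rv_integrable X : L2rv X -> Pr.-integrable setT (EFin \o X).
Proof.
move=> LX; have := L2rv_mul_integrable LX (L2rv_cst 1).
by congr integrable; apply/funext => w /=; rewrite mulr1.
Qed.

Lemma L2rv_of_integrable X : measurable_fun setT X ->
  Pr.-integrable setT (EFin \o (fun w => X w ^+ 2)) -> L2rv X.
Proof.
move=> mX /integrableP[_ H]; split => //.
by move: H; under eq_integral do rewrite /= ger0_norm ?sqr_ge0 //.
Qed.

Lemma L2rvZ a X : L2rv X -> L2rv (fun w => a * X w).
Proof.
move=> LX; apply: L2rv_of_integrable.
  by apply: measurable_funM => //; exact: LX.1.
have := integrableZl measurableT (a ^+ 2) (L2rv_sqr_integrable LX).
by congr integrable; apply/funext => w /=; rewrite exprMn.
Qed.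

Lemma L2rvD X Y : L2rv X -> L2rv Y -> L2rv (fun w => X w + Y w).
Proof.
move=> LX LY; apply: L2rv_of_integrable.
  by apply: measurable_funD; [exact: LX.1|exact: LY.1].
have i1 := integrableZl measurableT 2 (L2rv_mul_integrable LX LY).
have H := integrableD measurableT i1
  (integrableD measurableT (L2rv_sqr_integrable LX) (L2rv_sqr_integrable LY)).
move: H; congr integrable; apply/funext => w /=.
by rewrite -EFinM -!EFinD; congr EFin; ring.
Qed.

Lemma L2rvB X Y : L2rv X -> L2rv Y -> L2rv (fun w => X w - Y w).
Proof.
move=> LX LY; have := L2rvD LX (L2rvZ (-1) LY).
by congr L2rv; apply/funext => w; rewrite mulN1r.
Qed.

Lemma L2rv_sum (I : Type) (s : seq I) (X : I -> Om -> R) :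
  (forall i, L2rv (X i)) -> L2rv (fun w => \sum_(i <- s) X i w).
Proof.
move=> LX; elim: s => [|i s IH].
  by under eq_fun do rewrite big_nil; exact: L2rv_cst.
by under eq_fun do rewrite big_cons; exact: L2rvD.
Qed.

Lemma eq_Ex X Y : X =1 Y -> Ex X = Ex Y.
Proof. by move=> XY; apply: eq_Rintegral => w _. Qed.

Lemma ExD X Y : Pr.-integrable setT (EFin \o X) -> Pr.-integrable setT (EFin \o Y) ->
  Ex (fun w => X w + Y w) = Ex X + Ex Y.
Proof. by move=> iX iY; exact: RintegralD. Qed.

Lemma ExZ a X : Pr.-integrable setT (EFin \o X) -> Ex (fun w => a * X w) = a * Ex X.
Proof. by move=> iX; exact: RintegralZl. Qed.

Lemma Ex_sqrE X : L2rv X -> (\int[Pr]_w (X w ^+ 2)%:E)%E = (Ex (fun w => X w ^+ 2))%:E.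
Proof.
move=> LX; rewrite /Ex /Rintegral fineK //; apply: integrable_fin_num => //.
exact: L2rv_sqr_integrable.
Qed.

Lemma Ex_suml (I : Type) (s : seq I) (X : I -> Om -> R) Y :
  (forall i, L2rv (X i)) -> L2rv Y ->
  Ex (fun w => (\sum_(i <- s) X i w) * Y w) = \sum_(i <- s) Ex (fun w => X i w * Y w).
Proof.
move=> LX LY; elim: s => [|i s IH].
  rewrite big_nil -[RHS](mul0r (Ex (fun w => Y w * Y w))) -ExZ; last exact: L2rv_mul_integrable.
  by apply: eq_Ex => w; rewrite big_nil !mul0r.
rewrite big_cons -IH -ExD; last 2 first.
- exact: L2rv_mul_integrable.
- by apply: L2rv_mul_integrable => //; exact: L2rv_sum.
by apply: eq_Ex => w; rewrite big_cons mulrDl.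
Qed.

Lemma Ex_sqr_sum (I : Type) (s : seq I) (X : I -> Om -> R) : (forall i, L2rv (X i)) ->
  Ex (fun w => (\sum_(i <- s) X i w) ^+ 2)
  = \sum_(i <- s) \sum_(j <- s) Ex (fun w => X i w * X j w).
Proof.
move=> LX; transitivity (Ex (fun w => (\sum_(i <- s) X i w) * (\sum_(i <- s) X i w))).
  by apply: eq_Ex => w; rewrite expr2.
rewrite Ex_suml //; last exact: L2rv_sum.
apply: eq_bigr => i _.
transitivity (Ex (fun w => (\sum_(i <- s) X i w) * X i w)).
  by apply: eq_Ex => w; rewrite mulrC.
by rewrite Ex_suml //; apply: eq_bigr => j _; apply: eq_Ex => w; rewrite mulrC.
Qed.

Lemma Ex_sqrD X Y : L2rv X -> L2rv Y -> Ex (fun w => X w * Y w) = 0 ->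
  Ex (fun w => (X w + Y w) ^+ 2) = Ex (fun w => X w ^+ 2) + Ex (fun w => Y w ^+ 2).
Proof.
move=> LX LY XY0.
have iXY := L2rv_mul_integrable LX LY.
have iX := L2rv_sqr_integrable LX; have iY := L2rv_sqr_integrable LY.
transitivity (Ex (fun w => (X w ^+ 2 + Y w ^+ 2) + 2 * (X w * Y w))).
  by apply: eq_Ex => w; ring.
rewrite ExD; first by rewrite ExZ // XY0 mulr0 addr0 ExD.
- by have := integrableD measurableT iX iY; congr integrable; apply/funext.
- by have := integrableZl measurableT 2 iXY; congr integrable; apply/funext.
Qed.

Definition indep_rv X Y := forall B B' : set R, measurable B -> measurable B' ->
  Pr ((X @^-1` B) `&` (Y @^-1` B')) = (Pr (X @^-1` B) * Pr (Y @^-1` B'))%E.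

(* The joint law of independent variables is the product of their laws, so
   Fubini's theorem factors the expectation. *)
Lemma indep_Ex_mul0 X Y : L2rv X -> L2rv Y -> indep_rv Y X -> Ex X = 0 ->
  Ex (fun w => Y w * X w) = 0.
Proof.
move=> LX LY ind X0.
have [mX _] := LX; have [mY _] := LY.
have mYX : measurable_fun setT (fun w => (Y w, X w)) by exact: measurable_fun_pair.
pose X' : {mfun Om >-> R} := HB.pack X (isMeasurableFun.Build _ _ _ _ X mX).
pose Y' : {mfun Om >-> R} := HB.pack Y (isMeasurableFun.Build _ _ _ _ Y mY).
pose YX' : {mfun Om >-> (R * R)%type} :=
  HB.pack (fun w => (Y w, X w)) (isMeasurableFun.Build _ _ _ _ _ mYX).
pose muX := distribution Pr X'; pose muY := distribution Pr Y'.
pose g (z : R * R) : \bar R := (z.1 * z.2)%:E.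
have mg : measurable_fun setT g by apply/measurable_EFinP; exact: measurable_funM.
have gYX : Pr.-integrable setT (g \o YX') by exact: L2rv_mul_integrable.
have E1 : (\int[distribution Pr YX']_z g z = \int[Pr]_w (Y w * X w)%:E)%E.
  by rewrite integral_distribution.
have E2 : (\int[distribution Pr YX']_z g z = \int[muY \x muX]_z g z)%E.
  apply: eq_measure_integral => A mA _; apply/esym.
  by apply: product_measure_unique.
suff H : (\int[muY \x muX]_z g z = 0)%E.
  by rewrite /Ex /Rintegral -E1 E2 H.
have gi : (muY \x muX)%E.-integrable setT g.
  apply/integrableP; split => //.
  have -> : (\int[muY \x muX]_z `|g z| = \int[distribution Pr YX']_z `|g z|)%E.
    apply: eq_measure_integral => A mA _.
    by apply: product_measure_unique.
  rewrite ge0_integral_distribution //; last exact: measurableT_comp.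
  by case/integrableP : gYX.
rewrite -integral12_prod_meas1 //.
apply: integral0_eq => y _; rewrite /fubini_F /g /=.
under eq_integral do rewrite EFinM.
have iX : Pr.-integrable setT (EFin \o X') by exact: L2rv_integrable.
rewrite integralZl //; last first.
  exact: (integrable_pushforward mX).
have -> : (\int[muX]_x x%:E = 0)%E; last by rewrite mule0.
rewrite integral_distribution //.
have := X0; rewrite /Ex /Rintegral => H.
have fi := integrable_fin_num measurableT iX.
by rewrite -[LHS](fineK fi) [fine _]H.
Qed.

End SquareIntegrable.

Section BrownianIncrements.
Context {R : realType} {d : measure_display} {Om : measurableType d}.
Variable Pr : probability Om R.
Variable w : R -> Om -> R.
Hypothesis bm : brownian_motion Pr w.
Implicit Types (s t u T : R) (Y : Om -> R).

Let mw t : 0 <= t -> measurable_fun setT (w t).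
Proof. by case: bm => H _ _ _ _; exact: H. Qed.

Definition past_gen s : set (set Om) :=
  [set E | exists2 j, [set u | 0 <= u <= s] j & exists2 B, measurable B & E = w j @^-1` B].

(** Measurability with respect to the history of [w] on [0, s]. Putting the generated sigma-algebra
    on the domain makes the usual closure rules of measurable functions available. *)
Definition past s Y :=
  @measurable_fun _ _ (g_sigma_algebraType (past_gen s)) R setT Y.

Lemma past_preimage s Y B : past s Y -> measurable B ->
  sigma_of [set u | 0 <= u <= s] w (Y @^-1` B).
Proof. by move=> pY mB; have := pY measurableT B mB; rewrite setTI. Qed.

Lemma past_process s u : 0 <= u -> u <= s -> past s (w u).
Proof.
move=> u0 us _ B mB; rewrite setTI; apply: sub_sigma_algebra.
by exists u => /=; [rewrite u0 us|exists B].
Qed.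

Lemma past_measurable s Y : past s Y -> measurable_fun setT Y.
Proof.
move=> pY _ B mB; rewrite setTI.
have := past_preimage pY mB; apply: smallest_sub; first exact: sigma_algebra_measurable.
move=> E [u /= /andP[u0 _] [B' mB' ->]].
by rewrite -[X in measurable X]setTI; exact: mw.
Qed.

Lemma past_le s t Y : s <= t -> past s Y -> past t Y.
Proof.
move=> st pY _ B mB; rewrite setTI.
have := past_preimage pY mB; apply: smallest_sub; first exact: smallest_sigma_algebra.
move=> E [u /= /andP[u0 us] H]; apply: sub_sigma_algebra; exists u => //=.
by rewrite u0 (le_trans us).
Qed.

Let inc s t om := w t om - w s om.

Let minc s t : 0 <= s -> 0 <= t -> measurable_fun setT (inc s t).
Proof. by move=> s0 t0; apply: measurable_funB; exact: mw. Qed.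

Lemma ge0_integral_increment s t (f : R -> \bar R) : 0 <= s -> s < t ->
  (forall x, 0 <= f x)%E -> measurable_fun setT f ->
  (\int[Pr]_om f (inc s t om) = \int[normal_prob 0 (Num.sqrt (t - s))]_x f x)%E.
Proof.
move=> s0 st f0 mf.
have mi : measurable_fun setT (inc s t : Om -> measurableTypeR R).
  exact: (minc s0 (ltW (le_lt_trans s0 st))).
pose I : {mfun Om >-> measurableTypeR R} := HB.pack (inc s t) (isMeasurableFun.Build _ _ _ _ _ mi).
transitivity (\int[distribution Pr I]_x f x)%E.
  by rewrite ge0_integral_distribution.
apply: eq_measure_integral => A mA _.
by case: bm => _ _ H _ _; exact: (H s t s0 st A mA).
Qed.

Lemma increment_L2rv s t : 0 <= s -> s <= t -> L2rv Pr (inc s t).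
Proof.
move=> s0; rewrite le_eqVlt => /orP[/eqP <-|st].
  have -> : inc s s = cst 0 by apply/funext => om; rewrite /inc subrr.
  exact: L2rv_cst.
split; first by apply: minc => //; exact: ltW (le_lt_trans s0 st).
rewrite (@ge0_integral_increment s t (fun x => (x ^+ 2)%:E)) //.
- by rewrite normal_second_moment ?ltry // sqrtr_gt0 subr_gt0.
- by move=> x; rewrite lee_fin sqr_ge0.
- by apply/measurable_EFinP; exact: exprn_measurable.
Qed.

Lemma increment_var s t : 0 <= s -> s <= t -> Ex Pr (fun om => inc s t om ^+ 2) = t - s.
Proof.
move=> s0; rewrite le_eqVlt => /orP[/eqP <-|st].
  rewrite subrr -[RHS](mul0r (Ex Pr (fun=> 0))) -ExZ; last exact: (L2rv_integrable (L2rv_cst Pr 0)).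
  by apply: eq_Ex => om; rewrite /inc subrr expr0n /= mulr0.
rewrite /Ex /Rintegral (@ge0_integral_increment s t (fun x => (x ^+ 2)%:E)) //.
- by rewrite normal_second_moment ?sqrtr_gt0 ?subr_gt0 //= sqr_sqrtr // subr_ge0 ltW.
- by move=> x; rewrite lee_fin sqr_ge0.
- by apply/measurable_EFinP; exact: exprn_measurable.
Qed.

Lemma increment_mean s t : 0 <= s -> s <= t -> Ex Pr (inc s t) = 0.
Proof.
move=> s0; rewrite le_eqVlt => /orP[/eqP <-|st].
  rewrite -[RHS](mul0r (Ex Pr (fun=> 0))) -ExZ; last exact: (L2rv_integrable (L2rv_cst Pr 0)).
  by apply: eq_Ex => om; rewrite /inc subrr mulr0.
have iI := L2rv_integrable (increment_L2rv s0 (ltW st)).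
rewrite /Ex /Rintegral integralE.
have m1 : measurable_fun setT (fun x : R => (Num.max x 0)%:E).
  by apply/measurable_EFinP; apply: measurable_maxr.
have m2 : measurable_fun setT (fun x : R => (Num.max (- x) 0)%:E).
  by apply/measurable_EFinP; apply: measurable_maxr.
have E : (\int[Pr]_x ((fun x => (inc s t x)%:E)^\+ x) = \int[Pr]_x ((fun x => (inc s t x)%:E)^\- x))%E.
  transitivity (\int[Pr]_x (Num.max (inc s t x) 0)%:E)%E.
    by apply: eq_integral => x _; rewrite funeposE EFin_max.
  transitivity (\int[Pr]_x (Num.max (- inc s t x) 0)%:E)%E; last first.
    by apply: eq_integral => x _; rewrite funenegE EFin_max.
  rewrite (@ge0_integral_increment s t (fun x => (Num.max x 0)%:E)) //; last first.
    by move=> x; rewrite lee_fin le_max lexx orbT.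
  rewrite (@ge0_integral_increment s t (fun x => (Num.max (- x) 0)%:E)) //; last first.
    by move=> x; rewrite lee_fin le_max lexx orbT.
  by apply: normal_symmetric; rewrite sqrtr_gt0 subr_gt0.
rewrite E subee //.
have := integrable_neg_fin_num measurableT iI.
by [].
Qed.

(** The martingale property in weak form: what happens after s is orthogonal to every square
    integrable variable known at s. *)
Lemma past_increment s t Y : 0 <= s -> s <= t -> past s Y -> L2rv Pr Y ->
  Ex Pr (fun om => Y om * (w t om - w s om)) = 0.
Proof.
move=> s0 st pY LY; apply: (indep_Ex_mul0 (X := inc s t)) => //.
- exact: increment_L2rv.
- move=> B B' mB mB'; case: bm => _ _ _ H _.
  apply: (H s t s0 st); first exact: past_preimage.
  by apply: sub_sigma_algebra; exists tt => //; exists B'.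
- exact: increment_mean.
Qed.

(** A Brownian motion vanishes at 0 only almost surely; this version does so at every outcome. *)
Definition centered t om := w t om - w 0 om.

Lemma centered_L2rv t : 0 <= t -> L2rv Pr (centered t).
Proof. exact: increment_L2rv. Qed.

Lemma past_centered s t : 0 <= t -> t <= s -> past s (centered t).
Proof.
by move=> t0 ts; apply: measurable_funB; apply: past_process => //; exact: le_trans ts.
Qed.

Lemma past_centered_increment s t Y : 0 <= s -> s <= t -> past s Y -> L2rv Pr Y ->
  Ex Pr (fun om => Y om * (centered t om - centered s om)) = 0.
Proof.
move=> s0 st pY LY; rewrite -[RHS](past_increment s0 st pY LY).
by apply: eq_Ex => om; rewrite /centered; congr (_ * _); ring.
Qed.

Lemma centered_cov s t : 0 <= s -> 0 <= t ->
  Ex Pr (fun om => centered s om * centered t om) = Num.min s t.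
Proof.
wlog st : s t / s <= t.
  move=> H s0 t0; have [st|/ltW ts] := leP s t.
    by rewrite H // min_l.
  rewrite -[RHS](min_l ts) -H //.
  by apply: eq_Ex => om; rewrite mulrC.
move=> s0 t0; rewrite min_l //.
have Ls := centered_L2rv s0; have Lt := centered_L2rv t0.
transitivity (Ex Pr (fun om => centered s om ^+ 2 + centered s om * (centered t om - centered s om))).
  by apply: eq_Ex => om; ring.
rewrite ExD.
- rewrite past_centered_increment //; last exact: past_centered.
  by rewrite addr0 increment_var // subr0.
- exact: L2rv_sqr_integrable.
- by apply: L2rv_mul_integrable => //; exact: L2rvB.
Qed.

End BrownianIncrements.

(** * Integrals of step functions: isometry, martingale property and Kolmogorov's inequality *)

Section StepIntegrals.
Context {R : realType} {d : measure_display} {Om : measurableType d}.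
Variable Pr : probability Om R.
Variable w : R -> Om -> R.
Hypothesis bm : brownian_motion Pr w.
Implicit Types (s t u T : R) (l : seq (R * R)).
Notation mu := (@lebesgue_measure R).

(* [l] encodes the step function sum_(c, a) in l of c * 1_[0, a[ . *)
Definition step_fun l u : R := \sum_(p <- l) p.1 * (\1_(`[0, p.2[%classic : set R) u).

(** The integral up to t of 1_[0, a[ is the centered motion at min(t, a); [clamp] sends negative end
    points to 0, where it vanishes. *)
Definition step_int l t om : R := \sum_(p <- l) p.1 * centered w (clamp (Num.min t p.2)) om.

Lemma clamp_min (a b : R) : clamp (Num.min a b) = Num.min (clamp a) (clamp b).
Proof. by rewrite /clamp max_minr. Qed.

(** Time integrals over [0, T] are written as T times an expectation under the uniform law, so that
    the expansion of the square of a sum serves both sides of the isometry. *)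
Lemma uniform_initial_interval T (T0 : 0 < T) a :
  T * Ex (uniform_prob T0) (fun u : measurableTypeR R => \1_(`[0, a[%classic : set R) u) = clamp (Num.min T a).
Proof.
rewrite /Ex /Rintegral integral_uniform; last 2 first.
- by apply/measurable_EFinP; exact: measurable_indic.
- by move=> x; rewrite lee_fin indicE.
rewrite integral_indic // subr0.
have cap (i : interval R) : (forall x, (0 <= x < a) && (0 <= x <= T) = (x \in i)) ->
    `[0, a[%classic `&` `[0, T]%classic = [set` i].
  move=> H; apply/seteqP; split => x /=; rewrite -H !in_itv /=; first by case=> -> ->.
  by case/andP.
have [a0|a0] := leP a 0.
  rewrite (cap `]0, 0[); last first.
    by move=> x; rewrite in_itv /=; apply/idP/idP; lra.
  by rewrite [X in (_ * X)%E](lebesgue_measure_itv _) /= ltxx mule0 /= mulr0 clamp_le0 // ge_min a0 orbT.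
have [aT|Ta] := leP a T.
  rewrite (cap `[0, a[); last first.
    by move=> x; rewrite in_itv /=; apply/idP/idP; lra.
  rewrite [X in (_ * X)%E](lebesgue_measure_itv _) /= lte_fin a0 oppr0 adde0 -EFinM /= mulrA divff ?gt_eqF // mul1r.
  by rewrite clamp_id // ltW.
rewrite (cap `[0, T]); last first.
  by move=> x; rewrite in_itv /=; apply/idP/idP; lra.
rewrite [X in (_ * X)%E](lebesgue_measure_itv _) /= lte_fin T0 oppr0 adde0 -EFinM /= mulrA divff ?gt_eqF // mul1r.
by rewrite clamp_id // ltW.
Qed.

Lemma step_L2rv_uniform T (T0 : 0 < T) a :
  L2rv (uniform_prob T0) (\1_(`[0, a[%classic : set R) : measurableTypeR R -> R).
Proof.
split; first exact: measurable_indic.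
apply: (@le_lt_trans _ _ (\int[uniform_prob T0]_u (cst 1%:E u))%E); last first.
  by rewrite (integral_cst _ measurableT (1%:E)) mul1e [X in (X < _)%E]probability_setT ltry.
apply: ge0_le_integral => //.
- by apply/measurable_EFinP; apply: measurable_funX; exact: measurable_indic.
- by move=> u _; rewrite lee_fin indicE; case: (_ \in _); rewrite ?expr1n // expr0n.
Qed.

Lemma centered_clamp_L2rv a : L2rv Pr (centered w (clamp a)).
Proof. by apply: centered_L2rv => //; exact: clamp_ge0. Qed.

Lemma step_int_L2rv l t : L2rv Pr (step_int l t).
Proof. by apply: L2rv_sum => p; apply: L2rvZ; exact: centered_clamp_L2rv. Qed.

(* The covariance min(a, b) of Brownian motion is the scalar product of 1_[0, a[ and 1_[0, b[ . *)
Lemma step_int_isometry l T : 0 < T ->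
  (\int[Pr]_om (step_int l T om ^+ 2)%:E = \int[mu]_(u in `[0%R, T]) (step_fun l u ^+ 2)%:E)%E.
Proof.
move=> T0; pose U := uniform_prob T0.
pose I (p : R * R) (u : measurableTypeR R) : R := p.1 * (\1_(`[0, p.2[%classic : set R) u).
have LI p : L2rv U (I p) by apply: L2rvZ; exact: step_L2rv_uniform.
have LS : L2rv U (step_fun l) by apply: L2rv_sum => p; exact: LI.
rewrite (Ex_sqrE (step_int_L2rv l T)).
rewrite /step_int Ex_sqr_sum; last by move=> p; apply: L2rvZ; exact: centered_clamp_L2rv.
have E (p q : R * R) : Ex Pr (fun om => p.1 * centered w (clamp (Num.min T p.2)) om *
    (q.1 * centered w (clamp (Num.min T q.2)) om)) = T * Ex U (fun u => I p u * I q u).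
  transitivity (p.1 * q.1 * Num.min (clamp (Num.min T p.2)) (clamp (Num.min T q.2))).
    rewrite -(centered_cov bm (clamp_ge0 _) (clamp_ge0 _)).
    rewrite -(@ExZ _ _ _ _ (p.1 * q.1)); last by apply: L2rv_mul_integrable; exact: centered_clamp_L2rv.
    by apply: eq_Ex => om; ring.
  rewrite -clamp_min minACA minxx -(uniform_initial_interval T0).
  rewrite mulrCA; congr (T * _).
  rewrite -ExZ; last by apply: L2rv_integrable; exact: step_L2rv_uniform.
  apply: eq_Ex => u; rewrite /I !indicE.
  have -> : (u \in (`[0, Num.min p.2 q.2[%classic : set R)) = (u \in (`[0, p.2[%classic : set R)) && (u \in (`[0, q.2[%classic : set R)).
    apply/idP/andP; rewrite !inE /= !in_itv /= lt_min; first by case/andP=> -> /andP[-> ->].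
    by case=> /andP[-> ->] /andP[_ ->].
  by case: (_ \in _); case: (_ \in _) => /=; ring.
under eq_bigr do under eq_bigr do rewrite E.
under eq_bigr do rewrite -mulr_sumr.
rewrite -mulr_sumr -Ex_sqr_sum // EFinM.
rewrite -(Ex_sqrE LS) integral_uniform; last 2 first.
- by apply/measurable_EFinP; apply: measurable_funX; exact: LS.1.
- by move=> u; rewrite lee_fin sqr_ge0.
by rewrite subr0 muleA -EFinM divff ?gt_eqF // mul1e.
Qed.

Lemma past_step_int l s : 0 <= s -> past w s (step_int l s).
Proof.
move=> s0; apply: measurable_sum => p; apply: measurable_funM => //.
apply: past_centered; first exact: clamp_ge0.
by rewrite /clamp ge_max s0 ge_min lexx.
Qed.

Lemma step_int0 l om : step_int l 0 om = 0.
Proof.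
rewrite /step_int big1_seq // => p _.
have -> : clamp (Num.min 0 p.2) = 0 by rewrite clamp_le0 // ge_min lexx.
by rewrite /centered subrr mulr0.
Qed.

Lemma step_int_martingale l s t Y : 0 <= s -> s <= t -> past w s Y -> L2rv Pr Y ->
  Ex Pr (fun om => Y om * (step_int l t om - step_int l s om)) = 0.
Proof.
move=> s0 st pY LY.
transitivity (Ex Pr (fun om => (\sum_(p <- l) p.1 * (centered w (clamp (Num.min t p.2)) om
    - centered w (clamp (Num.min s p.2)) om)) * Y om)).
  apply: eq_Ex => om; rewrite mulrC; congr (_ * _).
  by under [RHS]eq_bigr do rewrite mulrBr; rewrite sumrB.
have LD (p : R * R) : L2rv Pr (fun om => centered w (clamp (Num.min t p.2)) om
    - centered w (clamp (Num.min s p.2)) om) by apply: L2rvB; exact: centered_clamp_L2rv.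
rewrite Ex_suml //; last by move=> p; exact: L2rvZ.
apply: big1_seq => p _.
transitivity (p.1 * Ex Pr (fun om => Y om * (centered w (clamp (Num.min t p.2)) om
    - centered w (clamp (Num.min s p.2)) om))).
  rewrite -ExZ; last exact: L2rv_mul_integrable.
  by apply: eq_Ex => om; ring.
(* A piece ending before s has no increment after s; for the others the increment runs from s to
   min(t, p.2). *)
have [ps|sp] := leP p.2 s.
  rewrite min_r ?(le_trans ps) //.
  rewrite (_ : Ex _ _ = 0) ?mulr0 // -(mul0r (Ex Pr (fun om => Y om * Y om))) -ExZ.
    by apply: eq_Ex => om; rewrite subrr mulr0 mul0r.
  exact: L2rv_mul_integrable.
have sm : s <= Num.min t p.2 by rewrite le_min st ltW.
rewrite (clamp_id s0) clamp_id ?(le_trans s0) //.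
by rewrite (past_centered_increment bm) ?mulr0.
Qed.

(* The sum of the increments of x stopped when it leaves ]- eps, eps[ . *)
Fixpoint stopped (eps : R) (x : nat -> Om -> R) n om : R :=
  if n is m.+1 then
    stopped eps x m om + (`|stopped eps x m om| < eps)%R%:R * (x m.+1 om - x m om)
  else x 0%N om.

(** A value outside the open interval is frozen for ever, so being inside at step n means never
    having stopped. *)
Lemma stopped_eq eps (x : nat -> Om -> R) n om : `|stopped eps x n om| < eps ->
  forall i, (i <= n)%N -> stopped eps x i om = x i om /\ `|x i om| < eps.
Proof.
elim: n => [|n IH] /= H i.
  by rewrite leqn0 => /eqP ->.
have Hn : `|stopped eps x n om| < eps.
  by apply: contraT => /negbTE nH; move: H; rewrite nH mul0r addr0 nH.
have [E _] := IH Hn n (leqnn n).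
rewrite leq_eqVlt => /orP[/eqP ->|]; last by rewrite ltnS; exact: IH.
by move: H; rewrite /= Hn E mul1r addrC subrK.
Qed.

Lemma past_ltr_norm s (eps : R) Y : past w s Y -> past w s (fun om => (`|Y om| < eps)%R%:R).
Proof.
move=> pY; have m : measurable_fun setT (fun x : R => (`|x| < eps)%R%:R : R).
  have -> : (fun x : R => (`|x| < eps)%R%:R : R) = \1_([set x | `|x| < eps]).
    apply/funext => x; rewrite indicE; congr (nat_of_bool _)%:R.
    by apply/idP/idP; rewrite ?inE //= => H; rewrite ?inE.
  apply: measurable_indic.
  have -> : [set x : R | `|x| < eps] = (Num.norm : R -> R) @^-1` `]-oo, eps[%classic.
    by apply/seteqP; split => x /=; rewrite in_itv.
  by rewrite -[X in measurable X]setTI; exact: (measurable_realfun.normr_measurable).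
exact: measurableT_comp m pY.
Qed.

Section Maximal.
Variables (l : seq (R * R)) (eps : R) (tau : nat -> R).
Hypotheses (eps0 : 0 < eps) (tau0 : tau 0%N = 0) (tauS : forall i, tau i <= tau i.+1).

Let tau_ge0 i : 0 <= tau i.
Proof. by elim: i => [|i IH]; [rewrite tau0|exact: le_trans (tauS i)]. Qed.

Let x i om := step_int l (tau i) om.

Let S := stopped eps x.

Let Lx i : L2rv Pr (x i).
Proof. exact: step_int_L2rv. Qed.

Lemma past_stopped i : past w (tau i) (S i).
Proof.
elim: i => [|i IH]; first by apply: past_step_int; rewrite tau0.
have pX j : past w (tau j) (x j) by exact: past_step_int.
apply: measurable_funD; first exact: past_le (tauS i) IH.
apply: measurable_funM; first by apply: past_ltr_norm; exact: past_le (tauS i) IH.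
by apply: measurable_funB; [exact: (pX i.+1)|exact: past_le (tauS i) (pX i)].
Qed.

Lemma L2rv_bool_mul (b : Om -> bool) Y : measurable_fun setT (fun om => (b om)%:R : R) ->
  L2rv Pr Y -> L2rv Pr (fun om => (b om)%:R * Y om).
Proof.
move=> mb LY; split; first by apply: measurable_funM => //; exact: LY.1.
apply: le_lt_trans LY.2; apply: ge0_le_integral => //.
- by move=> om _; rewrite lee_fin sqr_ge0.
- by apply/measurable_EFinP; apply: measurable_sqr; apply: measurable_funM => //; exact: LY.1.
- by apply/measurable_EFinP; apply: measurable_sqr; exact: LY.1.
- by move=> om _; rewrite lee_fin; case: (b om); rewrite ?mul1r // mul0r expr0n /= sqr_ge0.
Qed.

Lemma stopped_L2rv i : L2rv Pr (S i).
Proof.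
elim: i => [|i IH]; first exact: Lx.
apply: L2rvD => //; apply: L2rv_bool_mul; last exact: L2rvB.
apply: (past_measurable bm (s := tau i)); apply: past_ltr_norm; exact: past_stopped.
Qed.

(** Increments are orthogonal to the past, so energies add up; stopping multiplies each increment by
    an indicator known beforehand and keeps orthogonality. *)
Lemma stopped_energy i : Ex Pr (fun om => S i om ^+ 2) <= Ex Pr (fun om => x i om ^+ 2).
Proof.
elim: i => [|i IH]; first by [].
pose b om := `|S i om| < eps.
have pb : past w (tau i) (fun om => (b om)%:R : R) by apply: past_ltr_norm; exact: past_stopped.
have mb := past_measurable bm pb.
have LD : L2rv Pr (fun om => x i.+1 om - x i om) by exact: L2rvB.
have LbD := L2rv_bool_mul mb LD.
have LbS := L2rv_bool_mul mb (stopped_L2rv i).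
have -> : Ex Pr (fun om => S i.+1 om ^+ 2)
    = Ex Pr (fun om => S i om ^+ 2) + Ex Pr (fun om => ((b om)%:R * (x i.+1 om - x i om)) ^+ 2).
  rewrite -Ex_sqrD //; last first.
    transitivity (Ex Pr (fun om => ((b om)%:R * S i om) * (x i.+1 om - x i om))).
      by apply: eq_Ex => om; ring.
    apply: step_int_martingale => //.
    by apply: measurable_funM => //; exact: past_stopped.
  exact: stopped_L2rv.
have -> : Ex Pr (fun om => x i.+1 om ^+ 2)
    = Ex Pr (fun om => x i om ^+ 2) + Ex Pr (fun om => (x i.+1 om - x i om) ^+ 2).
  rewrite -Ex_sqrD //; first by apply: eq_Ex => om; rewrite addrC subrK.
  by apply: step_int_martingale => //; exact: past_step_int.
apply: lerD => //; apply: le_Rintegral => //.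
- exact: L2rv_sqr_integrable.
- exact: L2rv_sqr_integrable.
- by move=> om _; case: (b om); rewrite ?mul1r // mul0r expr0n /= sqr_ge0.
Qed.

Definition exceeds n : set Om := \bigcup_(i < n.+1) [set om | eps <= `|x i om|].

Lemma measurable_exceeds n : measurable (exceeds n).
Proof.
apply: bigcup_measurable => i _.
rewrite (_ : [set om | _] = (fun om => `|x i om|) @^-1` `[eps, +oo[%classic); last first.
  by apply/seteqP; split => om /=; rewrite in_itv /= andbT.
by rewrite -[X in measurable X]setTI; apply: measurableT_comp => //; exact: (Lx i).1.
Qed.

(** Chebyshev's inequality for the stopped sum: if some |x_i| reaches eps, the stopped value ends
    outside ]- eps, eps[ . *)
Lemma kolmogorov_maximal n :
  ((eps ^+ 2)%:E * Pr (exceeds n) <= \int[Pr]_om (x n om ^+ 2)%:E)%E.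
Proof.
apply: (@le_trans _ _ (\int[Pr]_om (S n om ^+ 2)%:E)%E); last first.
  by rewrite (Ex_sqrE (Lx n)) (Ex_sqrE (stopped_L2rv n)) lee_fin; exact: stopped_energy.
rewrite -[exceeds n]setIT -(integral_indic Pr measurableT (measurable_exceeds n)).
have me : measurable_fun setT (fun om : Om => (\1_(exceeds n) om)%:E : \bar R).
  by apply/measurable_EFinP; apply: measurable_indic; exact: measurable_exceeds.
rewrite -ge0_integralZl //; last by rewrite lee_fin sqr_ge0.
apply: ge0_le_integral => //.
- by move=> om _; rewrite -EFinM lee_fin mulr_ge0 ?sqr_ge0.
- exact: measurable_funeM.
- by apply/measurable_EFinP; apply: measurable_sqr; exact: (stopped_L2rv n).1.
move=> om _; rewrite -EFinM lee_fin indicE; have [|_] := boolP (om \in exceeds n); last by rewrite mulr0 sqr_ge0.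
rewrite inE => -[i iN Hi]; rewrite mulr1 -[leRHS]real_normK ?num_real // lerXn2r ?nnegrE ?(ltW eps0) //.
rewrite leNgt; apply/negP => /stopped_eq /(_ i); rewrite -ltnS => /(_ iN)[_].
by rewrite ltNge Hi.
Qed.

End Maximal.

End StepIntegrals.

Section StepApproximation.
Context {R : realType}.
Implicit Types (g : R -> R) (t u T : R) (l : seq (R * R)).

(** Only s is confined to the compact interval; u may leave it, since g is continuous on the
    line. *)
Lemma heine_cantor g T (eps : R) : continuous g -> 0 < eps ->
  \forall e \near 0^'+, forall s u : R, 0 <= s <= T -> `|s - u| <= e -> `|g s - g u| <= eps.
Proof.
move=> gc eps0.
have := @segment_compact R 0 T.
move=> /compact_near_coveringP /(_ _ (0^'+) (fun e s => forall u, `|s - u| <= e -> `|g s - g u| <= eps)) H.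
have {}H : \forall e \near 0^'+, `[0, T]%classic `<=` (fun s => forall u, `|s - u| <= e -> `|g s - g u| <= eps).
  apply: H => x _.
  have /cvgrPdist_lt /(_ (eps / 2)) H : g y @[y --> x] --> g x by exact: gc.
  have {}H := H (divr_gt0 eps0 (ltr0n _ 2)).
  have [e /= e0 He] := H.
  have e20 : 0 < e / 2 by rewrite divr_gt0.
  exists (ball x (e / 2), [set e' | e' < e / 2]) => /=.
    split; first by exact: nbhsx_ballx.
    by apply: nbhs_right_lt.
  move=> [s e'] /= [sx e'e] u su.
  have h1 : `|g x - g s| < eps / 2 by apply: He; apply: lt_trans sx _; rewrite ltr_pdivrMr // ltr_pMr // ltr1n.
  have h2 : `|g x - g u| < eps / 2.
    apply: He => /=; rewrite (_ : x - u = (x - s) + (s - u)); last by ring.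
    rewrite [e]splitr; apply: le_lt_trans (ler_normD _ _) _; apply: ltrD => //.
    exact: le_lt_trans su _.
  rewrite (_ : g s - g u = (g x - g u) - (g x - g s)); last by ring.
  by rewrite [eps]splitr; apply: le_trans (ler_normB _ _) _; apply: lerD; exact: ltW.
apply: filterS H => e He s u sT su; by apply: He.
Qed.

(** The step c_j on [tau_j, tau_(j+1)[ is the difference of two initial intervals, the only ones
    [step_fun] knows. *)
Fixpoint partition_steps (c tau : nat -> R) J : seq (R * R) :=
  if J is j.+1 then (c j, tau j.+1) :: (- c j, tau j) :: partition_steps c tau j else [::].

Lemma step_fun_nil u : step_fun [::] u = 0 :> R.
Proof. by rewrite /step_fun big_nil. Qed.

Lemma step_fun_cons (p : R * R) l u :
  step_fun (p :: l) u = p.1 * (\1_(`[0, p.2[%classic : set R) u) + step_fun l u.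
Proof. by rewrite /step_fun big_cons. Qed.

Lemma step_fun_partition (c tau : nat -> R) J u :
  tau 0%N = 0 -> (forall i, tau i <= tau i.+1) -> 0 <= u ->
  (tau J <= u -> step_fun (partition_steps c tau J) u = 0) /\
  (u < tau J -> exists j, [/\ (j < J)%N, tau j <= u, u < tau j.+1 &
     step_fun (partition_steps c tau J) u = c j]).
Proof.
move=> tau0 tauS u0; elim: J => [|J [IH1 IH2]] /=.
  split=> [_|]; first by rewrite step_fun_nil.
  by rewrite tau0 ltNge u0.
have I (a : R) : (\1_(`[0, a[%classic : set R) u : R) = (u < a)%R%:R.
  rewrite indicE; congr (nat_of_bool _)%:R.
  by apply/idP/idP; rewrite ?inE /= in_itv /= u0.
rewrite !step_fun_cons /= !I; split=> [H|H].
  by rewrite IH1 ?(le_trans (tauS J)) // !ltNge H (le_trans (tauS J) H) /=; ring.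
rewrite H; have [h|h] := leP (tau J) u.
  exists J; split => //; rewrite IH1 //=; ring.
have [j [jJ h1 h2 ->]] := IH2 h; exists j; split => //; first exact: ltnW.
by rewrite /=; ring.
Qed.

Lemma step_fun_partition_close g (c tau : nat -> R) J (e : R) u :
  tau 0%N = 0 -> (forall i, tau i <= tau i.+1) -> 0 <= u -> u < tau J ->
  (forall j, (j < J)%N -> tau j <= u -> u < tau j.+1 -> `|c j - g u| <= e) ->
  `|step_fun (partition_steps c tau J) u - g u| <= e.
Proof.
move=> tau0 tauS u0 uJ H.
have [_ /(_ uJ)[j [jJ h1 h2 ->]]] := step_fun_partition c J tau0 tauS u0.
exact: H.
Qed.

Definition opp_steps l : seq (R * R) := [seq (- p.1, p.2) | p <- l].

Lemma step_fun_sub l1 l2 u : step_fun (l1 ++ opp_steps l2) u = step_fun l1 u - step_fun l2 u.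
Proof.
rewrite /step_fun big_cat big_map -sumrN; congr (_ + _).
by apply: eq_bigr => p _; rewrite mulNr.
Qed.

End StepApproximation.

Section WienerIntegral.
Context {R : realType} {d : measure_display} {Om : measurableType d}.
Variable Pr : probability Om R.
Variable w : R -> Om -> R.
Hypothesis bm : brownian_motion Pr w.
Implicit Types (g : R -> R) (s t u T : R) (l : seq (R * R)).
Notation mu := (@lebesgue_measure R).

Lemma step_int_sub l1 l2 t om :
  step_int w (l1 ++ opp_steps l2) t om = step_int w l1 t om - step_int w l2 t om.
Proof.
rewrite /step_int big_cat big_map -sumrN; congr (_ + _).
by apply: eq_bigr => p _; rewrite mulNr.
Qed.

Lemma measurable_step_fun l : measurable_fun setT (step_fun l).
Proof. by apply: measurable_sum => p; apply: measurable_funM => //; exact: measurable_indic. Qed.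

Lemma step_int_isometry_co l T : 0 < T ->
  (\int[Pr]_om (step_int w l T om ^+ 2)%:E = \int[mu]_(u in `[0%R, T[) (step_fun l u ^+ 2)%:E)%E.
Proof.
move=> T0; rewrite (step_int_isometry bm) // integral_itv_bndo_bndc //.
apply/measurable_EFinP; apply: measurable_funX; apply: measurable_funTS.
exact: measurable_step_fun.
Qed.

Lemma step_int_bound l T (c : R) : 0 < T -> (forall u, 0 <= u < T -> `|step_fun l u| <= c) ->
  (\int[Pr]_om (step_int w l T om ^+ 2)%:E <= (c ^+ 2 * T)%:E)%E.
Proof.
move=> T0 H; rewrite step_int_isometry_co //.
apply: (@le_trans _ _ (\int[mu]_(u in `[0%R, T[) (c ^+ 2)%:E)%E).
  apply: ge0_le_integral => //.
  - by move=> u _; rewrite lee_fin sqr_ge0.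
  - by apply/measurable_EFinP; apply: measurable_funX; apply: measurable_funTS; exact: measurable_step_fun.
  - move=> u /=; rewrite in_itv /= => uT; have h := H u uT.
    rewrite lee_fin -[leLHS]real_normK ?num_real // lerXn2r ?nnegrE //.
    exact: le_trans h.
rewrite integral_cst //= lebesgue_measure_itv /= lte_fin T0.
by rewrite oppr0 adde0 -EFinM.
Qed.

Lemma step_int_continuous l om : continuous (fun t => step_int w l t om).
Proof.
apply: continuous_sumr => p _ t; apply: cvgM; first exact: cvg_cst.
apply: cvgB; last exact: cvg_cst.
case: bm => _ _ _ _ /(_ om) /within_clamp H.
have min_c : continuous (fun s : R => Num.min s p.2).
  by apply: min_fun_continuous => x; [exact: cvg_id|exact: cvg_cst].
exact: (@continuous_comp _ _ _ (fun s : R => Num.min s p.2) _ t (min_c t) (H _)).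
Qed.

(** The maximal inequality on the dyadic grid of mesh T / 2^p has a bound free of p, so it survives
    the increasing union over p; continuity of the path carries the bound from grid points to all
    times. *)
Lemma step_int_sup l T (c eps : R) : 0 < T -> 0 < eps ->
  (forall u, 0 <= u < T -> `|step_fun l u| <= c) ->
  exists A : set Om, [/\ measurable A, (Pr A <= ((c / eps) ^+ 2 * T)%:E)%E &
    forall om, ~ A om -> forall t, 0 <= t <= T -> `|step_int w l t om| <= eps].
Proof.
move=> T0 eps0 H.
(* Capping at T keeps the grid monotone over all indices, constant from index 2^p on. *)
pose tau p i : R := Num.min (i%:R * (T / (2 ^ p)%:R)) T.
have h0 p : 0 < T / (2 ^ p)%:R by rewrite divr_gt0 // ltr0n expn_gt0.
have tau0 p : tau p 0%N = 0 by rewrite /tau mul0r min_l // ltW.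
have tauS p i : tau p i <= tau p i.+1.
  by rewrite /tau le_min2 // ler_wpM2r ?ler_nat // ltW.
have tauT p : tau p (2 ^ p)%N = T.
  by rewrite /tau mulrC mulfVK ?minxx // pnatr_eq0 -lt0n expn_gt0.
pose E p := exceeds w l eps (tau p) (2 ^ p).
have mE p : measurable (E p) by exact: (measurable_exceeds bm).
exists (\bigcup_p E p); split.
- exact: bigcup_measurable.
- have hE p : (Pr (E p) <= ((c / eps) ^+ 2 * T)%:E)%E.
    have := kolmogorov_maximal bm l eps0 (tau0 p) (tauS p) (2 ^ p).
    rewrite tauT => /le_trans /(_ (step_int_bound T0 H)).
    rewrite -(fineK (fin_num_measure Pr _ (mE p))) -EFinM !lee_fin => h.
    by rewrite exprMn exprVn mulrAC ler_pdivlMr ?exprn_gt0 // mulrC.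
  have Ec := @nondecreasing_cvg_mu _ _ _ Pr E mE (bigcup_measurable (fun p _ => mE p)).
  (* Grid p is the even-indexed part of grid p + 1, so the events increase. *)
  have nE : {homo E : n m / (n <= m)%N >-> (n <= m)%O}.
    apply/nondecreasing_seqP => p; apply/subsetPset => om [i /= iN Hi].
    exists (i.*2) => /=.
      by rewrite ltnS expnS mul2n leq_double -ltnS.
    move: Hi; congr (_ <= `|step_int w l _ om|).
    rewrite /tau expnS natrM -muln2 natrM; congr (Num.min _ _).
    by field; rewrite pnatr_eq0 -lt0n expn_gt0.
  rewrite -(cvg_lim _ (Ec nE)) //.
  apply: lime_le; first by apply/cvg_ex; eexists; exact: Ec nE.
  by apply: nearW => p; exact: hE.
- move=> om nA t /andP[t0 tT]; rewrite leNgt; apply/negP => Ht.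
  have Dc : `|step_int w l s om| @[s --> t] --> `|step_int w l t om|.
    by apply: cvg_norm; exact: step_int_continuous.
  have [r /= r0 Hr] : \forall s \near t, eps < `|step_int w l s om|.
    by apply: (cvgr_gt _ Dc).
  have [p Hp] : exists p : nat, T / (2 ^ p)%:R < r.
    have /cvgrPdist_lt /(_ r r0) : T / (2 ^ n)%:R @[n --> \oo] --> (0 : R).
      rewrite -[X in _ --> X](mulr0 T); apply: cvgM; first exact: cvg_cst.
      under eq_fun do rewrite natrX -exprVn.
      by apply: cvg_expr; rewrite ger0_norm ?invr_ge0 // invf_lt1 // ltr1n.
    case=> n _ /(_ n (leqnn n)); rewrite /= sub0r normrN gtr0_norm //.
    by move=> ?; exists n.
  apply: nA; exists p => //.
  (* The grid point just left of t lies within the distance r on which the path stays above eps. *)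
  pose i := Num.truncn (t / (T / (2 ^ p)%:R)).
  have ti : 0 <= t / (T / (2 ^ p)%:R) by rewrite divr_ge0 // ltW.
  have /andP[i1 i2] := truncn_itv ti.
  rewrite ler_pdivlMr // in i1; rewrite ltr_pdivrMr // in i2.
  have iN : (i <= 2 ^ p)%N.
    rewrite -(ler_nat R) -(ler_pM2r (h0 p)); apply: le_trans i1 _.
    by apply: le_trans tT _; rewrite mulrC mulfVK // pnatr_eq0 -lt0n expn_gt0.
  exists i => //=.
  apply/ltW/Hr => /=.
  rewrite /tau min_l; last exact: le_trans i1 _.
  rewrite ger0_norm ?subr_ge0 //; apply: lt_trans Hp.
  by rewrite ltrBlDr; move: i2; rewrite -natr1 mulrDl mul1r addrC.
Qed.

End WienerIntegral.

Section UniformLimits.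
Context {R : realType}.
Implicit Types (x : nat -> R -> R) (t T : R).

Lemma geometric_cauchy (u : nat -> R) k0 :
  (forall k, (k0 <= k)%N -> `|u k.+1 - u k| <= 2^-1 ^+ k) ->
  cvgn u /\ forall k, (k0 <= k)%N -> `|limn u - u k| <= 2 * 2^-1 ^+ k.
Proof.
move=> H.
have tel k j : (k0 <= k)%N -> `|u (k + j)%N - u k| <= 2 * (2^-1 ^+ k - 2^-1 ^+ (k + j)).
  move=> k0k; elim: j => [|j IH]; first by rewrite addn0 !subrr normr0 mulr0.
  rewrite addnS (_ : u _ - u k = (u (k + j).+1 - u (k + j)%N) + (u (k + j)%N - u k)); last by ring.
  apply: le_trans (ler_normD _ _) _.
  apply: le_trans (lerD (H _ (leq_trans k0k (leq_addr _ _))) IH) _.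
  by rewrite exprS; lra.
have tel2 k j : (k0 <= k)%N -> (k <= j)%N -> `|u j - u k| <= 2 * 2^-1 ^+ k.
  move=> k0k /subnKC <-; apply: le_trans (tel _ _ k0k) _.
  by rewrite ler_wpM2l // gerBl exprn_ge0 // invr_ge0.
have pow0 : (2 * 2^-1 ^+ k : R) @[k --> \oo] --> (0 : R).
  rewrite -[X in _ --> X](mulr0 2); apply: cvgM; first exact: cvg_cst.
  by apply: cvg_expr; rewrite ger0_norm ?invr_ge0 // invf_lt1 // ltr1n.
have cu : cvgn u.
  apply: cauchy_cvg; apply: cauchy_exP => e e0.
  have /cvgrPdist_lt /(_ e e0) [K _ HK] := pow0.
  pose k := maxn K k0; exists (u k); exists k => // j /= kj.
  rewrite -ball_normE /= distrC; apply: le_lt_trans (tel2 _ _ (leq_maxr _ _) kj) _.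
  by have := HK k (leq_maxl _ _); rewrite /= sub0r normrN ger0_norm.
split=> // k k0k.
have lk : `|u j - u k| @[j --> \oo] --> `|limn u - u k|.
  by apply: cvg_norm; apply: cvgB => //; exact: cvg_cst.
rewrite -(cvg_lim _ lk) //; apply: limr_le; first exact: cvgP lk.
by exists k => // j /= kj; exact: tel2.
Qed.

(** Uniform limits preserve continuity; closeness is asked only up to some T > t because the
    approximations of the Wiener integral are uniform on bounded intervals. *)
Lemma continuous_of_close (z : R -> R) (t T : R) : t < T ->
  (forall e : R, 0 < e -> exists y : R -> R, continuous y /\
     forall s, s <= T -> `|z s - y s| <= e) -> {for t, continuous z}.
Proof.
move=> tT H; apply/cvgrPdist_le => e e0.
have e3 : 0 < e / 3 by rewrite divr_gt0.
have [y [yc Hy]] := H _ e3.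
have /cvgrPdist_le /(_ _ e3) N := yc t.
near=> s.
have sT : s <= T by near: s; apply: (filterS (fun s => @ltW _ _ s T)); exact: (lt_nbhsl tT).
have h : `|y t - y s| <= e / 3 by near: s.
rewrite (_ : z t - z s = (z t - y t) + (y t - y s) - (z s - y s)); last by ring.
apply: le_trans (ler_normB _ _) _; apply: le_trans (lerD (ler_normD _ _) (lexx _)) _.
apply: le_trans (lerD (lerD (Hy t (ltW tT)) h) (Hy s sT)) _; lra.
Unshelve. all: by end_near. Qed.

Lemma step_fun_approx (g : R -> R) (K : nat) (eps : R) : continuous g -> 0 < eps ->
  exists l, forall u, 0 <= u < K%:R -> `|step_fun l u - g u| <= eps.
Proof.
move=> gc eps0.
have [e /= e0 He] := heine_cantor K%:R gc eps0.
have [n] : exists n : nat, n.+1%:R^-1 < e.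
  have /cvgrPdist_lt /(_ e e0) := @cvg_harmonic R.
  case=> n _ /(_ n (leqnn n)); rewrite /= sub0r normrN gtr0_norm ?invr_gt0 // => h.
  by exists n.
move=> ne; pose h : R := n.+1%:R^-1.
have h0 : 0 < h by rewrite invr_gt0.
pose tau j : R := j%:R * h.
(* The mesh 1 / (n + 1) divides the integer horizon, so these cells end exactly at K. *)
exists (partition_steps (g \o tau) tau (K * n.+1)) => u /andP[u0 uK].
apply: step_fun_partition_close => //.
- by rewrite /tau mul0r.
- by move=> i; rewrite /tau ler_wpM2r ?ler_nat // ltW.
- by rewrite /tau natrM mulfK // pnatr_eq0.
move=> j jJ h1 h2; apply: (He h) => //=.
- by rewrite sub0r normrN gtr0_norm.
- by rewrite mulr_ge0 ?(ltW h0) //= (le_trans h1) // ltW.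
- rewrite distrC ger0_norm ?subr_ge0 // ltW // ltrBlDr.
  by move: h2; rewrite /tau -natr1 mulrDl mul1r addrC.
Qed.

End UniformLimits.

Section L2Limits.
Context {R : realType} {d : measure_display} {Om : measurableType d}.
Variable Pr : probability Om R.

Lemma fatou_sqr (Y : Om -> R) (Yk : nat -> Om -> R) (N : set Om) (c : \bar R) :
  measurable N -> Pr N = 0%E -> measurable_fun setT Y -> (forall k, measurable_fun setT (Yk k)) ->
  (forall om, ~ N om -> Yk ^~ om @ \oo --> Y om) ->
  (forall k, \int[Pr]_om (Yk k om ^+ 2)%:E <= c)%E ->
  (\int[Pr]_om (Y om ^+ 2)%:E <= c)%E.
Proof.
move=> mN N0 mY mYk H Hc.
have msq (X : Om -> R) : measurable_fun setT X -> measurable_fun setT (fun om => (X om ^+ 2)%:E).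
  by move=> mX; apply/measurable_EFinP; exact: measurable_sqr.
rewrite (ge0_negligible_integral mN measurableT _ _ N0) //; last 2 first.
- exact: msq.
- by move=> om _; rewrite lee_fin sqr_ge0.
have mD : measurable ([set: Om] `\` N) by exact: measurableD.
apply: (@le_trans _ _ (\int[Pr]_(om in [set: Om] `\` N) limn_einf (fun k => (Yk k om ^+ 2)%:E))%E).
  rewrite le_eqVlt; apply/orP; left; apply/eqP; apply: eq_integral => om.
  rewrite inE => -[_ nN].
  suff C : (fun k => (Yk k om ^+ 2)%:E) @ \oo --> (Y om ^+ 2)%:E by rewrite (cvg_limn_einf_sup C).1.
  apply: cvg_EFin; first by apply: nearW.
  by apply: cvgM; exact: H.
apply: le_trans (fatou Pr mD _ _) _.
- by move=> k; apply: measurable_funTS; exact: msq.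
- by move=> k om _; rewrite lee_fin sqr_ge0.
have Hd k : (\int[Pr]_(om in [set: Om] `\` N) (Yk k om ^+ 2)%:E <= c)%E.
  apply: le_trans (Hc k); apply: ge0_subset_integral => //; first exact: msq.
  by move=> om _; rewrite lee_fin sqr_ge0.
rewrite limn_einf_lim; apply: lime_le; first exact: is_cvg_einfs.
apply: nearW => n; apply: le_trans (Hd n).
by apply: ereal_inf_lbound; exists n => /=.
Qed.

End L2Limits.

Section WienerExistence.
Context {R : realType} {d : measure_display} {Om : measurableType d}.
Variable Pr : probability Om R.
Variable w : R -> Om -> R.
Hypothesis bm : brownian_motion Pr w.
Variable g : R -> R.
Hypothesis gc : {within `[0, +oo[, continuous g}.
Implicit Types (s t u T : R) (l : seq (R * R)).

Let gcl : continuous (g \o clamp).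
Proof. exact/within_clamp. Qed.

Lemma step_int_lt0 l t om : t <= 0 -> step_int w l t om = 0.
Proof.
move=> t0; rewrite -(step_int0 w l om) /step_int; apply: eq_bigr => p _; congr (_ * centered w _ om).
by rewrite !clamp_le0 // ge_min ?lexx // t0.
Qed.

Lemma step_int_partition (c tau : nat -> R) J t om :
  step_int w (partition_steps c tau J) t om =
  \sum_(j < J) c j * (centered w (clamp (Num.min t (tau j.+1))) om - centered w (clamp (Num.min t (tau j))) om).
Proof.
elim: J => [|J IH]; first by rewrite /step_int big_nil big_ord0.
rewrite big_ord_recr /= -IH /step_int !big_cons /=; ring.
Qed.

(** A left-endpoint Riemann sum is itself the integral of this step function, which brings the
    isometry to bear on it. *)
Definition riemann_steps t m :=
  partition_steps (fun j => g (j%:R * t / m.+1%:R)) (fun j => j%:R * t / m.+1%:R) m.+1.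

Lemma riemann_ito_step t m om : 0 <= t ->
  riemann_ito_sum g w t m om
  = step_int w (riemann_steps t m) t om.
Proof.
move=> t0; rewrite /riemann_steps step_int_partition; apply: eq_bigr => j _; congr (_ * _).
have E i : (i <= m.+1)%N -> clamp (Num.min t (i%:R * t / m.+1%:R)) = i%:R * t / m.+1%:R.
  move=> im; rewrite min_r ?clamp_id //; first by rewrite divr_ge0 // mulr_ge0.
  by rewrite ler_pdivrMr // mulrC ler_wpM2l // ler_nat.
by rewrite !E // ?(ltnW (ltn_ord j)) // /centered; ring.
Qed.

Lemma riemann_steps_close t (c : R) : 0 < t -> 0 < c -> \forall m \near \oo,
  forall u, 0 <= u < t -> `|step_fun (riemann_steps t m) u - (g \o clamp) u| <= c.
Proof.
move=> t0 c0; have [dl /= dl0 Hdl] := heine_cantor t gcl c0.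
have tm0 : t / m.+1%:R @[m --> \oo] --> (0 : R).
  by rewrite -[X in _ --> X](mulr0 t); apply: cvgM; [exact: cvg_cst|exact: cvg_harmonic].
have /cvgrPdist_lt /(_ dl dl0) := tm0.
apply: filterS => m /=; rewrite sub0r normrN => tm u /andP[u0 ut].
have tm1 : 0 < t / m.+1%:R by rewrite divr_gt0.
apply: (@step_fun_partition_close _ (g \o clamp)) => //.
- by rewrite !mul0r.
- by move=> i; rewrite -!mulrA ler_wpM2r ?ler_nat // ltW.
- by rewrite mulrAC divff ?mul1r // pnatr_eq0.
move=> j jm h2 h3; have tj0 : 0 <= j%:R * t / m.+1%:R by rewrite -mulrA mulr_ge0 // ltW.
rewrite -{1}(clamp_id tj0); apply: (Hdl (t / m.+1%:R)) => //=.
- by rewrite sub0r normrN.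
- by rewrite tj0 (le_trans h2) // ltW.
- rewrite distrC ger0_norm ?subr_ge0 // ltW // ltrBlDr.
  by move: h3; rewrite -natr1 !mulrDl mul1r addrC.
Qed.

Theorem continuous_wiener_integral : exists Z : R -> Om -> R,
  [/\ forall om, continuous (Z ^~ om), forall t, measurable_fun setT (Z t),
      forall om, Z 0 om = 0 & wiener_integral Pr g w Z].
Proof.
(* The k-th step function has precision 4^-k on [0, k + 1[ , tested against the threshold 2^-k: the
   exceptional probability 4 (k + 1) 4^-k is summable, and so are the thresholds. *)
have q0 k : 0 < (4^-1 : R) ^+ k by rewrite exprn_gt0 // invr_gt0.
have [l Hl] := choice (fun k : nat => step_fun_approx k.+1 gcl (q0 k)).
pose D k := l k.+1 ++ opp_steps (l k).
have HD k u : 0 <= u < k.+1%:R -> `|step_fun (D k) u| <= 2 * 4^-1 ^+ k.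
  move=> /andP[u0 uk]; rewrite step_fun_sub.
  have h1 : `|step_fun (l k) u - (g \o clamp) u| <= 4^-1 ^+ k by apply: Hl; rewrite u0.
  have h2 : `|step_fun (l k.+1) u - (g \o clamp) u| <= 4^-1 ^+ k.+1.
    by apply: Hl; rewrite u0 (lt_trans uk) // ltr_nat.
  rewrite (_ : _ - _ = (step_fun (l k.+1) u - (g \o clamp) u) - (step_fun (l k) u - (g \o clamp) u)); last by ring.
  apply: le_trans (ler_normB _ _) _; apply: le_trans (lerD h2 h1) _.
  by rewrite exprS; have := q0 k; lra.
have q2 k : 0 < (2^-1 : R) ^+ k by rewrite exprn_gt0 // invr_gt0.
have k1 k : 0 < k.+1%:R :> R by rewrite ltr0n.
have HA k := step_int_sup bm (k1 k) (q2 k) (HD k).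
(* Since (k + 1) / 2^k <= 1, the bound is at most 4 / 2^k, written as 8 / 2^(k + 1) to match the
   geometric series summed below. *)
have {}HA k : exists A : set Om, [/\ measurable A, (Pr A <= (8 / (2 ^ (k + 1))%:R)%:E)%E &
    forall om, ~ A om -> forall t, 0 <= t <= k.+1%:R -> `|step_int w (D k) t om| <= 2^-1 ^+ k].
  have [A [mA PA H]] := HA k.
  exists A; split => //; apply: (le_trans PA); rewrite lee_fin.
  have e4 : (4^-1 : R) ^+ k = 2^-1 ^+ k * 2^-1 ^+ k.
    by rewrite -exprMn; congr (_ ^+ _); field.
  have p0 : 0 < (2^-1 : R) ^+ k by rewrite exprn_gt0 // invr_gt0.
  have -> : 2 * 4^-1 ^+ k / 2^-1 ^+ k = 2 * 2^-1 ^+ k :> R.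
    by rewrite e4 mulrA mulfK // gt_eqF.
  have k2 : k.+1%:R * 2^-1 ^+ k <= 1 :> R.
    rewrite exprVn ler_pdivrMr ?exprn_gt0 // mul1r -natrX ler_nat.
    exact: ltn_expl.
  rewrite addn1 expnS natrM natrX invfM -exprVn.
  have -> : (2 * 2^-1 ^+ k) ^+ 2 * k.+1%:R = 4 * 2^-1 ^+ k * (k.+1%:R * 2^-1 ^+ k) :> R by ring.
  have -> : 8 * (2^-1 * 2^-1 ^+ k) = 4 * 2^-1 ^+ k :> R by field.
  by rewrite ler_piMr // mulr_ge0 // ltW.
have [A /all_and3[mA PA AH]] := choice HA.
pose Bad := lim_sup_set A.
have mBad : measurable Bad.
  by apply: bigcap_measurable => // n _; apply: bigcup_measurable.
have Bad0 : Pr Bad = 0%E.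
  apply: lim_sup_set_cvg0 => //.
  have S8 := @cvg_geometric_eseries_half R 8 0.
  apply: (@le_lt_trans _ _ (\big[+%E/0%R]_(0 <= k <oo) (8 / (2 ^ (k + 1))%:R)%:E)%E).
    by apply: lee_nneseries => // k _; exact: PA.
  by rewrite [X in (X < _)%E](cvg_lim _ S8) // ltry.
pose X k t om := step_int w (l k) t om.
(* On the null set [Bad] the process is set to 0, so that every path, and not only almost every one,
   is continuous, as [sde_sol] demands. *)
pose Z t om := if om \in Bad then 0 else limn (fun k => X k t om).
have good om : ~ Bad om -> exists k0, forall T k, T <= k.+1%:R -> (k0 <= k)%N ->
    forall t, t <= T -> `|X k.+1 t om - X k t om| <= 2^-1 ^+ k.
  move=> nB; have [k0 Hk0] : exists k0, forall k, (k0 <= k)%N -> ~ A k om.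
    apply: contrapT => nE; apply: nB => n _; apply: contrapT => nU.
    by apply: nE; exists n => k nk Ak; apply: nU; exists k.
  exists k0 => T k Tk k0k t tT; rewrite /X -step_int_sub.
  have [t0|t0] := leP 0 t; first by apply: (AH k om (Hk0 k k0k)); rewrite t0 (le_trans tT).
  by rewrite step_int_lt0 ?(ltW t0) // normr0 exprn_ge0 // invr_ge0.
have bound (T : R) : exists K : nat, forall k, (K <= k)%N -> T <= k.+1%:R.
  exists (Num.truncn `|T|) => k Kk; apply: le_trans (ler_norm T) _.
  have /andP[_ /ltW h] := truncn_itv (normr_ge0 T).
  by apply: le_trans h _; rewrite ler_nat ltnS.
have lim_good om T : ~ Bad om -> exists K, forall t, t <= T -> cvgn (fun k => X k t om) /\
    forall k, (K <= k)%N -> `|Z t om - X k t om| <= 2 * 2^-1 ^+ k.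
  move=> nB; have [k0 Hk0] := good om nB; have [K HK] := bound T.
  exists (maxn k0 K) => t tT.
  have := @geometric_cauchy R (fun k => X k t om) (maxn k0 K).
  rewrite /Z memNset //; apply=> k; rewrite geq_max => /andP[k0k Kk].
  by apply: (Hk0 T) => //; exact: HK.
have mX k t : measurable_fun setT (X k t) by exact: (step_int_L2rv bm (l k) t).1.
have mZ t : measurable_fun setT (Z t).
  pose Y k om := \1_(~` Bad) om * X k t om.
  apply: (@measurable_fun_cvg _ _ _ _ Y) => [k|om _].
    by apply: measurable_funM => //; apply: measurable_indic; exact: measurableC.
  have [B|nB] := pselect (Bad om).
    rewrite /Z mem_set // /Y indicE memNset; last by [].
    by under eq_fun do rewrite mul0r; exact: cvg_cst.
  rewrite /Z memNset // /Y indicE mem_set //.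
  under eq_fun do rewrite mul1r.
  by have [K /(_ t (lexx t))[+ _]] := lim_good om t nB.
have Xc k om : continuous (fun t => X k t om) by exact: (step_int_continuous bm).
have Z0 om : Z 0 om = 0.
  rewrite /Z; case: ifP => // _; apply: cvg_lim => //.
  by rewrite /X; under eq_fun do rewrite step_int_lt0 //; exact: cvg_cst.
exists Z; split => //.
- move=> om; have [B|nB] := pselect (Bad om).
    have -> : Z ^~ om = cst 0 by apply/funext => t; rewrite /Z mem_set.
    by move=> t; exact: cvg_cst.
  move=> t; apply: (@continuous_of_close _ _ t (t + 1)); first by rewrite ltrDl.
  move=> e e0; have [K HK] := lim_good om (t + 1) nB.
  have [k Kk ke] : exists2 k, (K <= k)%N & 2 * (2^-1 : R) ^+ k <= e.
    have pow0 : (2 * 2^-1 ^+ k : R) @[k --> \oo] --> (0 : R).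
      rewrite -[X in _ --> X](mulr0 2); apply: cvgM; first exact: cvg_cst.
      by apply: cvg_expr; rewrite ger0_norm ?invr_ge0 // invf_lt1 // ltr1n.
    have /cvgrPdist_le /(_ e e0) [K' _ HK'] := pow0.
    exists (maxn K K'); first exact: leq_maxl.
    by have := HK' _ (leq_maxr K K'); rewrite /= sub0r normrN ger0_norm.
  exists (fun s => X k s om); split => // s sT; apply: le_trans ke.
  by have [_ ->] := HK s sT.
- move=> t t0; split => //.
  pose RS := riemann_ito_sum g w t.
  have mRS m : measurable_fun setT (RS m).
    have -> : RS m = step_int w (riemann_steps t m) t.
      by apply/funext => om; rewrite /RS riemann_ito_step.
    exact: (step_int_L2rv bm _ t).1.
  suff H e : 0 < e -> \forall m \near \oo, (\int[Pr]_om ((RS m om - Z t om) ^+ 2)%:E <= e%:E)%E.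
    rewrite unlock; apply/fine_cvgP.
    have I0 m : (0 <= \int[Pr]_om ((RS m om - Z t om) ^+ 2)%:E)%E.
      by apply: integral_ge0 => om _; rewrite lee_fin sqr_ge0.
    split.
      apply: filterS (H 1 ltr01) => m Hm; rewrite ge0_fin_numE //.
      exact: le_lt_trans Hm (ltry _).
    apply/cvgrPdist_le => e e0; apply: filterS (H e e0) => m Hm /=.
    rewrite sub0r normrN ger0_norm; last exact: fine_ge0.
    rewrite -lee_fin fineK //; rewrite ge0_fin_numE //; exact: le_lt_trans Hm (ltry _).
  move=> e0; move: t0; rewrite le_eqVlt => /orP[/eqP t0|t0].
    apply: nearW => m; rewrite integral0_eq ?lee_fin ?(ltW e0) // => om _.
    rewrite /RS riemann_ito_step -?t0 // step_int_lt0 //.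
    by rewrite Z0 subrr expr0n.
  (* Both the Riemann step function and the late approximations are within c of g, hence within 2 c
     of each other; the isometry then gives (2 c)^2 t = e. *)
  pose c := Num.sqrt (e / (4 * t)).
  have et0 : 0 < e / (4 * t) by rewrite divr_gt0 // mulr_gt0.
  have c0 : 0 < c by rewrite sqrtr_gt0.
  have ce : (2 * c) ^+ 2 * t = e.
    rewrite exprMn sqr_sqrtr ?(ltW et0) //; field; exact: lt0r_neq0.
  have [k0 Hk0] := bound t.
  have [k2 Hk2] : exists k2 : nat, forall k, (k2 <= k)%N -> (4^-1 : R) ^+ k <= c.
    have pow0 : (4^-1 : R) ^+ k @[k --> \oo] --> (0 : R).
      by apply: cvg_expr; rewrite ger0_norm ?invr_ge0 // invf_lt1 // ltr1n.
    have /cvgrPdist_le /(_ c c0) [K' _ HK'] := pow0.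
    by exists K' => k Kk; have := HK' k Kk; rewrite /= sub0r normrN ger0_norm.
  apply: filterS (riemann_steps_close t0 c0) => m Hm.
  (* Fatou's lemma passes from the step integrals, for which the isometry holds, to their almost
     sure limit Z. *)
  apply: (@fatou_sqr _ _ _ _ _ (fun k om => RS m om - X (maxn k0 k2 + k)%N t om) Bad) => //.
  - exact: measurable_funB.
  - by move=> k; apply: measurable_funB.
  - move=> om nB; apply: cvgB; first exact: cvg_cst.
    rewrite /Z memNset //; have [K /(_ t (lexx t))[+ _]] := lim_good om t nB.
    move=> C; under eq_fun do rewrite addnC.
    by have := C; rewrite -(cvg_shiftn (maxn k0 k2)).
  move=> k; set k' := (maxn k0 k2 + k)%N.
  have k'0 : (k0 <= k')%N by rewrite (leq_trans (leq_maxl k0 k2)) // leq_addr.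
  have k'2 : (k2 <= k')%N by rewrite (leq_trans (leq_maxr k0 k2)) // leq_addr.
  rewrite -ce.
  under eq_integral do rewrite /RS riemann_ito_step ?(ltW t0) // /X -step_int_sub.
  apply: (step_int_bound bm) => // u /andP[u0 ut]; rewrite step_fun_sub.
  have h1 : `|step_fun (l k') u - (g \o clamp) u| <= c.
    by apply: le_trans (Hl k' u _) (Hk2 _ k'2); rewrite u0 (lt_le_trans ut) // Hk0.
  rewrite (_ : step_fun ?[a] u - step_fun ?[b] u = (step_fun ?a u - (g \o clamp) u) - (step_fun ?b u - (g \o clamp) u)); last by ring.
  apply: le_trans (ler_normB _ _) _.
  rewrite (_ : 2 * c = c + c); last by ring.
  by apply: lerD => //; apply: Hm; rewrite u0.
Qed.

End WienerExistence.

Section WienerEnergy.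
Context {R : realType} {d : measure_display} {Om : measurableType d}.
Variable Pr : probability Om R.
Variables (w : R -> Om -> R) (g : R -> R) (X : R -> Om -> R).
Hypothesis bm : brownian_motion Pr w.
Hypothesis gc : {within `[0, +oo[, continuous g}.
Hypothesis wX : wiener_integral Pr g w X.
Implicit Types (t e : R).
Notation mu := (@lebesgue_measure R).

Lemma ge0_integral_sqr_le (A B : Om -> R) : measurable_fun setT A -> measurable_fun setT B ->
  (\int[Pr]_om (A om ^+ 2)%:E
   <= 2%:E * \int[Pr]_om (B om ^+ 2)%:E + 2%:E * \int[Pr]_om ((B om - A om) ^+ 2)%:E)%E.
Proof.
move=> mA mB.
have msq (Y : Om -> R) : measurable_fun setT Y -> measurable_fun setT (fun om => (Y om ^+ 2)%:E).
  by move=> mY; apply/measurable_EFinP; exact: measurable_sqr.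
have mBA : measurable_fun setT (fun om => B om - A om) by exact: measurable_funB.
rewrite -!ge0_integralZl ?lee_fin //; try exact: msq; try by move=> om _; rewrite lee_fin sqr_ge0.
rewrite -ge0_integralD //; last 4 first.
- by move=> om _; rewrite -EFinM lee_fin mulr_ge0 // sqr_ge0.
- by apply: measurable_funeM; exact: msq.
- by move=> om _; rewrite -EFinM lee_fin mulr_ge0 // sqr_ge0.
- by apply: measurable_funeM; exact: msq.
apply: ge0_le_integral => //.
- by move=> om _; rewrite lee_fin sqr_ge0.
- exact: msq.
- by apply: emeasurable_funD; apply: measurable_funeM; exact: msq.
- move=> om _; rewrite -!EFinM -EFinD lee_fin.
  by have := sqr_ge0 (2 * B om - A om); nra.
Qed.

Lemma wiener_integral_small t e : 0 <= t -> 0 < e ->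
  \forall m \near \oo, (\int[Pr]_om ((riemann_ito_sum g w t m om - X t om) ^+ 2)%:E <= e%:E)%E.
Proof.
move=> t0 e0; have [_] := wX t0; rewrite unlock => /fine_cvgP[fin /cvgrPdist_le /(_ e e0)].
move: fin; apply: filterS2 => m fin /=; rewrite sub0r normrN => H.
by rewrite -(fineK fin) lee_fin (le_trans (ler_norm _)).
Qed.

(** Here [X] is an arbitrary version of the integral. The sharp constant is 1; the factor 4 comes
    from two uses of (a + b)^2 <= 2 a^2 + 2 b^2, once between X and a Riemann sum, once between its
    step function and g. Only finiteness matters later. *)
Lemma wiener_integral_energy t : 0 <= t ->
  (\int[Pr]_om (X t om ^+ 2)%:E <= (4 * prim (fun u => g (clamp u) ^+ 2) t)%:E)%E.
Proof.
move=> t0; have gcl : continuous (g \o clamp) by exact/within_clamp.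
have [mX _] := wX t0.
have g2c : continuous (fun u => g (clamp u) ^+ 2).
  by move=> u; apply: cvgM; exact: gcl.
have I0 : 0 <= prim (fun u => g (clamp u) ^+ 2) t by apply: prim_ge0 => u _; rewrite sqr_ge0.
suff H e : 0 < e -> (\int[Pr]_om (X t om ^+ 2)%:E <= (4 * prim (fun u => g (clamp u) ^+ 2) t + e)%:E)%E.
  apply/lee_addgt0Pr => e e0; rewrite -EFinD; exact: H.
have RSE m om := @riemann_ito_step R _ _ w g t m om t0.
move=> e0.
have e2 : 0 < e / 4 by rewrite divr_gt0.
have Hs := wiener_integral_small t0 e2.
move: t0; rewrite le_eqVlt => /orP[/eqP t0|t0].
  have [m Hm] := filter_ex Hs.
  apply: (@le_trans _ _ (\int[Pr]_om ((riemann_ito_sum g w t m om - X t om) ^+ 2)%:E)%E).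
    rewrite le_eqVlt; apply/orP; left; apply/eqP; apply: eq_integral => om _.
    by rewrite RSE -t0 step_int_lt0 // sub0r sqrrN.
  by apply: (le_trans Hm); rewrite lee_fin; lra.
(* Chosen so that the error 4 c^2 t is e / 2; the other e / 2 is twice the distance e / 4 to the
   Riemann sum. *)
pose c := Num.sqrt (e / (8 * t)).
have et0 : 0 < e / (8 * t) by rewrite divr_gt0 // mulr_gt0.
have c0 : 0 < c by rewrite sqrtr_gt0.
have ce : 4 * (c ^+ 2 * t) = e / 2.
  rewrite sqr_sqrtr ?(ltW et0) //; field; exact: lt0r_neq0.
have [m [Hm close]] := filter_ex (filterI Hs (riemann_steps_close gc t0 c0)).
pose l := riemann_steps g t m.
have RSl : riemann_ito_sum g w t m = step_int w l t by apply/funext => om; exact: RSE.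
have EL : (\int[Pr]_om (riemann_ito_sum g w t m om ^+ 2)%:E <= (2 * prim (fun u => g (clamp u) ^+ 2) t + 2 * (c ^+ 2 * t))%:E)%E.
  rewrite RSl (step_int_isometry_co bm) //.
  have pc : continuous (fun u => 2 * g (clamp u) ^+ 2 + 2 * c ^+ 2).
    by move=> u; apply: cvgD; [apply: cvgM; [exact: cvg_cst|exact: g2c]|exact: cvg_cst].
  have -> : 2 * prim (fun u => g (clamp u) ^+ 2) t + 2 * (c ^+ 2 * t) = prim (fun u => 2 * g (clamp u) ^+ 2 + 2 * c ^+ 2) t.
    rewrite primD; [|by move=> u; apply: cvgM; [exact: cvg_cst|exact: g2c]|by move=> u; exact: cvg_cst].
    by rewrite primZ // prim_cst ?(ltW t0) // mulrA.
  have pos u : 0 <= 2 * g (clamp u) ^+ 2 + 2 * c ^+ 2 by rewrite addr_ge0 // mulr_ge0 // sqr_ge0.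
  rewrite -prim_ereal // -integral_itv_bndo_bndc; last exact: measurable_continuous.
  apply: ge0_le_integral => //.
  - by move=> u _; rewrite lee_fin sqr_ge0.
  - by apply/measurable_EFinP; apply: measurable_funX; apply: measurable_funTS; exact: measurable_step_fun.
  - exact: measurable_continuous.
  - move=> u /=; rewrite in_itv /= => /close H; rewrite lee_fin.
    move: H; rewrite /= -/l ler_norml => /andP[h1 h2].
    have := sqr_ge0 (step_fun l u - 2 * g (clamp u)); nra.
have mRS : measurable_fun setT (riemann_ito_sum g w t m) by rewrite RSl; exact: (step_int_L2rv bm l t).1.
apply: le_trans (ge0_integral_sqr_le mX mRS) _.
apply: le_trans (leeD (lee_wpmul2l _ EL) (lee_wpmul2l _ Hm)) _; rewrite ?lee_fin //.
by lra.
Qed.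

End WienerEnergy.

(** * Stochastic linear systems *)

Section JointMeasurability.
Context {R : realType} {d : measure_display} {Om : measurableType d}.
Implicit Types (h : R -> Om -> R) (t T : R).
Notation mu := (@lebesgue_measure R).

(** Freezing time at the grid point left of t gives, for each mesh, a function assembled on
    countably many rectangles; path continuity makes it converge pointwise. *)
Lemma joint_measurable h : (forall om, continuous (fun t => h (clamp t) om)) ->
  (forall t, 0 <= t -> measurable_fun setT (h t)) ->
  measurable_fun setT (fun p : Om * measurableTypeR R => h (clamp p.2) p.1).
Proof.
move=> hc mh.
pose k n t : nat := Num.truncn (clamp t * n.+1%:R).
pose a n (p : Om * measurableTypeR R) : R := h ((k n p.2)%:R / n.+1%:R) p.1.
apply: (@measurable_fun_cvg _ _ _ _ a) => [n|[om t] _].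
  move=> _ B mB; rewrite setTI.
  have -> : a n @^-1` B = \bigcup_i ((h (i%:R / n.+1%:R) @^-1` B) `*` [set t | k n t = i]).
    apply/seteqP; split => [[om t] /= H|[om t] [i _ [/= H ki]]].
      by exists (k n t).
    by rewrite /a /= ki.
  apply: bigcup_measurable => i _; apply: measurableX.
    by rewrite -[X in measurable X]setTI; apply: mh => //; rewrite divr_ge0.
  have mc : measurable_fun setT (fun t : R => clamp t * n.+1%:R).
    by apply: measurable_funM => //; apply: measurable_maxr.
  have -> : [set t : R | k n t = i] = (fun t : R => clamp t * n.+1%:R) @^-1` `[i%:R, i.+1%:R[%classic.
    apply/seteqP; split => t /=; rewrite in_itv /=.
      by move=> <-; apply: truncn_itv; rewrite mulr_ge0 // clamp_ge0.
    by move=> H; exact: truncn_def.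
  have := mc measurableT _ (measurable_itv `[i%:R, i.+1%:R[); rewrite setTI.
  exact.
rewrite /a /=.
have H : (k n t)%:R / n.+1%:R @[n --> \oo] --> clamp t.
  apply: (@squeeze_cvgr _ _ _ _ (fun n => clamp t - n.+1%:R^-1) (fun=> clamp t)) => //.
  - apply: nearW => n; have /andP[h1 h2] := truncn_itv (mulr_ge0 (clamp_ge0 t) (ler0n R n.+1)).
    rewrite ler_pdivrMr // h1 andbT ler_pdivlMr // mulrBl mulVf // lerBlDr natr1.
    exact: ltW.
  - rewrite -[X in _ --> X]subr0; apply: cvgB; [exact: cvg_cst|exact: cvg_harmonic].
  - exact: cvg_cst.
have E n : h ((k n t)%:R / n.+1%:R) om = h (clamp ((k n t)%:R / n.+1%:R)) om.
  by rewrite clamp_id // divr_ge0.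
rewrite (_ : (fun n => _) = (fun n => h (clamp ((k n t)%:R / n.+1%:R)) om)); last exact/funext.
rewrite -(clamp_id (clamp_ge0 t)).
exact: (cvg_comp _ _ H (hc om (clamp t))).
Qed.

End JointMeasurability.

Section ContinuousProcesses.
Context {R : realType} {d : measure_display} {Om : measurableType d}.
Implicit Types (h : R -> Om -> R) (t T : R) (D : set (measurableTypeR R)).
Notation mu := (@lebesgue_measure R).

Definition cprocess h := (forall om, continuous (fun t => h (clamp t) om)) /\
  (forall t, 0 <= t -> measurable_fun setT (h t)).

Lemma cprocess_det (f : R -> R) : {within `[0, +oo[, continuous f} -> cprocess (fun t _ => f t).
Proof. by move=> /within_clamp fc; split. Qed.

Lemma cprocess_rv (X : Om -> R) : measurable_fun setT X -> cprocess (fun _ => X).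
Proof. by move=> mX; split=> // om t; exact: cvg_cst. Qed.

Lemma cprocessD h1 h2 : cprocess h1 -> cprocess h2 -> cprocess (fun t om => h1 t om + h2 t om).
Proof.
move=> [c1 m1] [c2 m2]; split=> [om t|t t0]; last by apply: measurable_funD; [exact: m1|exact: m2].
by apply: cvgD; [exact: c1|exact: c2].
Qed.

Lemma cprocessM h1 h2 : cprocess h1 -> cprocess h2 -> cprocess (fun t om => h1 t om * h2 t om).
Proof.
move=> [c1 m1] [c2 m2]; split=> [om t|t t0]; last by apply: measurable_funM; [exact: m1|exact: m2].
by apply: cvgM; [exact: c1|exact: c2].
Qed.

Lemma cprocess_cst (a : R) : cprocess (fun _ _ => a).
Proof. by split=> // om t; exact: cvg_cst. Qed.

Lemma cprocessB h1 h2 : cprocess h1 -> cprocess h2 -> cprocess (fun t om => h1 t om - h2 t om).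
Proof.
move=> p1 p2; have := cprocessD p1 (cprocessM (cprocess_cst (-1)) p2).
by congr cprocess; apply/funext => t; apply/funext => om; rewrite mulN1r.
Qed.

Lemma cprocess_sum (I : Type) (s : seq I) (h : I -> R -> Om -> R) :
  (forall i, cprocess (h i)) -> cprocess (fun t om => \sum_(i <- s) h i t om).
Proof.
move=> H; elim: s => [|i s IH].
  have := cprocess_cst 0; congr cprocess; apply/funext => t; apply/funext => om.
  by rewrite big_nil.
have := cprocessD (H i) IH; congr cprocess; apply/funext => t; apply/funext => om.
by rewrite big_cons.
Qed.

Lemma cprocess_max0 h : cprocess h -> cprocess (fun t om => Num.max 0 (h t om)).
Proof.
move=> [c m]; split=> [om t|t t0]; last by apply: measurable_maxr => //; exact: m.
exact: (cvg_comp _ _ (c om t) (@continuous_clamp R _)).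
Qed.

Section Tonelli.
Variables (h : R -> Om -> R) (D : set (measurableTypeR R)).
Hypotheses (ph : cprocess h) (h0 : forall t om, 0 <= t -> 0 <= h t om).
Hypotheses (mD : measurable D) (D0 : forall t, D t -> 0 <= t).

Let f (p : Om * measurableTypeR R) : \bar R := (\1_D p.2 * h (clamp p.2) p.1)%:E.

Let mf : measurable_fun setT f.
Proof.
apply/measurable_EFinP; apply: measurable_funM.
  by apply: (measurableT_comp (measurable_indic _)).
by apply: joint_measurable; [exact: ph.1|exact: ph.2].
Qed.

Let f0 p : (0 <= f p)%E.
Proof. by rewrite lee_fin mulr_ge0 // h0 // clamp_ge0. Qed.

Let fE om : (\int[mu]_(t in D) (h t om)%:E = \int[mu]_t f (om, t))%E.
Proof.
rewrite integral_mkcond; apply: eq_integral => t _; rewrite /f patchE indicE /=.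
case: ifP => [|_]; last by rewrite mul0r.
by rewrite inE => /D0 t0; rewrite mul1r clamp_id.
Qed.

Lemma measurable_time_integral : measurable_fun setT (fun om => \int[mu]_(t in D) (h t om)%:E)%E.
Proof.
under eq_fun do rewrite fE.
exact: (@measurable_fun_fubini_tonelli_F _ _ _ _ _ mu).
Qed.

Lemma tonelli_time_integral (Pr : probability Om R) :
  (\int[Pr]_om \int[mu]_(t in D) (h t om)%:E = \int[mu]_(t in D) \int[Pr]_om (h t om)%:E)%E.
Proof.
under eq_integral do rewrite fE.
rewrite (@fubini_tonelli _ _ _ _ _ Pr mu f mf f0) [RHS]integral_mkcond.
apply: eq_integral => t _; rewrite patchE; case: ifP => tD.
  apply: eq_integral => om _; rewrite /f indicE /= tD mul1r clamp_id //.
  by apply: D0; rewrite inE in tD.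
by apply: integral0_eq => om _; rewrite /f indicE /= tD mul0r.
Qed.

Lemma measurable_expectation (Pr : probability Om R) :
  measurable_fun D (fun t => \int[Pr]_om (h t om)%:E)%E.
Proof.
have H : measurable_fun D (fun t => \int[Pr]_om f (om, t))%E.
  apply: measurable_funTS.
  exact: (@measurable_fun_fubini_tonelli_G _ _ _ _ _ Pr f mf f0).
apply: eq_measurable_fun H => t tD; apply: eq_integral => om _.
rewrite /f indicE /= tD mul1r clamp_id //.
by apply: D0; rewrite inE in tD.
Qed.

End Tonelli.

(** Tonelli gives measurability for nonnegative integrands; in general the primitive is the
    difference of those of the positive and negative parts. *)
Lemma cprocess_prim h : cprocess h -> cprocess (fun t om => prim (fun u => h (clamp u) om) t).
Proof.
move=> ph; have [hc mh] := ph.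
have cm (p : R -> Om -> R) : cprocess p -> (forall t om, 0 <= t -> 0 <= p t om) ->
    forall t, 0 <= t -> measurable_fun setT (fun om => prim (fun u => p (clamp u) om) t).
  move=> pp p0 t t0; have [pc mp] := pp.
  have E om : (\int[mu]_(u in `[0%R, t]) (p u om)%:E)%E = (prim (fun u => p (clamp u) om) t)%:E.
    rewrite -prim_ereal //; last by move=> u _; rewrite p0 // clamp_ge0.
    by apply: eq_integral => u; rewrite inE /= in_itv /= => /andP[u0 _]; rewrite clamp_id.
  apply/measurable_EFinP.
  have -> : EFin \o (fun om => prim (fun u => p (clamp u) om) t) = (fun om => \int[mu]_(u in `[0%R, t]) (p u om)%:E)%E.
    by apply/funext => om /=; rewrite E.
  apply: measurable_time_integral => //.
  by move=> u /=; rewrite in_itv /= => /andP[].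
split=> [om t|t t0].
  have pc := prim_continuous (hc om).
  exact: (@cvg_comp _ _ _ clamp (prim (fun u => h (clamp u) om)) _ _ _ (@continuous_clamp R t) (pc _)).
have p1 := cprocess_max0 ph.
have p2 := cprocess_max0 (cprocessB (cprocess_cst 0) ph).
have -> : (fun om => prim (fun u => h (clamp u) om) t) =
    (fun om => prim (fun u => Num.max 0 (h (clamp u) om)) t - prim (fun u => Num.max 0 (0 - h (clamp u) om)) t).
  apply/funext => om; rewrite -primB; [|exact: p1.1|exact: p2.1].
  apply: eq_prim => u _; rewrite sub0r.
  by rewrite !maxEle; case: (leP 0 (h _ om)); case: (leP 0 (- h _ om)); lra.
by apply: measurable_funB; [apply: (cm _ p1)|apply: (cm _ p2)] => // s om _; rewrite le_max lexx.
Qed.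

End ContinuousProcesses.

Section PopulationEnergy.
Context {R : realType}.
Implicit Types (T : R).

Definition energy n (h : R -> 'cV[R]_n) T : R := prim (fun t => sqnorm (h t)) T.

Lemma energy_ge0 n (h : R -> 'cV[R]_n) T : 0 <= energy h T.
Proof. by apply: prim_ge0 => u _; exact: sqnorm_ge0. Qed.

Lemma energyD n (h1 h2 : R -> 'cV[R]_n) T : vcont h1 -> vcont h2 ->
  energy (fun t => h1 t + h2 t) T <= 2 * (energy h1 T + energy h2 T).
Proof.
move=> c1 c2; have s1 := continuous_sqnorm c1; have s2 := continuous_sqnorm c2.
have s12 : continuous (fun t => sqnorm (h1 t) + sqnorm (h2 t)).
  by move=> t; apply: cvgD; [exact: s1|exact: s2].
rewrite /energy -primD // -primZ //; apply: le_prim.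
- by apply: continuous_sqnorm; exact: vcontD.
- by move=> t; apply: cvgM; [exact: cvg_cst|exact: s12].
- by move=> u _; rewrite mulrDr; exact: sqnormD_le.
Qed.

Lemma energy_le n m (C : R) (h1 : R -> 'cV[R]_n) (h2 : R -> 'cV[R]_m) T :
  vcont h1 -> vcont h2 ->
  (forall t, 0 <= t -> sqnorm (h1 t) <= C * sqnorm (h2 t)) -> energy h1 T <= C * energy h2 T.
Proof.
move=> c1 c2 H; have s1 := continuous_sqnorm c1; have s2 := continuous_sqnorm c2.
rewrite /energy -primZ //; apply: le_prim => //.
by move=> t; apply: cvgM; [exact: cvg_cst|exact: s2].
Qed.

Lemma vcont_sum (I : Type) (s : seq I) n (h : I -> R -> 'cV[R]_n) :
  (forall i, vcont (h i)) -> vcont (fun t => \sum_(i <- s) h i t).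
Proof.
move=> H k; have -> : (fun t => (\sum_(i <- s) h i t) k 0) = (fun t => \sum_(i <- s) h i t k 0).
  by apply/funext => t; rewrite summxE.
by apply: continuous_sumr => i _; exact: H.
Qed.

(** The number of agents is fixed, so a constant exponential in it is harmless. *)
Lemma sqnorm_sum_le (I : Type) (s : seq I) n (v : I -> 'cV[R]_n) :
  sqnorm (\sum_(i <- s) v i) <= 2 ^+ size s * \sum_(i <- s) sqnorm (v i).
Proof.
elim: s => [|i s IH]; first by rewrite !big_nil sqnorm0 mulr0.
rewrite !big_cons /= exprS; apply: le_trans (sqnormD_le _ _) _.
have p : (1 : R) <= 2 ^+ size s by rewrite exprn_ege1 // ler1n.
have := sqnorm_ge0 (v i); nra.
Qed.

Lemma vcont_linear m n (M : 'M[R]_(m, n)) (h : R -> 'cV[R]_n) : vcont h -> vcont (fun t => M *m h t).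
Proof.
move=> hc k; have -> : (fun t => (M *m h t) k 0) = (fun t => \sum_j M k j * h t j 0).
  by apply/funext => t; rewrite mxE.
by apply: continuous_sumr => j _ t; apply: cvgM; [exact: cvg_cst|exact: hc].
Qed.

Lemma state_mean_sqnorm N n : exists2 C : R, 0 <= C &
  forall v : 'I_N -> 'cV[R]_n, sqnorm (state_mean v) <= C * \sum_(i < N) sqnorm (v i).
Proof.
exists (N%:R^-1 ^+ 2 * 2 ^+ size (index_enum 'I_N)); first by rewrite mulr_ge0 // ?sqr_ge0 // exprn_ge0.
by move=> v; rewrite /state_mean sqnormZ -[leRHS]mulrA ler_wpM2l ?sqr_ge0 //; exact: sqnorm_sum_le.
Qed.

Lemma state_mean_vcont N n (x : 'I_N -> R -> 'cV[R]_n) : (forall i, vcont (x i)) ->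
  vcont (fun t => state_mean (fun i => x i t)).
Proof. by move=> xc; apply: vcontZ; [move=> t; exact: cvg_cst|exact: vcont_sum]. Qed.

Lemma state_meanD N n (v1 v2 : 'I_N -> 'cV[R]_n) :
  state_mean (fun i => v1 i + v2 i) = state_mean v1 + state_mean v2.
Proof. by rewrite /state_mean big_split scalerDr. Qed.

Lemma state_meanM N n (M : 'M[R]_n) (v : 'I_N -> 'cV[R]_n) :
  state_mean (fun i => M *m v i) = M *m state_mean v.
Proof. by rewrite /state_mean -scalemxAr mulmx_sumr. Qed.

Lemma state_mean_cst N n (v : 'cV[R]_n) : (0 < N)%N -> state_mean (fun _ : 'I_N => v) = v.
Proof.
move=> N0; rewrite /state_mean sumr_const card_ord -[v *+ _]scaler_nat scalerA mulVf ?scale1r //.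
by rewrite pnatr_eq0 -lt0n.
Qed.

Lemma eq_state_mean N n (v1 v2 : 'I_N -> 'cV[R]_n) : v1 =1 v2 -> state_mean v1 = state_mean v2.
Proof. by move=> E; rewrite /state_mean; congr (_ *: _); apply: eq_bigr => i _. Qed.

Lemma vsol_sum (I : Type) (s : seq I) n (y g : I -> R -> 'cV[R]_n) :
  (forall i, vsol (y i) (g i)) -> vsol (fun t => \sum_(i <- s) y i t) (fun t => \sum_(i <- s) g i t).
Proof.
move=> H; split; first by apply: vcont_sum => i; exact: (H i).1.
move=> t t0; apply: is_derive_mx => i j.
under eq_fun do rewrite summxE; rewrite summxE.
by apply: is_derive_sumr => k _; apply: is_derive_entry; exact: (H k).2.
Qed.

Lemma vsolZ n (a : R) (y g : R -> 'cV[R]_n) : vsol y g -> vsol (fun t => a *: y t) (fun t => a *: g t).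
Proof.
move=> [yc yd]; split; first by apply: vcontZ => // t; exact: cvg_cst.
move=> t t0; apply: is_derive_mx => i j.
under eq_fun do rewrite mxZE; rewrite mxZE.
have D := is_deriveZ a (is_derive_entry i j (yd t t0)).
exact: (is_derive_eq D).
Qed.

Lemma state_mean_vsol N n (y g : 'I_N -> R -> 'cV[R]_n) : (forall i, vsol (y i) (g i)) ->
  vsol (fun t => state_mean (fun i => y i t)) (fun t => state_mean (fun i => g i t)).
Proof. by move=> H; apply: vsolZ; exact: vsol_sum. Qed.

Lemma forced_energy n (rho : R) (M : 'M[R]_n) : hurwitz (M - (rho / 2)%:M) ->
  exists2 C : R, 0 <= C & forall (y h : R -> 'cV[R]_n) T, vcont h ->
    vsol y (fun t => M *m y t + h t) -> 0 <= T ->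
    energy (discount (- (rho / 2)) y) T
      <= C * (sqnorm (y 0) + energy (discount (- (rho / 2)) h) T).
Proof.
move=> hM; have [C [C0 H]] := hurwitz_energy hM; exists C; first exact: ltW.
move=> y h T hc ys T0.
have D := discount_vsol (- (rho / 2)) ys.
have {}D : vsol (discount (- (rho / 2)) y)
    (fun t => (M - (rho / 2)%:M) *m discount (- (rho / 2)) y t + discount (- (rho / 2)) h t).
  apply: eq_vsol D => t _; rewrite discountD discount_linear mulmxBl mul_scalar_mx scaleNr.
  by rewrite addrA [- _ + _]addrC.
have := H _ _ T (@discount_vcont _ _ (- (rho / 2)) _ hc) D T0.
rewrite /discount mulr0 expR0 scale1r -/(discount _ _).
by apply: le_trans; rewrite lerDr; exact: sqnorm_ge0.
Qed.

(** With y_i = x_i - z_i, the mean of the y_i is driven by M + G and forced by the mean of the z_i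
    and c alone, so it is bounded first. It then is a known forcing in the equation of each y_i,
    driven by M. *)
Lemma population_energy N n (rho : R) (M G : 'M[R]_n) : (0 < N)%N ->
  hurwitz (M - (rho / 2)%:M) -> hurwitz (M + G - (rho / 2)%:M) ->
  exists2 K : R, 0 <= K & forall (x z : 'I_N -> R -> 'cV[R]_n) (c : R -> 'cV[R]_n) T,
    (forall i, vcont (x i)) -> (forall i, vcont (z i)) -> vcont c -> (forall i, z i 0 = 0) ->
    (forall i, vsol (fun t => x i t - z i t)
       (fun t => M *m x i t + G *m state_mean (fun j => x j t) + c t)) -> 0 <= T ->
    forall i, energy (discount (- (rho / 2)) (x i)) T
      <= K * (\sum_(j < N) sqnorm (x j 0) + \sum_(j < N) energy (discount (- (rho / 2)) (z j)) T
              + energy (discount (- (rho / 2)) c) T).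
Proof.
move=> N0 hM hMG; set D := discount (- (rho / 2)).
have [C1 C10 H1] := forced_energy hM.
have [C2 C20 H2] := forced_energy hMG.
have [Cm Cm0 Hm] := state_mean_sqnorm N n.
have [F1 F10 HF1] := sqnorm_mulmx M.
have [F2 F20 HF2] := sqnorm_mulmx (M + G).
have [FG FG0 HFG] := sqnorm_mulmx G.
have lin := @vcont_linear n n.
(* Relative to the total b of the data, K1 bounds the mean of the y_i, 2 (K1 + Cm) the mean of the
   states, and K2 the forcing in the equation of one agent. *)
pose K1 := C2 * (Cm + 2 * (F2 * Cm + 1)).
pose K2 := 2 * (F1 + 2 * (FG * (2 * (K1 + Cm)) + 1)).
have K10 : 0 <= K1 by rewrite !(mulr_ge0, addr_ge0) // ltW.
have K20 : 0 <= K2 by rewrite !(mulr_ge0, addr_ge0) // ltW.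
exists (2 * (C1 * (1 + K2) + 1)); first by rewrite mulr_ge0 // addr_ge0 // mulr_ge0 // addr_ge0.
move=> x z c T xc zc cc z0 ys T0 i.
set S0 := \sum_j _; set SZ := \sum_j _; set EC := energy (D c) T.
have S00 : 0 <= S0 by apply: sumr_ge0 => j _; exact: sqnorm_ge0.
have SZ0 : 0 <= SZ by apply: sumr_ge0 => j _; exact: energy_ge0.
have EC0 : 0 <= EC by exact: energy_ge0.
pose b := S0 + SZ + EC; rewrite -/b.
have S0b : S0 <= b by rewrite /b -addrA lerDl addr_ge0.
have SZb : SZ <= b by rewrite /b addrAC lerDr addr_ge0.
have ECb : EC <= b by rewrite /b lerDr addr_ge0.
have Dc h : vcont h -> vcont (D h) by exact: discount_vcont.
have D_le (C : R) (h1 h2 : R -> 'cV[R]_n) : vcont h1 -> vcont h2 ->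
    (forall t, sqnorm (h1 t) <= C * sqnorm (h2 t)) -> energy (D h1) T <= C * energy (D h2) T.
  move=> c1 c2 H; apply: energy_le; [exact: Dc|exact: Dc|move=> t _].
  by rewrite !sqnorm_discount mulrCA ler_wpM2l // expR_ge0.
have D_add (h1 h2 : R -> 'cV[R]_n) : vcont h1 -> vcont h2 ->
    energy (D (fun t => h1 t + h2 t)) T <= 2 * (energy (D h1) T + energy (D h2) T).
  by move=> c1 c2; rewrite /D discountD; apply: energyD; exact: Dc.
pose y j t := x j t - z j t.
have yc j : vcont (y j) by apply: vcontD => //; exact: vcontN.
have xyz j t : x j t = y j t + z j t by rewrite /y subrK.
pose zm t := state_mean (fun j => z j t).
pose ym t := state_mean (fun j => y j t).
have zmc : vcont zm by exact: state_mean_vcont.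
have ymc : vcont ym by exact: state_mean_vcont.
have mE t : state_mean (fun j => x j t) = ym t + zm t.
  by rewrite -state_meanD; apply: eq_state_mean.
have ysm : vsol ym (fun t => (M + G) *m ym t + ((M + G) *m zm t + c t)).
  apply: eq_vsol (state_mean_vsol ys) => t _.
  rewrite (state_meanD (fun j => M *m x j t + _)) state_meanD !state_mean_cst // state_meanM mE.
  by rewrite addrA -mulmxDr mulmxDl.
have Ez : energy (D zm) T <= Cm * b.
  apply: (@le_trans _ _ (Cm * SZ)); last by rewrite ler_wpM2l.
  have zs j : continuous (fun t => sqnorm (D (z j) t)) by apply: continuous_sqnorm; exact: Dc.
  have zss : continuous (fun t => \sum_(j < N) sqnorm (D (z j) t)) by apply: continuous_sumr => j _.
  rewrite /SZ /energy -prim_sum // -primZ //; apply: le_prim.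
  - by apply: continuous_sqnorm; exact: Dc.
  - by move=> t; apply: cvgM; [exact: cvg_cst|exact: zss].
  move=> t _; rewrite sqnorm_discount; under eq_bigr do rewrite sqnorm_discount.
  rewrite -mulr_sumr [leRHS]mulrCA ler_wpM2l ?expR_ge0 //; exact: Hm.
have fc : vcont (fun t => (M + G) *m zm t + c t) by apply: vcontD => //; exact: vcont_linear.
have Ey : energy (D ym) T <= K1 * b.
  apply: le_trans (H2 _ _ T fc ysm T0) _; rewrite /K1 -mulrA ler_wpM2l //.
  have h1 : sqnorm (ym 0) <= Cm * b.
    apply: (@le_trans _ _ (Cm * S0)); last by rewrite ler_wpM2l.
    apply: le_trans (Hm _) _; rewrite ler_wpM2l // /S0 le_eqVlt; apply/orP; left; apply/eqP.
    by apply: eq_bigr => j _; rewrite /y z0 subr0.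
  have h2 := D_add _ _ (lin (M + G) _ zmc) cc.
  have h3 := D_le F2 _ _ (lin (M + G) _ zmc) zmc (fun t => HF2 (zm t)).
  have h4 : F2 * energy (D zm) T <= F2 * (Cm * b) by rewrite ler_wpM2l // ltW.
  rewrite mulrDl lerD //; apply: le_trans h2 _.
  rewrite -[leRHS]mulrA [(_ + 1) * b]mulrDl ler_wpM2l // mul1r lerD // -[leRHS]mulrA.
  exact: le_trans h3 h4.
pose m t := ym t + zm t.
have mc : vcont m by exact: vcontD.
have Em : energy (D m) T <= 2 * (K1 + Cm) * b.
  by apply: le_trans (D_add _ _ ymc zmc) _; rewrite -[leRHS]mulrA [(K1 + Cm) * b]mulrDl ler_wpM2l // lerD.
have gc : vcont (fun t => G *m m t + c t) by apply: vcontD => //; exact: vcont_linear.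
have Eg : energy (D (fun t => G *m m t + c t)) T <= 2 * (FG * (2 * (K1 + Cm)) + 1) * b.
  have h2 := D_add _ _ (lin G _ mc) cc.
  have h3 := D_le FG _ _ (lin G _ mc) mc (fun t => HFG (m t)).
  have h4 : FG * energy (D m) T <= FG * (2 * (K1 + Cm) * b) by rewrite ler_wpM2l // ltW.
  apply: le_trans h2 _; rewrite -[leRHS]mulrA [(_ + 1) * b]mulrDl ler_wpM2l // mul1r lerD // -[leRHS]mulrA.
  exact: le_trans h3 h4.
have Ezi : energy (D (z i)) T <= b.
  apply: le_trans SZb; rewrite /SZ (bigD1 i) //= lerDl.
  by apply: sumr_ge0 => j _; exact: energy_ge0.
have hc : vcont (fun t => M *m z i t + (G *m m t + c t)) by apply: vcontD => //; exact: vcont_linear.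
have Eh : energy (D (fun t => M *m z i t + (G *m m t + c t))) T <= K2 * b.
  have h2 := D_add _ _ (lin M _ (zc i)) gc.
  have h3 := D_le F1 _ _ (lin M _ (zc i)) (zc i) (fun t => HF1 (z i t)).
  have h4 : F1 * energy (D (z i)) T <= F1 * b by rewrite ler_wpM2l // ltW.
  apply: le_trans h2 _; rewrite /K2 -[leRHS]mulrA [(F1 + _) * b]mulrDl ler_wpM2l // lerD //.
  exact: le_trans h3 h4.
have ysi : vsol (y i) (fun t => M *m y i t + (M *m z i t + (G *m m t + c t))).
  apply: eq_vsol (ys i) => t _; rewrite mE addrA -mulmxDr -xyz addrA.
  by [].
have Eyi : energy (D (y i)) T <= C1 * (1 + K2) * b.
  apply: le_trans (H1 _ _ T hc ysi T0) _; rewrite -mulrA ler_wpM2l //.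
  have : sqnorm (y i 0) <= S0.
    rewrite /y z0 subr0 /S0 (bigD1 i) //= lerDl; apply: sumr_ge0 => j _; exact: sqnorm_ge0.
  move=> h; rewrite mulrDl mul1r lerD //; exact: le_trans h S0b.
have -> : x i = (fun t => y i t + z i t) by apply/funext => t.
apply: le_trans (D_add _ _ (yc i) (zc i)) _.
by rewrite -[leRHS]mulrA [(_ + 1) * b]mulrDl mul1r ler_wpM2l // lerD.
Qed.

End PopulationEnergy.

Section VectorProcesses.
Context {R : realType} {d : measure_display} {Om : measurableType d}.
Implicit Types (t T : R).
Notation mu := (@lebesgue_measure R).

Definition vprocess n (y : R -> Om -> 'cV[R]_n) := forall k, cprocess (fun t om => y t om k 0).

Lemma eq_cprocess (h1 h2 : R -> Om -> R) : (forall t om, h1 t om = h2 t om) -> cprocess h1 -> cprocess h2.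
Proof. by move=> E; congr cprocess; apply/funext => t; apply/funext => om. Qed.

Lemma vprocessD n (y1 y2 : R -> Om -> 'cV[R]_n) : vprocess y1 -> vprocess y2 ->
  vprocess (fun t om => y1 t om + y2 t om).
Proof. by move=> p1 p2 k; apply: eq_cprocess (cprocessD (p1 k) (p2 k)) => t om; rewrite mxDE. Qed.

Lemma vprocess_mulmx m n (M : 'M[R]_(m, n)) (y : R -> Om -> 'cV[R]_n) : vprocess y ->
  vprocess (fun t om => M *m y t om).
Proof.
move=> py k; apply: (@eq_cprocess (fun t om => \sum_j M k j * y t om j 0)) => [t om|]; first by rewrite mxE.
by apply: cprocess_sum => j; apply: cprocessM => //; exact: cprocess_cst.
Qed.

Lemma vprocessN n (y : R -> Om -> 'cV[R]_n) : vprocess y -> vprocess (fun t om => - y t om).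
Proof.
move=> py k; apply: eq_cprocess (cprocessB (cprocess_cst 0) (py k)) => t om.
by rewrite mxNE sub0r.
Qed.

Lemma vprocess_mean N n (y : 'I_N -> R -> Om -> 'cV[R]_n) : (forall i, vprocess (y i)) ->
  vprocess (fun t om => state_mean (fun i => y i t om)).
Proof.
move=> py k; apply: (@eq_cprocess (fun t om => N%:R^-1 * \sum_i y i t om k 0)) => [t om|].
  by rewrite /state_mean mxZE summxE.
by apply: cprocessM; [exact: cprocess_cst|apply: cprocess_sum => i; exact: py].
Qed.

Lemma vprocess_det n (f : R -> 'cV[R]_n) : {within `[0, +oo[, continuous f} -> vprocess (fun t _ => f t).
Proof.
by move=> /within_entry fc k; split=> // om; exact: fc.
Qed.

Lemma cprocess_sqnorm n (y : R -> Om -> 'cV[R]_n) : vprocess y -> cprocess (fun t om => sqnorm (y t om)).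
Proof.
move=> py; apply: (@eq_cprocess (fun t om => \sum_k y t om k 0 * y t om k 0)) => [t om|].
  by apply: eq_bigr => k _; rewrite expr2.
by apply: cprocess_sum => k; apply: cprocessM; exact: py.
Qed.

Lemma vprocess_prim n (y : R -> Om -> 'cV[R]_n) : vprocess y ->
  vprocess (fun t om => vprim (fun u => y (clamp u) om) t).
Proof.
move=> py k; apply: eq_cprocess (cprocess_prim (py k)) => t om.
by rewrite mxE.
Qed.

Lemma cprocess_exp (a : R) : cprocess (fun t (_ : Om) => expR (a * t)).
Proof. by apply: cprocess_det; apply: continuous_subspaceT; exact: continuous_expRM. Qed.

End VectorProcesses.

Section DiscountedNoise.
Context {R : realType}.
Notation mu := (@lebesgue_measure R).
Implicit Types (T : R).

(** Integration by parts, as the energy inequality for exp(- rho t) prim p / rho: a variance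
    accumulated up to t has finite discounted integral as soon as its rate has. *)
Lemma discounted_primitive (rho : R) (p : R -> R) T : 0 < rho -> continuous p ->
  (forall u, 0 <= u -> 0 <= p u) -> 0 <= T ->
  prim (fun t => expR (- rho * t) * prim p t) T <= rho^-1 * prim (fun t => expR (- rho * t) * p t) T.
Proof.
move=> rho0 pc p0 T0; have ec := @continuous_expRM R (- rho).
have Pc := prim_continuous pc.
have eP : continuous (fun t => expR (- rho * t) * prim p t).
  by move=> t; apply: cvgM; [exact: ec|exact: Pc].
have ep : continuous (fun t => expR (- rho * t) * p t).
  by move=> t; apply: cvgM; [exact: ec|exact: pc].
have := @energy_integral R (fun t => rho^-1 * (expR (- rho * t) * prim p t))
  (fun t => rho^-1 * (expR (- rho * t) * p t) - expR (- rho * t) * prim p t)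
  (fun t => expR (- rho * t) * prim p t) (fun t => rho^-1 * (expR (- rho * t) * p t)) T.
rewrite prim0 !mulr0 add0r primZ // => H.
suff : rho^-1 * (expR (- rho * T) * prim p T) + prim (fun t => expR (- rho * t) * prim p t) T
    <= rho^-1 * prim (fun t => expR (- rho * t) * p t) T.
  apply: le_trans; rewrite lerDr mulr_ge0 ?invr_ge0 ?(ltW rho0) // mulr_ge0 ?expR_ge0 //.
  exact: prim_ge0.
apply: (H _ eP _ _ (fun t _ => lexx _) T0).
- by move=> t; apply: cvgM; [exact: cvg_cst|exact: eP].
- by move=> t; apply: cvgM; [exact: cvg_cst|exact: ep].
- move=> t t0.
  have D := is_deriveZ rho^-1 (is_deriveM (is_derive_expRM (- rho) t) (prim_derive pc t0)).
  apply: (is_derive_eq D); rewrite /GRing.scale /=; field; exact: lt0r_neq0.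
Qed.

Lemma ge0_integral_lee (p : R -> R) (K : \bar R) : continuous p -> (forall u, 0 <= u -> 0 <= p u) ->
  (forall T, (0 <= T)%R -> (prim p T)%:E <= K)%E ->
  (\int[mu]_(u in `[0%R, +oo[) (p u)%:E <= K)%E.
Proof.
move=> pc p0; case: K => [K|_|/(_ 0 (lexx 0))] //; last by rewrite leey.
by move=> H; apply: ge0_integral_le => // T T0; have := H T T0; rewrite lee_fin.
Qed.

End DiscountedNoise.

Section StochasticCost.
Context {R : realType} {N n r : nat} (rho : R) (A G : 'M[R]_n) (B : 'M[R]_(n, r)) (Rm : 'M[R]_r)
  (P Pi : 'M[R]_n) (xbar s f sg : R -> 'cV[R]_n).
Context {d : measure_display} {Om : measurableType d} (Pr : probability Om R).
Variables (W : 'I_N -> R -> Om -> R) (x : 'I_N -> R -> Om -> 'cV[R]_n) (C0 : R).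
Notation mu := (@lebesgue_measure R).
Notation u := (feedback B Rm P Pi xbar s).
Notation M := (Abar A B Rm P).
Notation D := (discount (- (rho / 2))).
Hypotheses (N0 : (0 < N)%N) (rho0 : 0 < rho).
Hypotheses (fC : Crho rho f) (sgC : Crho rho sg) (sC : Crho rho s) (xbarC : Crho rho xbar).
Hypotheses (hM : hurwitz (M - (rho / 2)%:M)) (hMG : hurwitz (M + G - (rho / 2)%:M)).
Hypothesis bmW : forall i, brownian_motion Pr (W i).
Hypothesis sol : sde_sol Pr W sg (closed_loop_drift A G B f u) x.
Hypothesis x0E : forall i, ('E_Pr[fun om => sqnorm (x i 0 om)] < C0%:E)%E.

Definition drift_offset (t : R) : 'cV[R]_n :=
  f t - B *m (invmx Rm *m B^T *m ((Pi - P) *m xbar t + s t)).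

Lemma closed_loop_driftE i t (v : 'I_N -> 'cV[R]_n) :
  closed_loop_drift A G B f u i t v = M *m v i + G *m state_mean v + drift_offset t.
Proof.
rewrite /closed_loop_drift /feedback /drift_offset /Abar.
rewrite -[P *m v i + _ + _]addrA [invmx Rm *m B^T *m (P *m v i + _)]mulmxDr.
rewrite mulmxN mulmxDr opprD !mulmxA [(A - _) *m v i]mulmxBl.
set a := A *m v i; set b := - (B *m invmx Rm *m B^T *m P *m v i).
set c := - (_ *m (_ + s t)); set g := G *m _.
by clearbody a b c g; apply/matrixP => k l; rewrite !mxDE; ring.
Qed.

Lemma drift_offset_continuous : {within `[0, +oo[, continuous drift_offset}.
Proof.
have [fc _] := fC; have [sc _] := sC; have [xc _] := xbarC.
apply/vcont_clamp; apply: vcontD; first exact/vcont_clamp.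
apply: vcontN; rewrite (_ : (fun t => _) = (fun t => (B *m (invmx Rm *m B^T)) *m ((Pi - P) *m xbar (clamp t) + s (clamp t)))); last first.
  by apply/funext => t; rewrite mulmxA.
apply: vcont_mulmx => [i j t|]; first exact: cvg_cst.
apply: vcontD; last exact/vcont_clamp.
apply: vcont_mulmx => [i j t|]; first exact: cvg_cst.
exact/vcont_clamp.
Qed.

Lemma Crho_energy (g : R -> 'cV[R]_n) : Crho rho g ->
  exists2 K, 0 <= K & forall T, 0 <= T -> energy (D (fun t => g (clamp t))) T <= K.
Proof.
move=> /CrhoP[_ [K HK]]; exists K => //.
by apply: le_trans (HK 0 (lexx 0)); exact: energy_ge0.
Qed.

Let vc (g : R -> 'cV[R]_n) : Crho rho g -> vcont (fun t => g (clamp t)).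
Proof. by case=> gc _; exact/vcont_clamp. Qed.

Let Dc (g : R -> 'cV[R]_n) : vcont g -> vcont (D g).
Proof. exact: discount_vcont. Qed.

Let D_le m (C : R) (h1 : R -> 'cV[R]_m) (h2 : R -> 'cV[R]_n) T : vcont h1 -> vcont h2 ->
  (forall t, sqnorm (h1 t) <= C * sqnorm (h2 t)) ->
  energy (discount (- (rho / 2)) h1) T <= C * energy (D h2) T.
Proof.
move=> c1 c2 H; apply: energy_le; [exact: discount_vcont|exact: Dc|move=> t _].
by rewrite !sqnorm_discount mulrCA ler_wpM2l // expR_ge0.
Qed.

Let D_add (h1 h2 : R -> 'cV[R]_n) T : vcont h1 -> vcont h2 ->
  energy (D (fun t => h1 t + h2 t)) T <= 2 * (energy (D h1) T + energy (D h2) T).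
Proof. by move=> c1 c2; rewrite discountD; apply: energyD; exact: Dc. Qed.

Lemma drift_offset_energy :
  exists2 K, 0 <= K & forall T, 0 <= T -> energy (D (fun t => drift_offset (clamp t))) T <= K.
Proof.
have [Kf Kf0 Hf] := Crho_energy fC; have [Ks Ks0 Hs] := Crho_energy sC.
have [Kx Kx0 Hx] := Crho_energy xbarC.
have [F1 F10 HF1] := sqnorm_mulmx (- (B *m (invmx Rm *m B^T))).
have [F2 F20 HF2] := sqnorm_mulmx (Pi - P).
exists (2 * (Kf + F1 * (2 * (F2 * Kx + Ks)))).
  by rewrite !(mulr_ge0, addr_ge0) // ltW.
move=> T T0.
pose q t := (Pi - P) *m xbar (clamp t) + s (clamp t).
have pc : vcont (fun t => (Pi - P) *m xbar (clamp t)) by apply: vcont_linear; exact: vc.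
have qc : vcont q by apply: vcontD => //; exact: vc.
have -> : (fun t => drift_offset (clamp t)) = (fun t => f (clamp t) + (- (B *m (invmx Rm *m B^T))) *m q t).
  by apply/funext => t; rewrite /drift_offset mulNmx /q !mulmxA.
apply: le_trans (D_add _ (vc fC) (vcont_linear qc)) _.
rewrite ler_wpM2l // lerD ?Hf //.
apply: le_trans (D_le T (vcont_linear qc) qc (fun t => HF1 (q t))) _.
rewrite ler_wpM2l ?(ltW F10) //.
apply: le_trans (D_add _ pc (vc sC)) _.
rewrite ler_wpM2l // lerD ?Hs //.
apply: le_trans (D_le T pc (vc xbarC) (fun t => HF2 (xbar (clamp t)))) _.
by rewrite ler_wpM2l ?(ltW F20) // Hx.
Qed.

Let xproc i : vprocess (x i).
Proof.
case: sol => mx cx _ k; split=> [om|t t0]; last exact: mx.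
by have /within_entry := cx i om; apply.
Qed.

Definition closed_drift i t om := closed_loop_drift A G B f u i t (fun j => x j t om).

Lemma closed_drift_process i : vprocess (closed_drift i).
Proof.
have H : vprocess (fun t om => M *m x i t om + G *m state_mean (fun j => x j t om) + drift_offset t).
  apply: vprocessD; last by apply: vprocess_det; exact: drift_offset_continuous.
  by apply: vprocessD; apply: vprocess_mulmx => //; exact: vprocess_mean.
by move=> k; apply: eq_cprocess (H k) => t om; rewrite /closed_drift closed_loop_driftE.
Qed.

(** The residual of the state equation, defined at every outcome. Continuity and measurability come
    from the state; the Wiener integrals [Z] of [sde_sol], equal to it only almost surely, enter
    through second moments. *)
Definition noise i t om : 'cV[R]_n :=
  x i (clamp t) om - x i 0 om - vprim (fun tau => closed_drift i (clamp tau) om) t.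

Lemma noise_process i : vprocess (noise i).
Proof.
apply: vprocessD; last by apply: vprocessN; apply: vprocess_prim; exact: closed_drift_process.
apply: vprocessD; last first.
  by move=> k; apply: cprocess_rv; rewrite (_ : (fun om => _) = (fun om => - x i 0 om k 0)); [apply: measurable_funN; exact: (xproc i k).2|apply/funext => om; rewrite mxNE].
move=> k; split=> [om|t t0]; last by rewrite clamp_id //; exact: (xproc i k).2.
by rewrite (_ : (fun t => _) = (fun t => x i (clamp t) om k 0)); [exact: (xproc i k).1|apply/funext => t; rewrite (clamp_id (clamp_ge0 t))].
Qed.

Lemma noise_second_moment i t k : 0 <= t ->
  (\int[Pr]_om (noise i t om k 0 ^+ 2)%:E <= (4 * prim (fun tau => sg (clamp tau) k 0 ^+ 2) t)%:E)%E.
Proof.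
move=> t0; case: sol => mx cx [Z [wZ aeZ]].
have gc : {within `[0, +oo[, continuous (fun t => sg t k 0)}.
  by apply/within_clamp; have [/within_entry H _] := sgC; exact: H.
have := wiener_integral_energy (bmW i) gc (wZ i k) t0.
apply: le_trans; rewrite le_eqVlt; apply/orP; left; apply/eqP.
have [mZ _] := wZ i k t t0.
apply: ge0_ae_eq_integral => //.
- by apply/measurable_EFinP; apply: measurable_sqr; exact: (noise_process i k).2.
- by apply/measurable_EFinP; apply: measurable_sqr.
- by move=> om _; rewrite lee_fin sqr_ge0.
- by move=> om _; rewrite lee_fin sqr_ge0.
apply: filterS aeZ => om /(_ i k t t0) H _; congr ((_ ^+ 2)%:E).
rewrite /noise !mxBE clamp_id // H mxE.
rewrite (_ : prim _ t = \int[mu]_(tau in `[0, t]) (closed_loop_drift A G B f u i tau (fun j => x j tau om)) k 0).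
  by ring.
by apply: (@eq_prim R) => tau tau0; rewrite clamp_id.
Qed.

Let noise_energy i : R -> Om -> R := fun t om => expR (- rho * t) * sqnorm (noise i t om).

Lemma noise_energy_process i : cprocess (noise_energy i).
Proof.
by apply: cprocessM; [exact: cprocess_exp|apply: cprocess_sqnorm; exact: noise_process].
Qed.

Lemma noise_energy_ge0 i t om : 0 <= noise_energy i t om.
Proof. by rewrite mulr_ge0 ?expR_ge0 // sqnorm_ge0. Qed.

(** By Tonelli this is a discounted time integral of second moments, each at most 4 times the
    primitive of |sg|^2; [discounted_primitive] reduces it to the discounted energy of sg. *)
Lemma expected_noise_energy i :
  (\int[Pr]_om \int[mu]_(t in `[0%R, +oo[) (noise_energy i t om)%:E < +oo)%E.
Proof.
have D0 (t : R) : `[0, +oo[%classic t -> 0 <= t by rewrite /= in_itv /= andbT.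
rewrite (tonelli_time_integral (noise_energy_process i) (fun t om _ => noise_energy_ge0 i t om) _ D0) //.
have [Ksg Ksg0 Hsg] := Crho_energy sgC.
pose p t := sqnorm (sg (clamp t)).
have pc : continuous p by apply: continuous_sqnorm; exact: vc.
have p0 t : 0 <= t -> 0 <= p t by move=> _; exact: sqnorm_ge0.
pose q t := 4 * (expR (- rho * t) * prim p t).
have qc : continuous q.
  move=> t; apply: cvgM; first exact: cvg_cst.
  by apply: cvgM; [exact: continuous_expRM|exact: prim_continuous].
have q0 t : 0 <= q t.
  by rewrite !mulr_ge0 ?expR_ge0 //; exact: prim_ge0.
have Eq t : 0 <= t -> (\int[Pr]_om (noise_energy i t om)%:E <= (q t)%:E)%E.
  move=> t0; rewrite /noise_energy; under eq_integral do rewrite EFinM.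
  have mk k : measurable_fun setT (fun om => (noise i t om k 0 ^+ 2)%:E).
    by apply/measurable_EFinP; apply: measurable_sqr; exact: (noise_process i k).2.
  rewrite ge0_integralZl; [|by []| | |]; first last.
  - by rewrite lee_fin expR_ge0.
  - by move=> om _; rewrite lee_fin sqnorm_ge0.
  - by apply/measurable_EFinP; exact: (cprocess_sqnorm (noise_process i)).2.
  rewrite /q mulrCA EFinM lee_wpmul2l ?lee_fin ?expR_ge0 //.
  under eq_integral do rewrite -sumEFin.
  rewrite ge0_integral_sum //; last by move=> k om _; rewrite lee_fin sqr_ge0.
  apply: le_trans (lee_sum _ (fun k _ => noise_second_moment i k t0)) _.
  rewrite sumEFin -mulr_sumr lee_fin ler_wpM2l // /p -prim_sum //.
  move=> k u; apply: cvgM; exact: (vc sgC).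
apply: (@le_lt_trans _ _ (\int[mu]_(t in `[0%R, +oo[) (q t)%:E)%E).
  apply: ge0_le_integral => //.
  - by move=> t _; apply: integral_ge0 => om _; rewrite lee_fin noise_energy_ge0.
  - apply: (measurable_expectation (noise_energy_process i)) => // t om _; exact: noise_energy_ge0.
  - exact: measurable_continuous.
  - by move=> t /D0; exact: Eq.
apply: le_lt_trans (ltry (4 * (rho^-1 * Ksg))).
apply: ge0_integral_le => // T T0.
rewrite primZ; last by move=> t; apply: cvgM; [exact: continuous_expRM|exact: prim_continuous].
rewrite ler_wpM2l //; apply: le_trans (discounted_primitive rho0 pc p0 T0) _.
rewrite ler_wpM2l ?invr_ge0 ?(ltW rho0) //; apply: le_trans (Hsg T T0).
rewrite le_eqVlt; apply/orP; left; apply/eqP; apply: eq_prim => t _.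
by rewrite sqnorm_discount.
Qed.

Lemma feedback_bound : exists2 C : R, 0 <= C & forall t (v : 'cV[R]_n),
  sqnorm (u t v) <= C * (sqnorm v + (sqnorm (xbar t) + sqnorm (s t))).
Proof.
have [F0 F00 H0] := sqnorm_mulmx (- (invmx Rm *m B^T)).
have [F1 F10 H1] := sqnorm_mulmx P.
have [F2 F20 H2] := sqnorm_mulmx (Pi - P).
exists (F0 * (4 * (F1 + F2 + 1))); first by rewrite !(mulr_ge0, addr_ge0) // ltW.
move=> t v; rewrite /feedback -mulNmx; apply: le_trans (H0 _) _.
rewrite -mulrA ler_wpM2l ?(ltW F00) //.
apply: le_trans (sqnormD_le _ _) _.
have h := sqnormD_le (P *m v) ((Pi - P) *m xbar t).
have h1 := H1 v; have h2 := H2 (xbar t).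
have s0 : 0 <= sqnorm (s t) by exact: sqnorm_ge0.
have m1 : 0 <= F1 * (sqnorm (xbar t) + sqnorm (s t)) by rewrite mulr_ge0 ?(ltW F10) ?addr_ge0 ?sqnorm_ge0.
have m2 : 0 <= F2 * (sqnorm v + sqnorm (s t)) by rewrite mulr_ge0 ?(ltW F20) ?addr_ge0 ?sqnorm_ge0.
have v0 := sqnorm_ge0 v; have x0 := sqnorm_ge0 (xbar t).
by lra.
Qed.

(** The bound holds outcome by outcome with a deterministic K, so expectations remain to be taken
    only of initial and noise energies. *)
Lemma agent_cost_bound : exists2 K : R, 0 <= K & forall i om,
  (\int[mu]_(t in `[0%R, +oo[)
     (expR (- rho * t) * (sqnorm (x i t om) + sqnorm (u t (x i t om))))%:E
   <= K%:E * (1 + \sum_(j < N) ((sqnorm (x j 0 om))%:E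
                  + \int[mu]_(t in `[0%R, +oo[) (noise_energy j t om)%:E)))%E.
Proof.
have [C C00 HC] := feedback_bound.
have [K K0 HK] := population_energy N0 hM hMG.
have [Kd Kd0 Hd] := drift_offset_energy.
have [Kx Kx0 Hx] := Crho_energy xbarC.
have [Ks Ks0 Hs] := Crho_energy sC.
(* The first part comes from the states, the offset energy Kd being charged to the summand 1 of the
   bound; the second from xbar and s in the feedback. *)
pose K1 := (1 + C) * K * (1 + Kd) + C * (Kx + Ks).
have K10 : 0 <= K1 by rewrite !(mulr_ge0, addr_ge0).
exists K1 => //.
move=> i om.
have xc j : vcont (fun t => x j (clamp t) om).
  by move=> k; have [H _] := xproc j k; exact: H.
have dc j : vcont (fun t => closed_drift j (clamp t) om).
  by move=> k; have [H _] := closed_drift_process j k; exact: H.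
have nE j t : noise j (clamp t) om = noise j t om.
  rewrite /noise (clamp_id (clamp_ge0 t)); congr (_ - _); apply/matrixP => k l; rewrite !mxE.
  by have [t0|t0] := leP 0 t; [rewrite clamp_id|rewrite !prim_le0 ?(ltW t0) // clamp_le0 // ltW].
have nc j : vcont (fun t => noise j t om).
  move=> k; have [H _] := noise_process j k.
  by rewrite (_ : (fun t => _) = (fun t => noise j (clamp t) om k 0)); [exact: H|apply/funext => t; rewrite nE].
have n0 j : noise j 0 om = 0.
  rewrite /noise clamp_le0 // subrr sub0r (_ : vprim _ 0 = 0) ?oppr0 //.
  by apply/matrixP => k l; rewrite !mxE prim0.
have offc : vcont (fun t => drift_offset (clamp t)).
  by apply/vcont_clamp; exact: drift_offset_continuous.
have ys j : vsol (fun t => x j (clamp t) om - noise j t om)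
    (fun t => M *m x j (clamp t) om + G *m state_mean (fun k => x k (clamp t) om) + drift_offset (clamp t)).
  have [vpc vpd] := vprim_sol (dc j).
  have E : (fun t => x j (clamp t) om - noise j t om) =
      (fun t => x j 0 om + vprim (fun tau => closed_drift j (clamp tau) om) t).
    by apply/funext => t; rewrite /noise; apply/matrixP => k l; rewrite !mxDE !mxNE !mxDE !mxNE; ring.
  rewrite E; apply: (@eq_vsol _ _ _ (fun t => 0 + closed_drift j (clamp t) om)).
    by move=> t t0; rewrite add0r /closed_drift closed_loop_driftE.
  split; first by apply: vcontD => //; exact: vcont_cst.
  by move=> t t0; apply: is_deriveD; exact: vpd.
pose p t := expR (- rho * t) * (sqnorm (x i (clamp t) om) + sqnorm (u (clamp t) (x i (clamp t) om))).
have uc : vcont (fun t => u (clamp t) (x i (clamp t) om)).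
  rewrite /feedback; apply: vcontN; apply: vcont_linear.
  apply: vcontD; last exact: (vc sC).
  by apply: vcontD; apply: vcont_linear => //; exact: (vc xbarC).
have sx := continuous_sqnorm (xc i); have su := continuous_sqnorm uc.
have pc : continuous p.
  move=> t; apply: cvgM; first exact: continuous_expRM.
  by apply: cvgD; [exact: sx|exact: su].
have p0 t : 0 <= p t by rewrite mulr_ge0 ?expR_ge0 // addr_ge0 // sqnorm_ge0.
have -> : (\int[mu]_(t in `[0%R, +oo[)
     (expR (- rho * t) * (sqnorm (x i t om) + sqnorm (u t (x i t om))))%:E
   = \int[mu]_(t in `[0%R, +oo[) (p t)%:E)%E.
  by apply: eq_integral => t; rewrite inE /= in_itv /= andbT => t0; rewrite /p clamp_id.
apply: ge0_integral_lee => // T T0.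
pose ex := energy (D (fun t => x i (clamp t) om)) T.
pose eb := energy (D (fun t => xbar (clamp t))) T; pose es := energy (D (fun t => s (clamp t))) T.
have Dsx : continuous (fun t => sqnorm (D (fun t => x i (clamp t) om) t)).
  by apply: continuous_sqnorm; exact: Dc.
have Dsb : continuous (fun t => sqnorm (D (fun t => xbar (clamp t)) t)).
  by apply: continuous_sqnorm; apply: Dc; exact: (vc xbarC).
have Dss : continuous (fun t => sqnorm (D (fun t => s (clamp t)) t)).
  by apply: continuous_sqnorm; apply: Dc; exact: (vc sC).
have cM (a : R) (h : R -> R) : continuous h -> continuous (fun t => a * h t).
  by move=> hc t; apply: cvgM; [exact: cvg_cst|exact: hc].
have cD (h1 h2 : R -> R) : continuous h1 -> continuous h2 -> continuous (fun t => h1 t + h2 t).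
  by move=> hc1 hc2 t; apply: cvgD; [exact: hc1|exact: hc2].
have H1 : prim p T <= (1 + C) * ex + C * (eb + es).
  rewrite [leRHS](_ : _ = prim (fun t => (1 + C) * sqnorm (D (fun t => x i (clamp t) om) t)
      + C * (sqnorm (D (fun t => xbar (clamp t)) t) + sqnorm (D (fun t => s (clamp t)) t))) T); last first.
    rewrite primD; [|exact: cM|by apply: cM; exact: cD].
    by rewrite primZ // (primZ _ _ (cD _ _ Dsb Dss)) primD.
  apply: le_prim => //.
    exact: (cD _ _ (cM _ _ Dsx) (cM _ _ (cD _ _ Dsb Dss))).
  move=> t _; rewrite !sqnorm_discount /p.
  have -> : (1 + C) * (expR (- rho * t) * sqnorm (x i (clamp t) om)) +
    C * (expR (- rho * t) * sqnorm (xbar (clamp t)) + expR (- rho * t) * sqnorm (s (clamp t)))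
    = expR (- rho * t) * (sqnorm (x i (clamp t) om) + C * (sqnorm (x i (clamp t) om) + (sqnorm (xbar (clamp t)) + sqnorm (s (clamp t))))) by ring.
  by rewrite ler_wpM2l ?expR_ge0 // lerD2l; exact: HC.
pose S0 := \sum_(j < N) sqnorm (x j 0 om).
pose SZ := \sum_(j < N) energy (D (fun t => noise j t om)) T.
have H2 : ex <= K * (S0 + SZ + Kd).
  have := HK _ _ _ T xc nc offc n0 ys T0 i.
  rewrite -/ex; under eq_bigr do rewrite clamp_le0 //.
  move/le_trans; apply; rewrite ler_wpM2l // lerD2l; exact: Hd.
have S00 : 0 <= S0 by apply: sumr_ge0 => j _; exact: sqnorm_ge0.
have SZ0 : 0 <= SZ by apply: sumr_ge0 => j _; exact: energy_ge0.
have H3 : prim p T <= K1 * (1 + (S0 + SZ)).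
  have b0 : 0 <= S0 + SZ by rewrite addr_ge0.
  have C1 : 0 <= 1 + C by rewrite addr_ge0.
  apply: le_trans H1 _; rewrite /K1 [leRHS]mulrDl; apply: lerD.
    rewrite -!mulrA ler_wpM2l //; apply: le_trans H2 _; rewrite ler_wpM2l //.
    rewrite [leRHS]mulrDl mul1r; apply: (@le_trans _ _ (1 + (S0 + SZ) + Kd * 1)).
      by rewrite mulr1 lerD2r lerDr.
    by rewrite lerD2l ler_wpM2l // lerDl.
  rewrite -mulrA ler_wpM2l //; apply: (@le_trans _ _ (Kx + Ks)).
    by apply: lerD; [exact: Hx|exact: Hs].
  by rewrite ler_peMr ?addr_ge0 // lerDl.
have H4 : (SZ%:E <= \sum_(j < N) \int[mu]_(t in `[0%R, +oo[) (noise_energy j t om)%:E)%E.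
  rewrite -sumEFin; apply: lee_sum => j _.
  have ec : continuous (fun t => sqnorm (D (fun t => noise j t om) t)) by apply: continuous_sqnorm; exact: Dc.
  rewrite /energy -prim_ereal //; last by move=> t _; exact: sqnorm_ge0.
  rewrite [leRHS](_ : _ = (\int[mu]_(t in `[0%R, +oo[) (sqnorm (D (fun t => noise j t om) t))%:E)%E); last first.
    by apply: eq_integral => t _; rewrite sqnorm_discount.
  apply: ge0_subset_integral => //.
  - exact: measurable_continuous.
  - by move=> t _; rewrite lee_fin sqnorm_ge0.
  - by move=> t /=; rewrite !in_itv /= => /andP[->].
apply: (@le_trans _ _ (K1 * (1 + (S0 + SZ)))%:E); first by rewrite lee_fin.
rewrite EFinM; apply: lee_wpmul2l; first by rewrite lee_fin.
rewrite big_split /= EFinD leeD // EFinD leeD //.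
by rewrite sumEFin.
Qed.

Theorem stable_total_cost : (total_cost rho Pr u x < +oo)%E.
Proof.
have [K K0 HK] := agent_cost_bound.
rewrite /total_cost; apply/lte_sum_pinfty => i _.
have D0 (t : R) : `[0, +oo[%classic t -> 0 <= t by rewrite /= in_itv /= andbT.
have pu : vprocess (fun t om => u t (x i t om)).
  apply: vprocessN; apply: vprocess_mulmx; apply: vprocessD; last by apply: vprocess_det; have [] := sC.
  apply: vprocessD; apply: vprocess_mulmx => //.
  by apply: vprocess_det; have [] := xbarC.
have pp : cprocess (fun t om => expR (- rho * t) * (sqnorm (x i t om) + sqnorm (u t (x i t om)))).
  apply: cprocessM; first exact: cprocess_exp.
  by apply: cprocessD; apply: cprocess_sqnorm.
have mN j : measurable_fun setT (fun om => \int[mu]_(t in `[0%R, +oo[) (noise_energy j t om)%:E)%E.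
  apply: (measurable_time_integral (noise_energy_process j)) => // t om _.
  exact: noise_energy_ge0.
have mx j : measurable_fun setT (fun om => (sqnorm (x j 0 om))%:E).
  apply/measurable_EFinP; apply: (cprocess_sqnorm _).2 => //; exact: xproc.
have N_ge0 j om : (0 <= \int[mu]_(t in `[0%R, +oo[) (noise_energy j t om)%:E)%E.
  by apply: integral_ge0 => t _; rewrite lee_fin noise_energy_ge0.
have x_ge0 j om : (0 <= (sqnorm (x j 0 om))%:E)%E by rewrite lee_fin sqnorm_ge0.
have mj j : measurable_fun setT (fun om => (sqnorm (x j 0 om))%:E
    + \int[mu]_(t in `[0%R, +oo[) (noise_energy j t om)%:E)%E by apply: emeasurable_funD.
have j_ge0 j om : (0 <= (sqnorm (x j 0 om))%:E
    + \int[mu]_(t in `[0%R, +oo[) (noise_energy j t om)%:E)%E by apply: adde_ge0.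
have msum : measurable_fun setT (fun om => \sum_(j < N) ((sqnorm (x j 0 om))%:E
    + \int[mu]_(t in `[0%R, +oo[) (noise_energy j t om)%:E))%E by apply: emeasurable_sum.
have sum_ge0 om : (0 <= \sum_(j < N) ((sqnorm (x j 0 om))%:E
    + \int[mu]_(t in `[0%R, +oo[) (noise_energy j t om)%:E))%E by apply: sume_ge0.
apply: (@le_lt_trans _ _ (\int[Pr]_om (K%:E * (1 + \sum_(j < N) ((sqnorm (x j 0 om))%:E
                  + \int[mu]_(t in `[0%R, +oo[) (noise_energy j t om)%:E))))%E).
  apply: ge0_le_integral => //.
  - move=> om _; apply: integral_ge0 => t _; rewrite lee_fin mulr_ge0 ?expR_ge0 //.
    by rewrite addr_ge0 // sqnorm_ge0.
  - apply: (measurable_time_integral pp) => // t om _.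
    by rewrite mulr_ge0 ?expR_ge0 // addr_ge0 // sqnorm_ge0.
  - by apply: measurable_funeM; exact: emeasurable_funD.
rewrite ge0_integralZl //; last 2 first.
- exact: emeasurable_funD.
- by move=> om _; apply: adde_ge0.
rewrite ge0_integralD //.
apply: lte_mul_pinfty; rewrite ?lee_fin //.
rewrite lte_add_pinfty //.
  by rewrite (integral_cst _ measurableT (1%:E)) mul1e [X in (X < _)%E]probability_setT ltry.
rewrite ge0_integral_sum //; apply/lte_sum_pinfty => j _.
rewrite ge0_integralD // lte_add_pinfty //; last exact: expected_noise_energy.
have := x0E j; rewrite unlock => /lt_trans; apply; exact: ltry.
Qed.

End StochasticCost.

Section Pullback.
Context {R : realType} {d d' : measure_display} {Om : measurableType d} {Om' : measurableType d'}.
Variables (Pr : probability Om R) (Pr' : probability Om' R) (phi : Om' -> Om).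
Hypotheses (mphi : measurable_fun setT phi)
  (phiP : forall E, measurable E -> Pr' (phi @^-1` E) = Pr E).

Lemma sigma_of_measurable (J : Type) (D : set J) (X : J -> Om -> R) E :
  (forall j, D j -> measurable_fun setT (X j)) -> sigma_of D X E -> measurable E.
Proof.
move=> mX; apply: smallest_sub; first exact: sigma_algebra_measurable.
by move=> A [j Dj [B mB ->]]; rewrite -[X in measurable X]setTI; exact: mX.
Qed.

(** Preimages of the members of a sigma-algebra form a sigma-algebra that contains the generators.
    Stated for bare types, it serves both the projection to [Om] and the one to the coin. *)
Lemma sigma_of_comp (T T' : Type) (psi : T' -> T) (J : Type) (D : set J) (X : J -> T -> R) E :
  <<s [set E | exists2 j, D j & exists2 B, measurable B & E = (fun om => X j (psi om)) @^-1` B] >> E ->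
  exists2 A, <<s [set E | exists2 j, D j & exists2 B, measurable B & E = X j @^-1` B] >> A & E = psi @^-1` A.
Proof.
pose H := <<s [set E | exists2 j, D j & exists2 B, measurable B & E = X j @^-1` B] >>.
have [H0 HC HU] : sigma_algebra setT H by exact: smallest_sigma_algebra.
apply: (@smallest_sub _ _ _ [set E | exists2 A, H A & E = psi @^-1` A]); last first.
  move=> A [j Dj [B mB ->]]; exists (X j @^-1` B) => //.
  by apply: sub_sigma_algebra; exists j => //; exists B.
split.
- by exists set0.
- move=> A [A' HA ->]; exists (setT `\` A'); first exact: HC.
  by [].
- move=> A HA; have [F /all_and2[HF FE]] := choice (fun k => (exists2P _ _).1 (HA k)).
  exists (\bigcup_k F k); first exact: HU.
  by rewrite preimage_bigcup; apply: eq_bigcupr => k _; exact: FE.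
Qed.

Lemma sigma_of_pullback (J : Type) (D : set J) (X : J -> Om -> R) E :
  sigma_of D (fun j om => X j (phi om)) E -> exists2 A, sigma_of D X A & E = phi @^-1` A.
Proof. exact: sigma_of_comp. Qed.

Lemma brownian_motion_pullback w : brownian_motion Pr w ->
  brownian_motion Pr' (fun t om => w t (phi om)).
Proof.
move=> [mw w0 law ind wc].
have minc s t : 0 <= s -> 0 <= t -> measurable_fun setT (fun om => w t om - w s om).
  by move=> s0 t0; apply: measurable_funB; exact: mw.
split=> //.
- by move=> t t0; exact: measurableT_comp (mw t t0) mphi.
- have [A [mA A0 AH]] := w0.
  exists (phi @^-1` A); split; first by rewrite -[X in measurable X]setTI; exact: mphi.
    by rewrite phiP.
  by move=> om H; apply: AH.
- move=> s t s0 st E mE; rewrite -(law s t s0 st E mE) -phiP //.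
  have := minc s t s0 (ltW (le_lt_trans s0 st)) measurableT E mE.
  by rewrite setTI.
- move=> s t s0 st E E' HE HE'.
  have [A HA ->] := sigma_of_pullback HE.
  have [A' HA' ->] := @sigma_of_pullback unit setT (fun _ om => w t om - w s om) _ HE'.
  have mA : measurable A.
    apply: sigma_of_measurable HA => u /= /andP[u0 _]; exact: mw.
  have mA' : measurable A'.
    by apply: sigma_of_measurable HA' => u _; apply: minc => //; exact: le_trans s0 st.
  rewrite -preimage_setI !phiP //; last exact: measurableI.
  exact: (ind s t s0 st).
Qed.

End Pullback.

Section StateEquation.
Context {R : realType}.

Lemma eq_vprim n (h1 h2 : R -> 'cV[R]_n) t : (forall u, 0 <= u -> h1 u = h2 u) ->
  vprim h1 t = vprim h2 t.
Proof.
move=> H; apply/matrixP => k l; rewrite [LHS]mxE [RHS]mxE.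
by apply: eq_prim => u u0; rewrite H.
Qed.

Lemma vsol_vprim n (y g : R -> 'cV[R]_n) t : vcont g -> vsol y g -> 0 <= t -> y t = y 0 + vprim g t.
Proof.
move=> gc [yc yd] t0; apply/matrixP => k l; rewrite ord1 mxDE [vprim g t k 0]mxE.
(* The factor e, taken 1 and -1, yields both inequalities from the monotonicity lemma. *)
have dV (e : R) : forall u : R, 0 < u -> is_derive u (1 : R) (fun u => e * (y u k 0 - prim (fun u => g u k 0) u)) 0.
  move=> u u0.
  have D := is_deriveZ e (is_deriveB (is_derive_entry k 0 (yd u u0)) (prim_derive (gc k) u0)).
  by apply: (is_derive_eq D); rewrite subrr /GRing.scale /= mulr0.
have cV (e : R) : continuous (fun u => e * (y u k 0 - prim (fun u => g u k 0) u)).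
  move=> u; apply: cvgM; first exact: cvg_cst.
  by apply: cvgB; [exact: yc|exact: prim_continuous].
have le (e : R) := continuous_le_of_derive (cV e) (dV e) (fun _ _ => lexx 0) t0.
have := le 1; have := le (-1); rewrite prim0 subr0 => h1 h2.
by apply/eqP; rewrite eq_le; apply/andP; split; lra.
Qed.

Lemma vprimD n (g1 g2 : R -> 'cV[R]_n) t : vcont g1 -> vcont g2 ->
  vprim (fun u => g1 u + g2 u) t = vprim g1 t + vprim g2 t.
Proof.
move=> c1 c2; apply/matrixP => k l; rewrite mxDE ![vprim _ t k l]mxE.
rewrite -(primD t (c1 k) (c2 k)); apply: eq_prim => u _; exact: mxDE.
Qed.

(* y absorbs the noise z of each agent separately, v the interaction and the offset. *)
Lemma population_integral_form N n (M G : 'M[R]_n) (z y : 'I_N -> R -> 'cV[R]_n)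
    (v c : R -> 'cV[R]_n) : (0 < N)%N ->
  (forall i, vcont (z i)) -> vcont c ->
  (forall i, vsol (y i) (fun t => M *m (z i t + y i t))) ->
  vsol v (fun t => (M + G) *m v t + (c t + G *m state_mean (fun j => z j t + y j t))) ->
  forall i t, 0 <= t -> z i t + y i t + v t
    = y i 0 + v 0 + vprim (fun tau => M *m (z i tau + y i tau + v tau)
        + G *m state_mean (fun j => z j tau + y j tau + v tau) + c tau) t + z i t.
Proof.
move=> N0 zc cc ys vs i t t0.
have yc j := (ys j).1; have vc := vs.1.
have g1c : vcont (fun t => M *m (z i t + y i t)) by apply: vcont_linear; exact: vcontD.
have mc : vcont (fun t => state_mean (fun j => z j t + y j t)).
  by apply: (@state_mean_vcont _ _ _ (fun j t => z j t + y j t)) => j; exact: vcontD.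
have g2c : vcont (fun t => (M + G) *m v t + (c t + G *m state_mean (fun j => z j t + y j t))).
  by apply: vcontD; [exact: vcont_linear|apply: vcontD => //; exact: vcont_linear].
have E : vprim (fun tau => M *m (z i tau + y i tau + v tau)
        + G *m state_mean (fun j => z j tau + y j tau + v tau) + c tau) t
  = vprim (fun t => M *m (z i t + y i t)) t
    + vprim (fun t => (M + G) *m v t + (c t + G *m state_mean (fun j => z j t + y j t))) t.
  rewrite -vprimD //; apply: eq_vprim => tau _.
  rewrite (state_meanD (fun j => z j tau + y j tau) (fun=> v tau)) state_mean_cst //.
  rewrite mulmxDl !mulmxDr; set m1 := M *m z i tau; set m2 := M *m y i tau; set m3 := M *m v tau.
  set m4 := G *m v tau; set m5 := G *m state_mean _; clearbody m1 m2 m3 m4 m5.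
  by apply/matrixP => k l; rewrite !mxDE; ring.
rewrite (vsol_vprim g1c (ys i) t0) (vsol_vprim g2c vs t0) E.
set m1 := vprim _ t; set m2 := vprim _ t; clearbody m1 m2.
by apply/matrixP => k l; rewrite !mxDE; ring.
Qed.

End StateEquation.

Section ClosedLoopExistence.
Context {R : realType} {N n r : nat} (rho : R) (A G : 'M[R]_n) (B : 'M[R]_(n, r)) (Rm : 'M[R]_r)
  (P Pi : 'M[R]_n) (xbar s f sg : R -> 'cV[R]_n) (xbar0 : 'cV[R]_n).
Context {d : measure_display} {Om : measurableType d} (Pr : probability Om R).
Variables (W : 'I_N -> R -> Om -> R).
Notation u := (feedback B Rm P Pi xbar s).
Notation M := (Abar A B Rm P).
Hypotheses (N0 : (0 < N)%N).
Hypotheses (fC : Crho rho f) (sgC : Crho rho sg) (sC : Crho rho s) (xbarC : Crho rho xbar).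
Hypothesis bmW : forall i, brownian_motion Pr (W i).

Lemma vprocess_mulmx_det m (U : R -> 'M[R]_(m, n)) (y : R -> Om -> 'cV[R]_n) :
  (forall i j, continuous (fun t => U t i j)) -> vprocess y -> vprocess (fun t om => U t *m y t om).
Proof.
move=> Uc py k; apply: (@eq_cprocess _ _ _ (fun t om => \sum_j U t k j * y t om j 0)) => [t om|]; first by rewrite mxE.
apply: cprocess_sum => j; apply: cprocessM => //; apply: cprocess_det.
exact: continuous_subspaceT.
Qed.

Lemma vprocess_clamp (y : R -> Om -> 'cV[R]_n) : vprocess y -> vprocess (fun t om => y (clamp t) om).
Proof.
move=> py k; have [c m] := py k; split=> [om|t t0]; last by rewrite clamp_id //; exact: m.
by under eq_fun do rewrite (clamp_id (clamp_ge0 _)); exact: c.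
Qed.

Lemma vprocess_duhamel (F : 'M[R]_n) (x0 : 'cV[R]_n) (h : R -> Om -> 'cV[R]_n) : vprocess h ->
  vprocess (fun t om => duhamel F x0 (fun u => h (clamp u) om) t).
Proof.
move=> ph; apply: vprocess_mulmx_det; first exact: expmx_continuous.
apply: vprocessD.
  by apply: vprocess_det; apply: vcont_within; exact: vcont_cst.
have H : vprocess (fun t om => expmx F (- t) *m h t om).
  by apply: vprocess_mulmx_det => //; exact: expmxN_continuous.
move=> k; apply: eq_cprocess (vprocess_prim H k) => t om.
have E : vprim (fun u => expmx F (- clamp u) *m h (clamp u) om) t
    = vprim (fun u => expmx F (- u) *m h (clamp u) om) t.
  by apply: eq_vprim => v v0; rewrite (clamp_id v0).
by rewrite E.
Qed.

(** Everything is built from the continuous Wiener integrals by explicit Duhamel formulas, so path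
    continuity and measurability in the outcome come with the construction. *)
Theorem closed_loop_existence : exists x : 'I_N -> R -> Om -> 'cV[R]_n,
  (forall i om, x i 0 om = xbar0) /\ sde_sol Pr W sg (closed_loop_drift A G B f u) x.
Proof.
have gc k : {within `[0, +oo[, continuous (fun t => sg t k 0)}.
  by apply/within_clamp; have [/within_entry H _] := sgC; exact: H.
have [Zf HZf] := choice (fun ik : 'I_N * 'I_n => continuous_wiener_integral (bmW ik.1) (gc ik.2)).
pose Z i t om : 'cV[R]_n := \col_k Zf (i, k) t om.
have Zc i om : vcont (fun t => Z i t om).
  move=> k; have [H _ _ _] := HZf (i, k).
  by rewrite (_ : (fun t => _) = Zf (i, k) ^~ om); [exact: H|apply/funext => t; rewrite mxE].
have pZ i : vprocess (Z i).
  move=> k; have [H1 H2 _ _] := HZf (i, k).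
  apply: (@eq_cprocess _ _ _ (Zf (i, k))) => [t om|]; first by rewrite mxE.
  by split=> // om t; exact: (cvg_comp _ _ (@continuous_clamp R t) (H1 om _)).
have Z0 i om : Z i 0 om = 0.
  by apply/matrixP => k l; rewrite !mxE; have [_ _ -> _] := HZf (i, k).
have Zc' i om : vcont (fun t => Z i (clamp t) om).
  by move=> k; have [H _] := pZ i k; exact: H.
pose c := drift_offset B Rm P Pi xbar s f.
have cc : {within `[0, +oo[, continuous c} by exact: drift_offset_continuous fC sC xbarC.
pose y i t om := duhamel M 0 (fun v => M *m Z i (clamp v) om) t.
pose a i t om := Z i (clamp t) om + y i t om.
have py i : vprocess (y i) by exact: (vprocess_duhamel M 0 (vprocess_mulmx M (pZ i))).
have yc i om : vcont (fun t => y i t om).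
  by have [] := @duhamel_sol _ _ M 0 _ (vcont_linear (Zc' i om) : vcont (fun v => M *m Z i (clamp v) om)).
have ac i om : vcont (fun t => a i t om) by apply: vcontD.
have pa i : vprocess (a i).
  apply: vprocessD => //; apply: vprocess_clamp; exact: pZ.
pose h t om := c t + G *m state_mean (fun i => a i t om).
have ph : vprocess h.
  apply: vprocessD; first exact: vprocess_det.
  by apply: vprocess_mulmx; exact: vprocess_mean.
have hc om : vcont (fun t => h (clamp t) om) by move=> k; have [H _] := ph k; exact: H.
(* The common initial state is carried by [v] alone; [Z] and [y] start at 0. *)
pose v t om := duhamel (M + G) xbar0 (fun tau => h (clamp tau) om) t.
have pv : vprocess v by exact: (vprocess_duhamel (M + G) xbar0 ph).
have vc om : vcont (fun t => v t om) by have [] := duhamel_sol (M + G) xbar0 (hc om).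
pose x i t om := a i t om + v t om.
have px i : vprocess (x i) by exact: vprocessD.
have xc i om : vcont (fun t => x i t om) by apply: vcontD.
exists x; split.
  move=> i om; rewrite /x /a /y /v !duhamel0 clamp_le0 // Z0 !add0r //.
split.
- by move=> i t k t0; have [_ H] := px i k; exact: H.
- by move=> i om; exact: (vcont_within (xc i om)).
exists Z; split.
  move=> i k; have [_ _ _ H] := HZf (i, k).
  rewrite (_ : (fun t om => Z i t om k 0) = Zf (i, k)) //.
  by apply/funext => t; apply/funext => om; rewrite mxE.
apply: aeW => om i k t t0.
have ya j : vsol (fun t => y j t om) (fun t => M *m (Z j (clamp t) om + y j t om)).
  have := @duhamel_sol _ _ M 0 _ (vcont_linear (Zc' j om) : vcont (fun v => M *m Z j (clamp v) om)).
  by apply: eq_vsol => tau _; rewrite -mulmxDr addrC.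
have hE tau : 0 <= tau -> h (clamp tau) om
    = c (clamp tau) + G *m state_mean (fun j => Z j (clamp tau) om + y j tau om).
  move=> tau0; rewrite /h (clamp_id tau0); congr (_ + _ *m _).
  by apply: eq_state_mean => j; rewrite /a (clamp_id tau0).
have vh0 : vsol (fun t => v t om) (fun t => (M + G) *m v t om + h (clamp t) om) by exact: duhamel_sol.
have y0 j : y j 0 om = 0 by rewrite /y duhamel0.
have v0 : v 0 om = xbar0 by rewrite /v duhamel0.
have ccl : vcont (fun t => c (clamp t)) by apply/vcont_clamp.
have zc j := Zc' j om.
have a0 : a i 0 om = 0 by rewrite /a y0 clamp_le0 // Z0 addr0.
have xE tau j : x j tau om = Z j (clamp tau) om + y j tau om + v tau om by [].
have cE tau j w : closed_loop_drift A G B f u j tau w = M *m w j + G *m state_mean w + c tau.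
  by rewrite closed_loop_driftE.
have x0 : x i 0 om = xbar0 by rewrite /x a0 v0 add0r.
clear hc vc pv ph ac pa py yc xc px HZf a0; clearbody x a y v h Z c.
have vh : vsol (fun t => v t om) (fun t => (M + G) *m v t om
    + (c (clamp t) + G *m state_mean (fun j => Z j (clamp t) om + y j t om))).
  by apply: eq_vsol vh0 => tau tau0; rewrite (hE tau (ltW tau0)).
have H := population_integral_form N0 zc ccl ya vh i t0.
rewrite y0 v0 add0r (clamp_id t0) in H.
rewrite x0 xE (clamp_id t0) H.
rewrite !mxDE; congr (_ + _ + _).
rewrite [LHS]mxE; apply: eq_prim => tau tau0; rewrite cE.
have -> : state_mean (fun j => x j tau om) = state_mean (fun j => Z j (clamp tau) om + y j tau om + v tau om).
  by apply: eq_state_mean => j; exact: xE.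
by rewrite xE (clamp_id tau0).
Qed.

End ClosedLoopExistence.

(** * Necessity *)

Section CoinSpace.
Context {R : realType} {d : measure_display} {Om : measurableType d}.
Variable Pr : probability Om R.

Lemma measurable_pairb (b : bool) : measurable_fun setT (fun om : Om => (om, b)).
Proof. exact: measurable_fun_pair. Qed.

Definition pairb (b : bool) : {mfun Om >-> (Om * bool)%type} :=
  HB.pack (fun om : Om => (om, b)) (isMeasurableFun.Build _ _ _ _ _ (measurable_pairb b)).

Let half : {nonneg R} := NngNum (ltW (divr_gt0 ltr01 (ltr0n R 2)) : 0 <= 1 / 2).

(** This is the product of [Pr] with a fair coin; as a half-sum of two image measures, it reduces
    each probability to the two sections of an event. *)
Definition coin_space : set (Om * bool) -> \bar R :=
  mscale half (measure_add (distribution Pr (pairb true)) (distribution Pr (pairb false))).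

HB.instance Definition _ := Measure.on coin_space.

Lemma coin_spaceE (A : set (Om * bool)) :
  coin_space A = ((2^-1)%:E * (Pr [set om | A (om, true)] + Pr [set om | A (om, false)]))%E.
Proof.
transitivity ((1 / 2)%:E * measure_add (distribution Pr (pairb true)) (distribution Pr (pairb false)) A)%E => //.
by rewrite measure_addE div1r.
Qed.

Lemma coin_space_setT : coin_space setT = 1%E.
Proof.
rewrite coin_spaceE; transitivity ((2^-1)%:E * (Pr setT + Pr setT))%E => //.
by rewrite probability_setT -EFinD -EFinM; congr EFin; field.
Qed.

HB.instance Definition _ := Measure_isProbability.Build _ _ _ coin_space coin_space_setT.

Lemma coin_space_fst E : measurable E -> coin_space (fst @^-1` E) = Pr E.
Proof.
move=> mE; rewrite coin_spaceE; transitivity ((2^-1)%:E * (Pr E + Pr E))%E => //.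
by rewrite -(fineK (fin_num_measure Pr _ mE)) -EFinD -EFinM; congr EFin; field.
Qed.

Lemma coin_space_indep E (S : set bool) : measurable E ->
  coin_space (snd @^-1` S `&` fst @^-1` E) = (coin_space (snd @^-1` S) * coin_space (fst @^-1` E))%E.
Proof.
move=> mE; rewrite (coin_space_fst mE) !coin_spaceE.
have pE : (fine (Pr E))%:E = Pr E by rewrite fineK // fin_num_measure.
have H b : exists2 a : R, Pr [set om | (snd @^-1` S `&` fst @^-1` E) (om, b)] = (a * fine (Pr E))%:E
    & Pr [set om : Om | (snd @^-1` S) (om, b)] = a%:E.
  have [Sb|nSb] := pselect (S b).
    exists 1; last by rewrite (_ : [set om | _] = setT) ?probability_setT //; apply/seteqP; split.
    by rewrite mul1r pE; congr (Pr _); apply/seteqP; split=> om /=; [case|].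
  exists 0; last by rewrite (_ : [set om | _] = set0) ?measure0 //; apply/seteqP; split.
  by rewrite mul0r (_ : [set om | _] = set0) ?measure0 //; apply/seteqP; split=> om //= -[].
have [a1 -> ->] := H true; have [a2 -> ->] := H false.
by rewrite -pE -!EFinD -!EFinM; congr EFin; ring.
Qed.

Lemma measurable_snd_fun (f : bool -> R) : measurable_fun setT (fun p : Om * bool => f p.2).
Proof. by apply: measurableT_comp => //; exact: measurable_snd. Qed.

Lemma coin_space_snd_sigma (J : Type) (D : set J) (Y : J -> bool -> R) E :
  sigma_of D (fun j (p : Om * bool) => Y j p.2) E -> exists S, E = snd @^-1` S.
Proof. by move=> /(@sigma_of_comp _ _ _ snd _ D Y)[S _ ->]; exists S. Qed.

Lemma Ex_coin_sign : Ex coin_space (fun p => if p.2 then 1 else -1) = 0.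
Proof.
pose A : set (Om * bool) := snd @^-1` [set true].
have mA : measurable A by rewrite -[X in measurable X]setTI; apply: measurable_snd.
have lA : L2rv coin_space (\1_A : Om * bool -> R).
  split; first exact: measurable_indic.
  apply: (@le_lt_trans _ _ (\int[coin_space]_p (cst 1%:E p))%E); last first.
    by rewrite (integral_cst _ measurableT (1%:E)) mul1e [X in (X < _)%E]probability_setT ltry.
  apply: ge0_le_integral => //.
  - by apply/measurable_EFinP; apply: measurable_funX; exact: measurable_indic.
  - by move=> p _; rewrite lee_fin indicE; case: (_ \in _); rewrite ?expr1n // expr0n.
have EA : Ex coin_space (\1_A : Om * bool -> R) = 2^-1.
  have cA : coin_space A = (2^-1)%:E.
    rewrite coin_spaceE (_ : [set om | A (om, true)] = setT); last by apply/seteqP; split.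
    rewrite (_ : [set om | A (om, false)] = set0); last by apply/seteqP; split.
    by rewrite probability_setT measure0 adde0 mule1.
  by rewrite /Ex /Rintegral integral_indic // setIT; exact: (congr1 fine cA).
have E1 : Ex coin_space (cst (-1)) = -1.
  rewrite /Ex /Rintegral (integral_cst _ measurableT ((-1)%:E)).
  by rewrite [X in (_ * X)%E]probability_setT mule1.
transitivity (Ex coin_space (fun p => 2 * (\1_A p : R) + cst (-1) p)).
  apply: eq_Ex => p; rewrite indicE /=; case: ifPn => p2.
    by rewrite mem_set //=; ring.
  by rewrite memNset /=; [ring|apply/negP].
rewrite ExD; [|exact/L2rv_integrable/L2rvZ|exact: (L2rv_integrable (L2rv_cst _ _))].
by rewrite ExZ ?EA ?E1; [field|exact: L2rv_integrable].
Qed.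

Section RandomizedInitialState.
Context {N n : nat} (W : 'I_N -> R -> Om -> R) (xbar0 v : 'cV[R]_n) (i0 : 'I_N).
Hypothesis bmW : forall i, brownian_motion Pr (W i).

Definition coin_sign (b : bool) : R := if b then 1 else -1.

Definition coin_state (i : 'I_N) (p : Om * bool) : 'cV[R]_n :=
  xbar0 + ((i == i0)%:R * coin_sign p.2) *: v.

Lemma measurable_coin_state i k : measurable_fun setT (fun p => coin_state i p k 0).
Proof. exact: (measurable_snd_fun (fun b => (xbar0 + ((i == i0)%:R * coin_sign b) *: v) k 0)). Qed.

Lemma sqnorm_coin_state i p : sqnorm (coin_state i p) <= 2 * sqnorm xbar0 + 2 * sqnorm v.
Proof.
apply: le_trans (sqnormD_le _ _) _; rewrite lerD2l ler_wpM2l // sqnormZ.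
rewrite ler_piMl ?sqnorm_ge0 // exprMn /coin_sign.
by case: (i == i0); case: p.2; rewrite /= ?expr0n ?mul0r ?sqrrN ?expr1n ?mul1r // ler01.
Qed.

Lemma coin_state_const_sigma i E : i != i0 ->
  sigma_of [set: 'I_n] (fun k p => coin_state i p k 0) E -> E = set0 \/ E = setT.
Proof.
move=> /negbTE ne; apply: (@smallest_sub _ _ _ [set E | E = set0 \/ E = setT]).
  split; first by left.
  - by move=> A [->|->]; [right; rewrite setD0|left; rewrite setDv].
  - move=> A HA; have [[k Ak]|nA] := pselect (exists k, A k = setT).
      by right; apply/seteqP; split => // p _; exists k => //; rewrite Ak.
    left; apply/seteqP; split => // p [k _].
    by have [->|H] := HA k => //; case: nA; exists k.
move=> A [k _ [B mB ->]].
have [Bx|nBx] := pselect (B (xbar0 k 0)); [right|left]; apply/seteqP; split => // p /=;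
  by rewrite /coin_state ne mul0r scale0r addr0.
Qed.

(** Every event but that of [i0] is empty or full, so the product formula has at most one factor
    other than 0 and 1. *)
Lemma mutually_indep_trivial (F : 'I_N -> set (set (Om * bool))) :
  (forall i, i != i0 -> forall E, F i E -> E = set0 \/ E = setT) ->
  mutually_indep coin_space F.
Proof.
move=> triv J E FE.
have [[i [iJ Ei]]|nE] := pselect (exists i, i \in J /\ E i = set0).
  rewrite (bigD1 i) //= Ei measure0 mul0e.
  rewrite (_ : \bigcap_(i in [set` J]) E i = set0) ?measure0 //.
  by apply/seteqP; split => // p /(_ i iJ); rewrite Ei.
have ET i : i \in J -> i != i0 -> E i = setT.
  move=> iJ ii0; have [Ei|//] := triv i ii0 _ (FE i iJ).
  by case: nE; exists i.
have [i0J|i0J] := boolP (i0 \in J).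
  rewrite (bigD1 i0) //= big1 ?mule1; last first.
    by move=> i /andP[iJ ii0]; rewrite ET // probability_setT.
  congr (coin_space _); apply/seteqP; split=> p; first by move/(_ i0 i0J).
  by move=> Ep i iJ; have [->//|ii0] := eqVneq i i0; rewrite ET.
rewrite big1; last first.
  move=> i iJ; rewrite ET ?probability_setT //.
  by apply: contraNneq i0J => <-.
rewrite (_ : \bigcap_(i in [set` J]) E i = setT) ?probability_setT //.
apply/seteqP; split => // p _ i iJ; rewrite ET //.
by apply: contraNneq i0J => <-.
Qed.

Lemma Ex_coin_state i k : ('E_coin_space[fun p => (coin_state i p k 0)%R] = ((xbar0 k 0)%R)%:E)%E.
Proof.
rewrite unlock.
have ls : L2rv coin_space (fun p => coin_sign p.2).
  split; first exact: measurable_snd_fun.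
  apply: (@le_lt_trans _ _ (\int[coin_space]_p (cst 1%:E p))%E); last first.
    by rewrite (integral_cst _ measurableT (1%:E)) mul1e [X in (X < _)%E]probability_setT ltry.
  apply: ge0_le_integral => //.
  - by move=> p _; rewrite lee_fin sqr_ge0.
  - by apply/measurable_EFinP; apply: measurable_sqr; exact: measurable_snd_fun.
  - by move=> p _; rewrite lee_fin /coin_sign; case: p.2; rewrite ?sqrrN expr1n.
pose a : R := (i == i0)%:R * v k 0.
have E : (fun p => coin_state i p k 0) = (fun p => a * coin_sign p.2 + cst (xbar0 k 0) p).
  by apply/funext => p; rewrite /coin_state mxDE mxZE /= addrC /a; ring.
have iL := L2rv_integrable (L2rvZ a ls).
have iC := L2rv_integrable (L2rv_cst coin_space (xbar0 k 0)).
have iE : coin_space.-integrable setT (EFin \o (fun p => coin_state i p k 0)).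
  by rewrite E; have := integrableD measurableT iL iC; congr integrable; apply/funext.
have H : Ex coin_space (fun p => coin_state i p k 0) = xbar0 k 0.
  rewrite E ExD // ExZ; last exact: L2rv_integrable.
  rewrite [X in a * X](_ : _ = 0); last exact: Ex_coin_sign.
  rewrite mulr0 add0r /Ex /Rintegral (integral_cst _ measurableT ((xbar0 k 0)%:E)).
  by rewrite [X in (_ * X)%E]probability_setT mule1.
by rewrite -[LHS]fineK ?(integrable_fin_num measurableT iE) //; congr EFin.
Qed.

Lemma coin_state_admissible : exists C0 : R,
  admissible_initial coin_space (fun i t p => W i t p.1) xbar0 C0 coin_state.
Proof.
(* The added 1 makes the moment bound strict. *)
exists (2 * sqnorm xbar0 + 2 * sqnorm v + 1); split.
- exact: measurable_coin_state.
- by apply: mutually_indep_trivial => i ii0 E; exact: coin_state_const_sigma.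
- exact: Ex_coin_state.
- move=> i; rewrite unlock.
  pose b := 2 * sqnorm xbar0 + 2 * sqnorm v.
  apply: (@le_lt_trans _ _ (\int[coin_space]_p (cst b%:E p))%E); last first.
    by rewrite (integral_cst _ measurableT b%:E) [X in (_ * X)%E]probability_setT mule1 lte_fin ltrDl.
  apply: ge0_le_integral => //.
  + by move=> p _; rewrite lee_fin sqnorm_ge0.
  + apply/measurable_EFinP; apply: measurable_sum => k; apply: measurable_funX.
    exact: measurable_coin_state.
  + by move=> p _; rewrite lee_fin; exact: sqnorm_coin_state.
- move=> E E' HE HE'.
  have [S ->] : exists S, E = snd @^-1` S.
    exact: (@coin_space_snd_sigma _ setT (fun (q : 'I_N * 'I_n) b => (xbar0 + ((q.1 == i0)%:R * coin_sign b) *: v) q.2 0)).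
  have [A HA ->] := @sigma_of_comp _ _ _ fst ('I_N * R)%type [set p | 0 <= p.2] (fun q om => W q.1 q.2 om) _ HE'.
  apply: coin_space_indep; apply: sigma_of_measurable HA => q /= q0.
  by have [H _ _ _ _] := bmW q.1; exact: H.
Qed.

End RandomizedInitialState.

End CoinSpace.

Section Necessity.
Context {R : realType} {N n r : nat} (rho : R) (A G : 'M[R]_n) (B : 'M[R]_(n, r)) (Rm : 'M[R]_r)
  (P Pi : 'M[R]_n) (xbar s f sg : R -> 'cV[R]_n) (xbar0 : 'cV[R]_n).
Context {d : measure_display} {Om : measurableType d} (Pr : probability Om R).
Variables (W : 'I_N -> R -> Om -> R).
Notation mu := (@lebesgue_measure R).
Notation u := (feedback B Rm P Pi xbar s).
Notation M := (Abar A B Rm P).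
Notation D := (discount (- (rho / 2))).
Hypotheses (fC : Crho rho f) (sgC : Crho rho sg) (sC : Crho rho s) (xbarC : Crho rho xbar).

Lemma closed_loop_driftD i t (v w : 'I_N -> 'cV[R]_n) :
  closed_loop_drift A G B f u i t (fun j => v j + w j)
  = closed_loop_drift A G B f u i t v + (M *m w i + G *m state_mean w).
Proof.
rewrite !closed_loop_driftE state_meanD !mulmxDr.
set m1 := M *m v i; set m2 := M *m w i; set m3 := G *m _; set m4 := G *m _; set c := drift_offset _ _ _ _ _ _ _ _.
clearbody m1 m2 m3 m4 c.
by apply/matrixP => k l; rewrite !mxDE; ring.
Qed.

Section FiniteCost.
Context {d' : measure_display} {Om' : measurableType d'} (Pr' : probability Om' R).
Variables (W' : 'I_N -> R -> Om' -> R) (x : 'I_N -> R -> Om' -> 'cV[R]_n).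
Hypothesis sol : sde_sol Pr' W' sg (closed_loop_drift A G B f u) x.

Let xproc i : vprocess (x i).
Proof.
case: sol => mx cx _ k; split=> [om|t t0]; last exact: mx.
by have /within_entry := cx i om; apply.
Qed.

Lemma feedback_process i : vprocess (fun t om => u t (x i t om)).
Proof.
apply: vprocessN; apply: vprocess_mulmx; apply: vprocessD; last by apply: vprocess_det; have [] := sC.
apply: vprocessD; apply: vprocess_mulmx => //.
by apply: vprocess_det; have [] := xbarC.
Qed.

(** One agent's expected cost is a nonnegative summand of the total, and a nonnegative variable of
    finite expectation is finite almost surely. *)
Lemma finite_cost_L2 i : (total_cost rho Pr' u x < +oo)%E ->
  {ae Pr', forall om, L2bounded (D (fun t => x i (clamp t) om))}.
Proof.
move=> cost.
have D0 (t : R) : `[0, +oo[%classic t -> 0 <= t by rewrite /= in_itv /= andbT.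
pose p j t om := expR (- rho * t) * (sqnorm (x j t om) + sqnorm (u t (x j t om))).
have p0 j t om : 0 <= p j t om by rewrite mulr_ge0 ?expR_ge0 // addr_ge0 // sqnorm_ge0.
have pp : cprocess (p i).
  apply: cprocessM; first exact: cprocess_exp.
  by apply: cprocessD; apply: cprocess_sqnorm => //; exact: feedback_process.
have I0 j : (0 <= \int[Pr']_om \int[mu]_(t in `[0%R, +oo[) (p j t om)%:E)%E.
  by apply: integral_ge0 => om _; apply: integral_ge0 => t _; rewrite lee_fin.
have ci : (\int[Pr']_om \int[mu]_(t in `[0%R, +oo[) (p i t om)%:E < +oo)%E.
  apply: le_lt_trans cost; rewrite /total_cost (bigD1 i) //= leeDl //.
  by apply: sume_ge0 => j _; exact: I0.
have mi : measurable_fun setT (fun om => \int[mu]_(t in `[0%R, +oo[) (p i t om)%:E)%E.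
  by apply: (measurable_time_integral pp) => // t om _.
have ii : Pr'.-integrable setT (fun om => \int[mu]_(t in `[0%R, +oo[) (p i t om)%:E)%E.
  apply/integrableP; split => //; apply: le_lt_trans ci.
  rewrite le_eqVlt; apply/orP; left; apply/eqP; apply: eq_integral => om _.
  by rewrite gee0_abs //; apply: integral_ge0 => t _; rewrite lee_fin.
apply: filterS (integrable_ae measurableT ii) => om /(_ I) fin.
have xc : vcont (fun t => x i (clamp t) om) by move=> k; have [H _] := xproc i k; exact: H.
have Dxc : continuous (fun t => sqnorm (D (fun t => x i (clamp t) om) t)).
  by apply: continuous_sqnorm; exact: discount_vcont.
have [c1 _] := pp.
apply: ge0_integral_bounded => //; first by move=> t _; exact: sqnorm_ge0.
apply: (@le_lt_trans _ _ (\int[mu]_(t in `[0%R, +oo[) (p i (clamp t) om)%:E)%E).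
  apply: ge0_le_integral => //.
  - by move=> t _; rewrite lee_fin sqnorm_ge0.
  - exact: measurable_continuous.
  - by apply: measurable_continuous => //; exact: c1.
  - move=> t /D0 t0; rewrite lee_fin sqnorm_discount /p clamp_id //.
    by rewrite ler_wpM2l ?expR_ge0 // lerDl sqnorm_ge0.
have <- : (\int[mu]_(t in `[0%R, +oo[) (p i t om)%:E = \int[mu]_(t in `[0%R, +oo[) (p i (clamp t) om)%:E)%E.
  by apply: eq_integral => t; rewrite inE => /D0 t0; rewrite clamp_id.
by have := fin; rewrite ge0_fin_numE //; apply: integral_ge0 => t _; rewrite lee_fin.
Qed.

(** The closed loop is affine in the states, so a random multiple of a deterministic solution of its
    linear part can be added with the same Wiener integrals. *)
Lemma perturbed_sol (xi : Om' -> R) (dl : 'I_N -> R -> 'cV[R]_n) : measurable_fun setT xi ->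
  (forall i, vsol (dl i) (fun t => M *m dl i t + G *m state_mean (fun j => dl j t))) ->
  sde_sol Pr' W' sg (closed_loop_drift A G B f u) (fun i t om => x i t om + xi om *: dl i t).
Proof.
move=> mxi dls; case: sol => mx cx [Z [wZ aeZ]].
have dlc i : vcont (dl i) := (dls i).1.
have xc j om : vcont (fun t => x j (clamp t) om) := (vcont_clamp (fun t => x j t om)).1 (cx j om).
split.
- move=> i t k t0.
  rewrite (_ : (fun om => _) = (fun om => x i t om k 0 + xi om * dl i t k 0)); last first.
    by apply/funext => om; rewrite mxDE mxZE.
  apply: measurable_funD; first exact: mx.
  by apply: measurable_funM.
- move=> i om; apply/vcont_clamp; apply: vcontD; first exact: xc.
  apply: vcontZ; first by move=> t; exact: cvg_cst.
  exact: (vcont_clamp (dl i)).1 (vcont_within (dlc i)).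
exists Z; split; first exact: wZ.
apply: filterS aeZ => om H i k t t0.
pose g tau := M *m dl i tau + G *m state_mean (fun j => dl j tau).
have gc : vcont g by apply: vcontD; apply: vcont_linear => //; exact: state_mean_vcont.
pose bd tau := closed_loop_drift A G B f u i (clamp tau) (fun j => x j (clamp tau) om).
have bc : vcont bd.
  have H' : vcont (fun tau => M *m x i (clamp tau) om + G *m state_mean (fun j => x j (clamp tau) om)
      + drift_offset B Rm P Pi xbar s f (clamp tau)).
    apply: vcontD; last by apply/vcont_clamp; exact: drift_offset_continuous fC sC xbarC.
    by apply: vcontD; apply: vcont_linear => //; exact: (@state_mean_vcont _ _ _ (fun j t => x j (clamp t) om) (fun j => xc j om)).
  by move: H'; congr vcont; apply/funext => tau; rewrite /bd closed_loop_driftE.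
have E1 : \int[lebesgue_measure]_(tau in `[0, t])
    (closed_loop_drift A G B f u i tau (fun j => x j tau om)) k 0 = prim (fun tau => bd tau k 0) t.
  by apply: eq_prim => tau tau0; rewrite /bd clamp_id.
have -> : \int[lebesgue_measure]_(tau in `[0, t])
    (closed_loop_drift A G B f u i tau (fun j => x j tau om + xi om *: dl j tau)) k 0
    = prim (fun tau => bd tau k 0 + xi om * g tau k 0) t.
  apply: eq_prim => tau tau0; rewrite closed_loop_driftD /bd clamp_id // mxDE; congr (_ + _).
  have -> : state_mean (fun j => xi om *: dl j tau) = xi om *: state_mean (fun j => dl j tau).
    by rewrite /state_mean -scaler_sumr !scalerA mulrC.
  by rewrite -!scalemxAr -scalerDr mxZE /g /state_mean -scalemxAr.
have cxg : continuous (fun tau => xi om * g tau k 0).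
  by move=> tau; apply: cvgM; [exact: cvg_cst|exact: gc].
rewrite (primD t (bc k) cxg) (primZ _ _ (gc k)).
rewrite !mxDE !mxZE (H i k t t0) E1 (vsol_vprim gc (dls i) t0) mxDE [vprim g t k 0]mxE.
by ring.
Qed.

End FiniteCost.

Hypothesis N1 : (1 < N)%N.
Hypothesis bmW : forall i, brownian_motion Pr (W i).
Hypothesis stab : uniformly_stabilizing rho A G B f sg xbar0 Pr W u.

(** The response of the linear part to a shift of agent [i0]: its mean is p / N, driven by M + G,
    and the deviations from the mean are multiples of q, driven by M. When q and p agree at 0, only
    agent [i0] starts away from 0. *)
Definition perturbation (q p : R -> 'cV[R]_n) (i0 i : 'I_N) (t : R) : 'cV[R]_n :=
  (i == i0)%:R *: q t + N%:R^-1 *: (p t - q t).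

Lemma perturbation_mean q p i0 t :
  state_mean (fun i => perturbation q p i0 i t) = N%:R^-1 *: p t.
Proof.
have N0 : (0 < N)%N by exact: ltnW.
rewrite (state_meanD (fun i => (i == i0)%:R *: q t)) state_mean_cst // /state_mean.
rewrite (bigD1 i0) //= eqxx scale1r big1 ?addr0; last first.
  by move=> i /negbTE ->; rewrite scale0r.
by rewrite -scalerDr addrC subrK.
Qed.

Lemma perturbation_sol q p i0 i : vsol q (fun t => M *m q t) -> vsol p (fun t => (M + G) *m p t) ->
  vsol (perturbation q p i0 i) (fun t => M *m perturbation q p i0 i t
    + G *m state_mean (fun j => perturbation q p i0 j t)).
Proof.
move=> [qc qd] [pc pd]; split.
  apply: vcontD; first by apply: vcontZ => // t; exact: cvg_cst.
  apply: vcontZ; first by move=> t; exact: cvg_cst.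
  by apply: vcontD => //; exact: vcontN.
move=> t t0; rewrite perturbation_mean.
apply: is_derive_mx => k l.
have D := is_deriveD (is_deriveZ ((i == i0)%:R : R) (is_derive_entry k l (qd t t0)))
  (is_deriveZ (N%:R^-1 : R) (is_deriveB (is_derive_entry k l (pd t t0)) (is_derive_entry k l (qd t t0)))).
rewrite (_ : (fun x => perturbation q p i0 i x k l) =
    (fun t => (i == i0)%:R * q t k l + N%:R^-1 * (p t k l - q t k l))); last first.
  by apply/funext => x; rewrite /perturbation !mxDE !mxZE !mxDE mxNE.
apply: (is_derive_eq D); rewrite [(M + G) *m p t]mulmxDl /perturbation.
rewrite [M *m (_ + _)]mulmxDr -!scalemxAr [M *m (_ - _)]mulmxBr.
set m1 := M *m q t; set m2 := M *m p t; set m3 := G *m p t; clearbody m1 m2 m3.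
rewrite !mxDE !mxZE mxBE /GRing.scale /=; set e : R := (i == i0)%:R; clearbody e; ring.
Qed.

Lemma perturbation_L2 q p i0 i : vsol q (fun t => M *m q t) -> vsol p (fun t => (M + G) *m p t) ->
  q 0 = p 0 -> L2bounded (D (perturbation q p i0 i)).
Proof.
move=> qs ps qp0; have N0 : (0 < N)%N by exact: ltnW.
pose Pr' := coin_space Pr : probability (Om * bool)%type R.
pose W' j t (om : Om * bool) := W j t om.1.
have bmW' j : brownian_motion Pr' (W' j).
  by apply: (brownian_motion_pullback measurable_fst _ (bmW j)) => E; exact: coin_space_fst.
have [x [x0 sol]] := closed_loop_existence A G B Rm P Pi xbar0 N0 fC sgC sC xbarC bmW'.
pose xi (om : Om * bool) : R := coin_sign om.2.
have mxi : measurable_fun setT xi by exact: measurable_snd_fun.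
have cost q' p' : vsol q' (fun t => M *m q' t) -> vsol p' (fun t => (M + G) *m p' t) -> q' 0 = p' 0 ->
    {ae Pr', forall om, L2bounded (D (fun t => x i (clamp t) om + xi om *: perturbation q' p' i0 i (clamp t)))}.
  move=> qs' ps' qp'.
  have sol' := perturbed_sol sol mxi (fun j => perturbation_sol i0 j qs' ps').
  apply: (finite_cost_L2 sol' i).
  have [C0 adm] := coin_state_admissible xbar0 (q' 0) i0 bmW.
  apply: (stab measurable_fst (coin_space_fst Pr) _ sol' : (_ < _)%E).
  (* As q' and p' agree at 0 the term in 1/N vanishes, and the initial states are those of the coin.
     The zero perturbation fits in as the case q' 0 = 0. *)
  rewrite (_ : (fun j => _) = coin_state xbar0 (q' 0) i0); first exact: adm.
  apply/funext => j; apply/funext => om; rewrite x0 /coin_state /perturbation qp' subrr scaler0 addr0.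
  by rewrite scalerA mulrC.
have zs (F : 'M[R]_n) : vsol (fun=> 0) (fun t => F *m (fun=> 0 : 'cV[R]_n) t).
  by split; [exact: vcont_cst|move=> t t0; rewrite mulmx0; exact: is_derive_cstmx].
have ae0 := cost _ _ (zs M) (zs (M + G)) erefl.
have ae1 := cost _ _ qs ps qp0.
have [om [h0 h1]] : exists om, L2bounded (D (fun t => x i (clamp t) om + xi om *: perturbation (fun=> 0) (fun=> 0) i0 i (clamp t)))
  /\ L2bounded (D (fun t => x i (clamp t) om + xi om *: perturbation q p i0 i (clamp t))).
  (* Two almost sure events share an outcome, so both paths can be subtracted at the same [om]. *)
  have PF : ProperFilter (almost_everywhere Pr').
    apply: ae_properfilter_algebraOfSetsType.
    by rewrite [X in (_ < X)%E]probability_setT.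
  exact: (filter_ex (filterI ae0 ae1)).
have [_ cx _] := sol.
have xc : vcont (fun t => x i (clamp t) om) := (vcont_clamp (fun t => x i t om)).1 (cx i om).
have pc q' p' : vsol q' (fun t => M *m q' t) -> vsol p' (fun t => (M + G) *m p' t) ->
    vcont (perturbation q' p' i0 i) by move=> qs' ps'; have [] := perturbation_sol i0 i qs' ps'.
have yc q' p' : vsol q' (fun t => M *m q' t) -> vsol p' (fun t => (M + G) *m p' t) ->
    vcont (fun t => x i (clamp t) om + xi om *: perturbation q' p' i0 i (clamp t)).
  move=> qs' ps'; apply: vcontD => //; apply: vcontZ; first by move=> t; exact: cvg_cst.
  exact: (vcont_clamp _).1 (vcont_within (pc _ _ qs' ps')).
have c1 := discount_vcont (yc _ _ qs ps); have c0 := discount_vcont (yc _ _ (zs M) (zs (M + G))).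
have Nc : vcont (fun t => - D (fun t => x i (clamp t) om + xi om *: perturbation (fun=> 0) (fun=> 0) i0 i (clamp t)) t).
  exact: vcontN.
have h0N : L2bounded (fun t => - D (fun t => x i (clamp t) om + xi om *: perturbation (fun=> 0) (fun=> 0) i0 i (clamp t)) t).
  by apply: (L2bounded_le Nc (c0 _) ler01 _ h0) => t _; rewrite sqnormN mul1r.
have hd := L2boundedD (c1 _) Nc h1 h0N.
apply: (L2bounded_le (discount_vcont (pc _ _ qs ps)) (vcontD (c1 _) Nc) ler01 _ hd) => t t0.
have P0 : perturbation (fun=> 0) (fun=> 0) i0 i (clamp t) = 0.
  by rewrite /perturbation subr0 !scaler0 addr0.
rewrite mul1r /discount P0 scaler0 addr0 -scalerBr [x i (clamp t) om + _]addrC addrK clamp_id //.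
rewrite !sqnormZ ler_wpM2l ?sqr_ge0 //.
by rewrite ler_peMl ?sqnorm_ge0 // /xi /coin_sign; case: om.2; rewrite ?sqrrN expr1n.
Qed.

(** Two distinct agents separate the modes: the perturbations of [i0] and [i1] differ by q, and p is
    N times that of [i1] plus q. *)
Theorem stabilizing_hurwitz : hurwitz (M - (rho / 2)%:M) /\ hurwitz (M + G - (rho / 2)%:M).
Proof.
have N0 : (0 < N)%N by exact: ltnW.
pose i0 := Ordinal N0; pose i1 := Ordinal N1.
have i10 : (i1 == i0) = false by [].
have qL q p : vsol q (fun t => M *m q t) -> vsol p (fun t => (M + G) *m p t) -> q 0 = p 0 ->
    L2bounded (D q) /\ L2bounded (D p).
  move=> qs ps qp.
  have [c0 c1] : vcont (perturbation q p i0 i0) /\ vcont (perturbation q p i0 i1).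
    by split; [have [] := perturbation_sol i0 i0 qs ps|have [] := perturbation_sol i0 i1 qs ps].
  have L0 := perturbation_L2 i0 i0 qs ps qp.
  have L1 := perturbation_L2 i0 i1 qs ps qp.
  have dc0 : vcont (D (perturbation q p i0 i0)) := discount_vcont c0.
  have dc1 : vcont (D (perturbation q p i0 i1)) := discount_vcont c1.
  have dc1N := vcontN dc1.
  have L1N : L2bounded (fun t => - D (perturbation q p i0 i1) t).
    by apply: (L2bounded_le dc1N dc1 ler01 _ L1) => t _; rewrite sqnormN mul1r.
  have [qc _] := qs; have [pc _] := ps.
  have Lq : L2bounded (D q).
    apply: (L2bounded_le (discount_vcont qc) (vcontD dc0 dc1N) ler01 _ (L2boundedD dc0 dc1N L0 L1N)) => t _.
    rewrite mul1r /discount -scalerBr /perturbation eqxx i10 scale1r scale0r add0r addrK.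
    by [].
  split => //.
  pose c1' := N%:R : R.
  have dcn : vcont (fun t => c1' *: D (perturbation q p i0 i1) t) by apply: vcontZ => // t; exact: cvg_cst.
  have Ln : L2bounded (fun t => c1' *: D (perturbation q p i0 i1) t).
    by apply: (L2bounded_le dcn dc1 (sqr_ge0 c1') _ L1) => t _; rewrite sqnormZ.
  apply: (L2bounded_le (discount_vcont pc) (vcontD dcn (discount_vcont qc)) ler01 _ (L2boundedD dcn (discount_vcont qc) Ln Lq)) => t _.
  rewrite mul1r /discount /perturbation i10 scale0r add0r !scalerA.
  rewrite /c1' [N%:R * _]mulrC -[_ * N%:R * _]mulrA divff ?mulr1 ?pnatr_eq0 -?lt0n //.
  by rewrite -scalerDr subrK.
(* [hurwitz_of_L2] tests trajectories of F - rho/2; multiplied by exp(rho t / 2) they become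
   trajectories of F, to which [qL] applies. *)
have undisc (F : 'M[R]_n) y : vsol y (fun t => (F - (rho / 2)%:M) *m y t) ->
    vsol (discount (rho / 2) y) (fun t => F *m discount (rho / 2) y t).
  move=> ys; apply: eq_vsol (discount_vsol (rho / 2) ys) => t _.
  by rewrite discount_linear mulmxBl mul_scalar_mx addrC subrK.
have D0 (a : R) (y : R -> 'cV[R]_n) : discount a y 0 = y 0 by rewrite /discount mulr0 expR0 scale1r.
split; apply: hurwitz_of_L2 => y /undisc ys.
- have E : discount (rho / 2) y 0 = expmx (M + G) 0 *m y 0 by rewrite D0 expmx0 mul1mx.
  have [+ _] := qL _ _ ys (homogeneous_sol (M + G) (y 0)) E.
  by rewrite -{2}[rho / 2]opprK discountK.
- have E : expmx M 0 *m y 0 = discount (rho / 2) y 0 by rewrite D0 expmx0 mul1mx.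
  have [_ +] := qL _ _ (homogeneous_sol M (y 0)) ys E.
  by rewrite -{2}[rho / 2]opprK discountK.
Qed.

End Necessity.

(** * The control laws *)

Section ClosedLoopMatrices.
Context {R : realType} {n r p : nat}.
Variables (rho : R) (A : 'M[R]_n) (B : 'M[R]_(n, r)) (Rm : 'M[R]_r) (C : 'M[R]_(p, n)) (Q : 'M[R]_n).
Hypotheses (Rpd : pdmx Rm) (obs : observable (A - (rho / 2)%:M) C) (QC : Q = C^T *m C).
Implicit Types (P G : 'M[R]_n).

Lemma riccati_are P : riccati rho A B Rm Q P <-> are (A - (rho / 2)%:M) B Rm C P.
Proof.
rewrite /riccati /are QC linearB /= tr_scalar_mx mulmxBl mulmxBr mul_scalar_mx mul_mx_scalar.
set a := A^T *m P; set b := P *m A; set c := P *m B *m invmx Rm *m B^T *m P; set e := C^T *m C.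
clearbody a b c e.
have E : a - (rho / 2) *: P + (b - (rho / 2) *: P) - c + e = (a + b - c + e) - rho *: P.
  by apply/matrixP => i j; rewrite !(mxDE, mxNE, mxZE); field.
by rewrite E; split=> [->|/eqP]; [rewrite subrr|rewrite subr_eq0 => /eqP ->].
Qed.

Lemma Abar_closed_loop P : Abar A B Rm P - (rho / 2)%:M = closed_loop (A - (rho / 2)%:M) B Rm P.
Proof. by rewrite /Abar /closed_loop addrAC. Qed.

Lemma riccati_pd_hurwitz P : pdmx P -> riccati rho A B Rm Q P -> hurwitz (Abar A B Rm P - (rho / 2)%:M).
Proof.
by move=> /pdmx_psd Pp /riccati_are HP; rewrite Abar_closed_loop; exact: (are_stabilizing Rpd obs Pp HP).
Qed.

Lemma riccati_unique P1 P2 : P1^T = P1 -> P2^T = P2 -> riccati rho A B Rm Q P1 -> riccati rho A B Rm Q P2 ->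
  hurwitz (Abar A B Rm P1 - (rho / 2)%:M) -> hurwitz (Abar A B Rm P2 - (rho / 2)%:M) -> P1 = P2.
Proof.
rewrite !Abar_closed_loop => s1 s2 /riccati_are a1 /riccati_are a2.
exact: (are_unique Rpd s1 s2 a1 a2).
Qed.

Lemma riccati_pd_unique P : pdmx P -> riccati rho A B Rm Q P ->
  unique (fun P => pdmx P /\ riccati rho A B Rm Q P) P.
Proof.
move=> Pp HP; split => // P' [Pp' HP'].
by apply: riccati_unique => //; [exact: Pp.1|exact: Pp'.1|exact: riccati_pd_hurwitz|exact: riccati_pd_hurwitz].
Qed.

Lemma riccati_exists : stabilizable (A - (rho / 2)%:M) B ->
  exists P, unique (fun P => pdmx P /\ riccati rho A B Rm Q P) P.
Proof.
move=> /(are_exists Rpd obs)[P Pp /riccati_are HP]; exists P; exact: riccati_pd_unique.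
Qed.

Lemma riccati_stabilizable P : pdmx P -> riccati rho A B Rm Q P -> stabilizable (A - (rho / 2)%:M) B.
Proof. by move=> /pdmx_psd Pp /riccati_are HP; exact: (are_stabilizable Rpd obs Pp HP). Qed.

End ClosedLoopMatrices.

Lemma hurwitz_stabilizable (R : realType) n r (A : 'M[R]_n) (B : 'M[R]_(n, r)) Rm P (c : R) :
  hurwitz (Abar A B Rm P - c%:M) -> stabilizable (A - c%:M) B.
Proof.
move=> H; exists (- (invmx Rm *m B^T *m P)).
by rewrite mulmxN !mulmxA addrAC.
Qed.

Lemma AbarD (R : realType) n r (A G : 'M[R]_n) (B : 'M[R]_(n, r)) Rm P :
  Abar A B Rm P + G = Abar (A + G) B Rm P.
Proof. by rewrite /Abar addrAC. Qed.

(** A matrix and its transpose have the same characteristic polynomial; the offset equation is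
    driven by a transpose. *)
Lemma hurwitz_tr (R : realType) n (M : 'M[R]_n) : hurwitz M -> hurwitz M^T.
Proof.
move=> H lam; rewrite eigenvalue_root_char -map_trmx /char_poly -det_tr /char_poly_mx.
rewrite linearB /= tr_scalar_mx -map_trmx trmxK -/(char_poly_mx _) -/(char_poly _).
by rewrite -eigenvalue_root_char; exact: H.
Qed.

Section ControlLaw.
Context {R : realType} {n r : nat} (rho : R) (A G Gam Q : 'M[R]_n) (B : 'M[R]_(n, r)) (Rm : 'M[R]_r)
  (eta xbar0 : 'cV[R]_n) (f : R -> 'cV[R]_n) (Pi : 'M[R]_n).
Hypotheses (rho0 : 0 < rho) (fC : Crho rho f).
Notation F := (Abar (A + G) B Rm Pi).
Notation D := (discount (- (rho / 2))).
Hypothesis hF : hurwitz (F - (rho / 2)%:M).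

Lemma vsol_ode_sol (Fd : R -> 'cV[R]_n -> 'cV[R]_n) x g :
  (forall t, 0 < t -> g t = Fd t (x t)) -> vsol x g -> ode_sol Fd x.
Proof.
move=> E [xc xd]; split; first exact: vcont_within.
by move=> t t0; rewrite -E //; exact: xd.
Qed.

(** The integral of exp(- rho t) is at most 1 / rho. The constant forcing by eta in the offset
    equation calls for it. *)
Lemma discount_cst_L2 (v : 'cV[R]_n) : L2bounded (D (fun=> v)).
Proof.
have ec := @continuous_expRM R (- rho).
exists (sqnorm v * rho^-1) => T T0.
have H := @energy_integral R (fun t => rho^-1 * expR (- rho * t)) (fun t => - expR (- rho * t))
  (fun t => expR (- rho * t)) (fun=> 0) T _ ec _ _ _ T0.
rewrite (_ : prim _ T = sqnorm v * prim (fun t => expR (- rho * t)) T); last first.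
  by rewrite -primZ //; apply: eq_prim => t _; rewrite sqnorm_discount mulrC.
rewrite ler_wpM2l ?sqnorm_ge0 //.
suff : rho^-1 * expR (- rho * T) + prim (fun t => expR (- rho * t)) T <= rho^-1.
  by apply: le_trans; rewrite lerDr mulr_ge0 ?expR_ge0 // invr_ge0 ltW.
have := H; rewrite mulr0 expR0 mulr1 prim_cst // mul0r addr0; apply.
- by move=> t; apply: cvgM; [exact: cvg_cst|exact: ec].
- by move=> t; exact: cvg_cst.
- move=> t t0; have D' := is_deriveZ rho^-1 (is_derive_expRM (- rho) t).
  by apply: (is_derive_eq D'); rewrite /GRing.scale /=; field; exact: lt0r_neq0.
- by move=> t _; rewrite sub0r.
Qed.

Lemma Crho_vsol (x : R -> 'cV[R]_n) : vcont x -> L2bounded (D x) -> Crho rho x.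
Proof.
move=> xc xL; apply/CrhoP; split; first exact: vcont_within.
have xcl : vcont (x \o clamp) := (vcont_clamp x).1 (vcont_within xc).
apply: (L2bounded_le (discount_vcont xcl) (discount_vcont xc) ler01 _ xL) => t t0.
by rewrite mul1r !sqnorm_discount /= clamp_id.
Qed.

(** With z = exp(- rho t / 2) s, the offset equation reads z' = - (F - rho/2)^T z - h with square
    integrable h, which is the antistable form. *)
Lemma offset_exists : exists s, [/\ vcont s, Crho rho s & offset_eq rho A G Gam Q B Rm eta f Pi s].
Proof.
pose e := Q *m eta - Gam^T *m Q *m eta.
pose h0 t := Pi *m f (clamp t) - e.
have [fc fL] := (CrhoP rho f).1 fC.
have fcl : vcont (fun t => f (clamp t)) := (vcont_clamp f).1 fc.
have pfc : vcont (fun t => Pi *m f (clamp t)) by exact: vcont_linear.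
have ec : vcont (fun=> - e) by exact: vcont_cst.
have h0c : vcont h0 by exact: (vcontD pfc ec).
have [C C0 HC] := sqnorm_mulmx Pi.
have h0L : L2bounded (D h0).
  rewrite /h0 discountD; apply: L2boundedD; [exact: discount_vcont|exact: discount_vcont| |exact: discount_cst_L2].
  apply: (L2bounded_le (discount_vcont pfc) (discount_vcont fcl) (ltW C0) _ fL) => t _.
  by rewrite !sqnorm_discount mulrCA ler_wpM2l ?expR_ge0 //; exact: HC.
have [z [zs zL]] := antistable_L2 (hurwitz_tr hF) (discount_vcont h0c) h0L.
exists (discount (rho / 2) z).
have ss := discount_vsol (rho / 2) zs.
have zE : D (discount (rho / 2) z) = z by rewrite -{2}[rho / 2]opprK discountK.
split; first exact: ss.1.
  by apply: Crho_vsol; [exact: ss.1|rewrite zE].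
apply: vsol_ode_sol ss => t t0.
set y := discount (rho / 2) z.
have -> : discount (rho / 2) (fun t0 => - ((F - (rho / 2)%:M)^T *m z t0) - D h0 t0) t
    = - ((F - (rho / 2)%:M)^T *m y t) - h0 t.
  rewrite /discount scalerBr scalerN scalemxAr; congr (_ - _).
  by rewrite scalerA -expRD mulNr subrr expR0 scale1r.
rewrite /h0 clamp_id ?(ltW t0) // -/e linearB /= tr_scalar_mx mulmxBl mul_scalar_mx /Abar.
set m1 := _ *m y t; set m2 := Pi *m f t; set w := y t; clearbody m1 m2 w e.
by apply/matrixP => i j; rewrite !(mxDE, mxNE, mxZE); field.
Qed.

Lemma mean_field_exists s : vcont s -> Crho rho s ->
  exists xbar, Crho rho xbar /\ mean_field_eq A G B Rm f xbar0 Pi s xbar.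
Proof.
move=> sc sC.
have [fc fL] := (CrhoP rho f).1 fC; have [_ sL] := (CrhoP rho s).1 sC.
have fcl : vcont (fun t => f (clamp t)) := (vcont_clamp f).1 fc.
have scl : vcont (fun t => s (clamp t)) := (vcont_clamp s).1 (vcont_within sc).
pose S := - (B *m invmx Rm *m B^T).
pose h t := S *m s (clamp t) + f (clamp t).
have Ssc : vcont (fun t => S *m s (clamp t)) by exact: vcont_linear.
have hc : vcont h by exact: vcontD.
have [C C0 HC] := sqnorm_mulmx S.
have [K HK] : L2bounded (D h).
  rewrite /h discountD; apply: L2boundedD; [exact: discount_vcont|exact: discount_vcont| |exact: fL].
  apply: (L2bounded_le (discount_vcont Ssc) (discount_vcont scl) (ltW C0) _ sL) => t _.
  by rewrite !sqnorm_discount mulrCA ler_wpM2l ?expR_ge0 //; exact: HC.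
have xs := duhamel_sol F xbar0 hc.
exists (duhamel F xbar0 h); split; last first.
  split; first exact: duhamel0.
  apply: vsol_ode_sol xs => t t0; rewrite /h clamp_id ?(ltW t0) //.
  move: (duhamel F xbar0 h t) (s t) (f t) => x y z.
  rewrite mulmxDr mulmxBl /S mulNmx !mulmxA.
  set m1 := (A + G) *m x; set m2 := _ *m y; set m3 := _ *m x; clearbody m1 m2 m3.
  by apply/matrixP => i j; rewrite !(mxDE, mxNE); ring.
apply: Crho_vsol; first exact: xs.1.
have [C' C'0 H'] := forced_energy hF.
exists (C' * (sqnorm xbar0 + K)) => T T0.
apply: le_trans (H' _ _ T hc xs T0) _; rewrite duhamel0 ler_wpM2l // lerD2l.
exact: HK.
Qed.

End ControlLaw.

Theorem mainTheorem4 (R : realType) (N n r : nat) (rho : R)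
    (A G Gam Q : 'M[R]_n) (B : 'M[R]_(n, r)) (Rm : 'M[R]_r)
    (eta xbar0 : 'cV[R]_n) (f sg : R -> 'cV[R]_n)
    (d : measure_display) (Omega : measurableType d)
    (Pr : probability Omega R) (W : 'I_N -> R -> Omega -> R)
    (sqrtQ : 'M[R]_n) :
  (1 < N)%N ->
  0 < rho ->
  pdmx Rm ->
  Crho rho f ->
  Crho rho sg ->
  indep_brownian_motions Pr W ->
  psdmx Q ->
  is_sqrtmx Q sqrtQ ->
  observable (A - (rho / 2)%:M) sqrtQ ->
  observable (A + G - (rho / 2)%:M) (sqrtQ *m (1%:M - Gam)) ->
  let RP := riccati rho A B Rm Q in
  let RPi := riccati rho (A + G) B Rm (Qhat Q Gam) in
  let statement_i :=
    exists (P Pi : 'M[R]_n) (s xbar : R -> 'cV[R]_n),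
      [/\ (P^T = P /\ RP P) /\ (Pi^T = Pi /\ RPi Pi),
          Crho rho s /\ offset_eq rho A G Gam Q B Rm eta f Pi s,
          Crho rho xbar /\ mean_field_eq A G B Rm f xbar0 Pi s xbar &
          uniformly_stabilizing rho A G B f sg xbar0 Pr W
            (feedback B Rm P Pi xbar s)] in
  let statement_ii :=
    exists P Pi : 'M[R]_n,
      [/\ unique (fun P => pdmx P /\ RP P) P,
          unique (fun Pi => pdmx Pi /\ RPi Pi) Pi &
          hurwitz (Abar A B Rm P + G - (rho / 2)%:M)] in
  let statement_iii :=
    [/\ stabilizable (A - (rho / 2)%:M) B,
        stabilizable (A + G - (rho / 2)%:M) B &
        forall P : 'M[R]_n, pdmx P -> RP P ->
          hurwitz (Abar A B Rm P + G - (rho / 2)%:M)] in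
  (statement_i <-> statement_ii) /\ (statement_ii <-> statement_iii).
Proof.
move=> N1 rho0 Rpd fC sgC [bmW _] _ [[sqT _] sqE] obsP obsPi RP RPi.
have QC : Q = sqrtQ^T *m sqrtQ by rewrite sqT.
have QhatC : Qhat Q Gam = (sqrtQ *m (1%:M - Gam))^T *m (sqrtQ *m (1%:M - Gam)).
  by rewrite /Qhat trmx_mul QC !mulmxA.
move=> statement_i statement_ii statement_iii.
split; split.
- move=> [P [Pi [s [xbar [[[PT HP] _] [sC _] [xbarC _] stab]]]]].
  have [hM hMG] := stabilizing_hurwitz fC sgC sC xbarC N1 bmW stab.
  (* The gain of [P] stabilizes both pairs, since [Abar] plus [G] is the closed loop of [A + G]
     under it. *)
  have st1 := hurwitz_stabilizable hM.
  have st2 : stabilizable (A + G - (rho / 2)%:M) B.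
    by apply: (@hurwitz_stabilizable _ _ _ _ _ Rm P); rewrite -AbarD.
  have [P0 uP0] := riccati_exists Rpd obsP QC st1.
  have [Pi0 uPi0] := riccati_exists Rpd obsPi QhatC st2.
  exists P0, Pi0; split; [exact: uP0|exact: uPi0|].
  have [[P0p HP0] _] := uP0.
  have hM0 := riccati_pd_hurwitz Rpd obsP QC P0p HP0.
  (* The given [P] is merely symmetric, but stabilizing, and so is the positive definite [P0]; hence
     they coincide. *)
  by rewrite (riccati_unique Rpd QC P0p.1 PT HP0 HP hM0 hM).
- move=> [P [Pi [uP uPi hMG]]].
  have [[Pp HP] _] := uP; have [[Pip HPi] _] := uPi.
  have hM := riccati_pd_hurwitz Rpd obsP QC Pp HP.
  have hF := riccati_pd_hurwitz Rpd obsPi QhatC Pip HPi.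
  (* Stability under [Pi] makes the discounted offset equation antistable and the discounted mean
     field equation stable. *)
  have [s [sc sC sE]] := offset_exists Gam Q eta rho0 fC hF.
  have [xbar [xbarC xbarE]] := mean_field_exists xbar0 fC hF sc sC.
  exists P, Pi, s, xbar; split; [|exact: (conj sC sE)|exact: (conj xbarC xbarE)|].
    by split; [exact: (conj Pp.1 HP)|exact: (conj Pip.1 HPi)].
  move=> d' Om' Pr' phi mphi phiP W' C0 x adm sol.
  have bmW' i : brownian_motion Pr' (W' i) by exact: (brownian_motion_pullback mphi phiP (bmW i)).
  have [_ _ _ x0E _] := adm.
  exact: (stable_total_cost (ltnW N1) rho0 fC sgC sC xbarC hM hMG bmW' sol x0E).
- move=> [P [Pi [uP uPi hMG]]].
  have [[Pp HP] Pu] := uP; have [[Pip HPi] _] := uPi.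
  split; [exact: (riccati_stabilizable Rpd obsP QC Pp HP)|exact: (riccati_stabilizable Rpd obsPi QhatC Pip HPi)|].
  by move=> P' Pp' HP'; rewrite -(Pu P').
- move=> [st1 st2 H].
  have [P uP] := riccati_exists Rpd obsP QC st1.
  have [Pi uPi] := riccati_exists Rpd obsPi QhatC st2.
  exists P, Pi; split; [exact: uP|exact: uPi|].
  by have [[Pp HP] _] := uP; exact: H.
Qed.
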